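(* Let $T\in[0,+\infty]$, $\rho>0$, let $(\Omega,\mathcal F,\mathbb F=(\mathcal F_t)_{t\in[0,T]},\mathbb P)$ be a filtered probability space satisfying the usual conditions, and let $\mathcal G\subseteq\mathcal F$ be a $\sigma$-algebra generated by a countable partition of $\Omega$. Let $h,g:\Omega\times[0,T]\times\mathbb L^0_{\mathcal G}(\Omega,\mathcal P([0,T]))\to\mathbb R$ be running and terminal reward functions such that for every $m\in\mathbb L^0_{\mathcal G}(\Omega,\mathcal P([0,T]))$: (i) the process $(\omega,t)\mapsto e^{-\rho t}g(\omega,t,m)$ is optional, of class (D), upper semicontinuous in expectation, and has a.s. left upper-semicontinuous paths; (ii) the process $(\omega,t)\mapsto h(\omega,t,m)$ is progressively measurable with $\mathbb E\big[\int_0^T e^{-\rho t}|h(t,m)|\,dt\big]<+\infty$. Assume moreover: (a) there exist a continuous and bounded function $\hat g:[0,T]\times\mathbb R\to\mathbb R$ and a function $\hat h:[0,T]\times C\to\mathbb R$, where $C=C([0,T])$ if $T<+\infty$ and $C=C([0,+\infty))$ if $T=+\infty$, such that for every $m\in\mathbb L^0_{\mathcal G}(\Omega,\mathcal P([0,T]))$ there exists an $\mathbb F$-adapted real-valued stochastic process $X^m$ with continuous paths (i.e. with paths in $C$) with $$h(\omega,t,m)=\hat h(t,X^m(\omega))\quad\text{and}\quad g(\omega,t,m)=\hat g(t,X^m_t(\omega))\,\mathbf 1_{\{t<+\infty\}};$$ (b) whenever $m^n\to m^\infty$ weakly in probability in $\mathbb L^0_{\mathcal G}(\Omega,\mathcal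 P([0,T]))$, $$\mathbb E\Big[d_C\big(X^{m^n},X^{m^\infty}\big)+\sup_{t\in[0,T]}e^{-\rho t}\big|\hat g(t,X^{m^n}_t)-\hat g(t,X^{m^\infty}_t)\big|+\int_0^T e^{-\rho t}\big|\hat h(t,X^{m^n})-\hat h(t,X^{m^\infty})\big|\,dt\Big]\longrightarrow 0 .$$ Then there exists a strong randomized mean-field equilibrium, i.e. a pair $(m^*,\tilde\tau^* )$ with $m^*\in\mathbb L^0_{\mathcal G}(\Omega,\mathcal P([0,T]))$ and $\tilde\tau^*\in\tilde{\mathcal S}$ such that $$\tilde J(\tilde\tau^*,m^* )\ge\sup_{\tilde\tau\in\tilde{\mathcal S}}\tilde J(\tilde\tau,m^* )\quad\text{and}\quad m^*=\mathcal L\big(\tilde\tau^*\,\big|\,\mathcal G\times\{\emptyset,[0,1]\}\big).$$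
   Context: **Time set.** $[0,T]$ carries the metric $d_\rho(s,t)=|e^{-\rho t}-e^{-\rho s}|$ with $e^{-\rho(+\infty)}:=0$; it is a compact Polish space (if $T=+\infty$, the point $+\infty$ is included). **Random measures.** $\mathcal P([0,T])$ is the space of Borel probability measures on $[0,T]$ with the topology of weak convergence. $\mathbb L^0_{\mathcal G}(\Omega,\mathcal P([0,T]))$ is the space of $\mathcal G$-measurable random variables $m:\Omega\to\mathcal P([0,T])$, with convergence in probability: $m^n\to m$ ''weakly in probability'' means that every subsequence has a further subsequence along which $m^n\to m$ weakly, a.s. **Countable partition.** $\mathcal G$ is generated by a countable partition if $\mathcal G=\sigma(A_i: i\in\mathbb N)$ for a countable collection of disjoint measurable sets $A_i$ with $\bigcup_iA_i=\Omega$ and $\mathbb P(A_i)>0$ for all $i$. **Processes.** $\mathcal S$ is the set of $\mathbb F$-stopping times with values in $[0,T]$ a.s. An optional process $Y$ is of class (D) if $\{Y_\tau:\tau\in\mathcal S\}$ is uniformly integrable. It is upper semicontinuous in expectation if $\mathbb E[Y_\tau]\ge\limsup_n\mathbb E[Y_{\tau_n}]$ for every monotone sequence $(\tau_n)$ of stopping times converging a.s. to a stopping time $\tau$. Paths are left upper-semicontinuous if $Y_t\ge\limsup_{s\uparrow t}Y_s$ for all $t$. Convention: on $\{\tau=+\infty\}$, $e^{-\rho\tau}g(\tau,m):=\limsup_{t\to+\infty}e^{-\rho t}g(t,m)$. **Path space metric.** If $T<+\infty$, $d_C(x,y)=\|x-y\|_\infty$ is the uniform distance on $C([0,T])$. If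 $T=+\infty$, $d_C$ is the standard metric of uniform convergence on compact sets on $C([0,+\infty))$, e.g. $d_C(x,y)=\sum_{n\ge1}2^{-n}\frac{\sup_{t\le n}|x_t-y_t|}{1+\sup_{t\le n}|x_t-y_t|}$. When $T=+\infty$, the value at $t=+\infty$ of the expression inside the supremum in (b) is understood to be $0$. **Randomized stopping times.** Let $\tilde\Omega=\Omega\times[0,1]$, $\tilde{\mathcal F}_t=\mathcal F_t\times\mathcal B_{[0,1]}$ (product $\sigma$-algebra, $\mathcal B_{[0,1]}$ Borel), $\tilde{\mathbb P}=\mathbb P\otimes dv$ with $dv$ Lebesgue measure on $[0,1]$, and $\tilde{\mathbb E}$ the expectation under $\tilde{\mathbb P}$. A randomized stopping time is a random variable $\tilde\tau:\tilde\Omega\to[0,T]$ with $\{\tilde\tau\le t\}\in\tilde{\mathcal F}_t$ for all $t\in[0,T]$ and such that for every $\omega\in\Omega$ the map $v\mapsto\tilde\tau(\omega,v)$ is non-decreasing and left-continuous. $\tilde{\mathcal S}$ is the set of randomized stopping times. **Reward.** For $\tilde\tau\in\tilde{\mathcal S}$, $\tilde J(\tilde\tau,m)=\tilde{\mathbb E}\big[\int_0^{\tilde\tau}e^{-\rho t}h(t,m)\,dt+e^{-\rho\tilde\tau}g(\tilde\tau,m)\big]$. **Conditional law.** $\mathcal L(\tilde\tau\,|\,\mathcal G\times\{\emptyset,[0,1]\})$ is the regular conditional law of $\tilde\tau$ under $\tilde{\mathbb P}$ given $\mathcal G\times\{\emptyset,[0,1]\}$ (the sets $G\times[0,1]$,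 $G\in\mathcal G$), identified with a $\mathcal G$-measurable random measure on $\Omega$. *)

(* Defs.v *)
From HB Require Import structures.
From mathcomp Require Import all_boot all_order all_algebra.
From mathcomp Require Import all_classical all_reals all_analysis.
From mathcomp Require Import measurable_realfun lra.

Set Implicit Arguments.
Unset Strict Implicit.
Unset Printing Implicit Defensive.

Import Order.TTheory GRing.Theory Num.Theory.
Import numFieldNormedType.Exports.

Local Open Scope classical_set_scope.
Local Open Scope ring_scope.

(* Throughout, a function of time has domain [\bar R], and only its values on
   [time_set T], i.e. [0, T] with [+oo] included when [T = +oo], matter. *)
Section time.
Context {R : realType}.
Implicit Types (T t : \bar R).

Definition time_set T : set (\bar R) := [set t | (0 <= t)%E /\ (t <= T)%E].

Definition fin_time T : set R := [set r | 0 <= r /\ (r%:E <= T)%E].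

Definition path_space T : Type := continuousType (fin_time T) R.

(* [dexp rho t] is e^{- rho t}, with e^{- rho (+oo)} = 0. *)
Definition dexp (rho : R) t : R := if t is r%:E then expR (- rho * r) else 0.

Definition d_rho (rho : R) (s t : \bar R) : R := `|dexp rho t - dexp rho s|.

Lemma ltr_dexp (rho : R) (s t : \bar R) : 0 < rho ->
  (0 <= s)%E -> (s < t)%E -> dexp rho t < dexp rho s.
Proof.
move=> rho0; case: s => [s| |] // _; case: t => [t| |] // st /=.
  by rewrite ltr_expR ltr_nM2l ?oppr_lt0// -lte_fin.
exact: expR_gt0.
Qed.

(* On [0, T] the metric d_rho induces the topology of [\bar R], which is used
   below for continuity, limits and the Borel sets of [0, T]. *)
Lemma d_rho_nbhs (rho : R) (T t : \bar R) (A : set (\bar R)) :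
  0 < rho -> time_set T t ->
  within (time_set T) (nbhs t) A <->
  exists2 e : R, 0 < e & forall s, time_set T s -> d_rho rho s t < e -> A s.
Proof.
move=> rho0 [t0 tT].
have lowE (a : \bar R) : (a < t)%E -> exists2 e : R, 0 < e &
    forall s, time_set T s -> d_rho rho s t < e -> (a < s)%E.
  move=> at_; have [a0|a0] := leP 0%E a; last first.
    by exists 1 => // s [s0 _] _; exact: lt_le_trans s0.
  exists (dexp rho a - dexp rho t); first by rewrite subr_gt0 ltr_dexp.
  move=> s [s0 sT] sd; rewrite ltNge; apply/negP => sa.
  have : dexp rho a <= dexp rho s.
    move: sa; rewrite le_eqVlt => /predU1P[->//|sa]; exact/ltW/ltr_dexp.
  by move: sd; rewrite /d_rho ltr_norml => /andP[]; lra.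
have upE (a : \bar R) : (t < a)%E -> exists2 e : R, 0 < e &
    forall s, time_set T s -> d_rho rho s t < e -> (s < a)%E.
  move=> ta; exists (dexp rho t - dexp rho a); first by rewrite subr_gt0 ltr_dexp.
  move=> s [s0 sT] sd; rewrite ltNge; apply/negP => sa.
  have : dexp rho s <= dexp rho a.
    move: sa; rewrite le_eqVlt => /predU1P[->//|sa]; apply/ltW/ltr_dexp => //.
    exact: le_trans t0 (ltW ta).
  by move: sd; rewrite /d_rho ltr_norml => /andP[]; lra.
split.
- rewrite /within; case: t t0 tT lowE upE => [r| |] // t0 tT lowE upE.
  + move=> /= [e /= e0 eA].
    have [e1 e10 e1A] := lowE (r - e)%:E ltac:(rewrite lte_fin; lra).
    have [e2 e20 e2A] := upE (r + e)%:E ltac:(rewrite lte_fin; lra).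
    exists (Num.min e1 e2); first by rewrite lt_min e10.
    move=> s Ts; rewrite lt_min => /andP[/(e1A _ Ts) s1 /(e2A _ Ts) s2].
    case: s Ts s1 s2 => [s| |] //; rewrite !lte_fin => Ts s1 s2.
    by apply: eA => //=; rewrite ltr_distlC; apply/andP.
  + move=> [M [_ MA]]; have [e e0 eA] := lowE M%:E (ltry _).
    by exists e => // s Ts /(eA _ Ts) /MA; exact.
- move=> [e e0 eA]; rewrite /within /=.
  suff H : \forall s \near t, (0 <= s)%E -> d_rho rho s t < e.
    by move: H; apply: filterS => s H Ts; apply: eA => //; apply: H; case: Ts.
  have cvg0 : expR (- rho * x) @[x --> +oo] --> (0 : R).
    have : expR (- (rho * x)) @[x --> +oo] --> (0 : R).
      apply: (@cvg_comp _ _ _ (fun x : R => rho * x) (fun x => expR (- x)) _ (pinfty_nbhs R)).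
        exact: gt0_cvgMry.
      exact: cvgr_expR.
    by under eq_fun do rewrite -mulNr.
  case: t {lowE upE eA} t0 tT => [r| |] // t0 tT.
  + have : expR (- rho * x) @[x --> r] --> expR (- rho * r).
      apply: (@cvg_comp _ _ _ (fun x : R => - rho * x) expR _ (nbhs (- rho * r))).
        by apply: cvgMr; exact: cvg_id.
      exact: continuous_expR.
    move=> /cvgrPdist_lt /(_ e e0) H.
    by apply: filterS H => x + _; exact.
  + move: cvg0 => /cvgrPdist_lt /(_ e e0) [M [Mr HM]].
    exists M; split => // -[x| |]//= Mx x0.
      by rewrite /d_rho /=; exact: HM.
    by rewrite /d_rho /= subrr normr0.
Qed.

(* If [T = +oo] this is
   \sum_(n >= 1) 2^-n * sup_(s <= n) |x s - y s| / (1 + sup_(s <= n) |x s - y s|).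
   The real-valued [sup] is meaningful: the paths are continuous and each
   supremum is over a nonempty compact set of times. *)
Definition d_C T (x y : path_space T) : \bar R :=
  if T is +oo%E then
    let D (n : nat) := sup [set `|x s - y s| | s in [set s | \val s <= n%:R]] in
    (\sum_(1 <= n <oo) (2^-1 ^+ n * (D n / (1 + D n)))%:E)%E
  else (sup [set `|x s - y s| | s in [set: fin_time T]])%:E.

(* The filters of s -> t with s > t, resp. s < t, inside [0, T]. The first is
   degenerate at t = T and the second at t = 0, where the conditions below
   hold trivially, as they should. *)
Definition time_right T t := within [set s | (t < s)%E /\ time_set T s] (nbhs t).
Definition time_left T t := within [set s | (s < t)%E /\ time_set T s] (nbhs t).

Definition cadlag T (z : \bar R -> R) : Prop :=
  forall t, time_set T t ->
    z s @[s --> time_right T t] --> z t /\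
    exists l : R, z s @[s --> time_left T t] --> l.

(* Weak convergence of probability measures on [0, T]. *)
Definition weak_cvg T (mu : nat -> pprobability (\bar R) R)
    (nu : pprobability (\bar R) R) : Prop :=
  forall f : \bar R -> R, {within time_set T, continuous f} ->
    (exists M, forall t, time_set T t -> `|f t| <= M) ->
    (\int[mu n]_(t in time_set T) (f t)%:E)%E @[n --> \oo] -->
    (\int[nu]_(t in time_set T) (f t)%:E)%E.

End time.

Section filtered_space.
Context d (Omega : measurableType d) (R : realType).
Variables (P : probability Omega R) (T : \bar R).
Variable F : \bar R -> set (set Omega).
Implicit Types (Y : Omega -> \bar R -> \bar R) (tau : Omega -> \bar R).

(* The sigma-algebra of [g_sigma_algebraType H] is [H] itself when [H] is a
   sigma-algebra. *)
Definition measurable_wrt (H : set (set Omega)) d' (U : measurableType d')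
    (f : Omega -> U) : Prop :=
  measurable_fun [set: g_sigma_algebraType H] (f : g_sigma_algebraType H -> U).

Definition is_filtration : Prop :=
  (forall t, time_set T t ->
     sigma_algebra [set: Omega] (F t) /\ F t `<=` measurable) /\
  (forall s t, time_set T s -> time_set T t -> (s <= t)%E -> F s `<=` F t).

Definition usual_conditions : Prop :=
  (forall N, P.-negligible N -> F 0%E N) /\
  (forall t, time_set T t -> (t < T)%E ->
     F t = \bigcap_(s in [set s | (t < s)%E /\ time_set T s]) F s).

Definition adapted (Z : Omega -> \bar R -> R) : Prop :=
  forall t, time_set T t -> measurable_wrt (F t) (Z ^~ t).

(* The optional sigma-algebra on Omega * [0, T]. *)
Definition optional_sets : set (set (Omega * \bar R)) :=
  let D := [set: Omega] `*` time_set T in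
  <<s D, [set A | exists Z : Omega -> \bar R -> R,
           [/\ adapted Z, forall w, cadlag T (Z w) &
            exists2 B, measurable B & A = D `&` [set z | B (Z z.1 z.2)]]] >>.

Definition optional Y : Prop :=
  forall B, measurable B ->
    optional_sets (([set: Omega] `*` time_set T) `&` [set z | B (Y z.1 z.2)]).

Definition progressive (Z : Omega -> \bar R -> R) : Prop :=
  forall t, time_set T t ->
    measurable_fun ([set: g_sigma_algebraType (F t)] `*` time_set t)
      (fun z : g_sigma_algebraType (F t) * \bar R => Z z.1 z.2).

Definition stopping_time tau : Prop :=
  (forall t, time_set T t -> F t [set w | (tau w <= t)%E]) /\
  {ae P, forall w, time_set T (tau w)}.

Definition class_D Y : Prop :=
  ereal_sup [set (\int[P]_(w in [set w | (K%:E < `|Y w (tau w)|)%E])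
                    `|Y w (tau w)|)%E | tau in stopping_time]
    @[K --> +oo%R] --> 0%E.

Definition usc_in_expectation Y : Prop :=
  forall (tau : Omega -> \bar R) (taun : nat -> Omega -> \bar R),
    stopping_time tau -> (forall n, stopping_time (taun n)) ->
    (forall w, nondecreasing_seq (taun ^~ w)) \/
      (forall w, nonincreasing_seq (taun ^~ w)) ->
    {ae P, forall w, taun n w @[n --> \oo] --> tau w} ->
    (limn_esup (fun n => \int[P]_w Y w (taun n w)) <= \int[P]_w Y w (tau w))%E.

Definition left_usc_paths Y : Prop :=
  {ae P, forall w, forall t, time_set T t ->
    (limf_esup (Y w) (time_left T t) <= Y w t)%E}.

(* e^{- rho t} k(t), read at t = +oo as the limsup of e^{- rho s} k(s), s -> +oo. *)
Definition discounted (rho : R) (k : Omega -> \bar R -> R) :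
    Omega -> \bar R -> \bar R := fun w t =>
  if t is +oo%E then
    limf_esup (fun r : R => (dexp rho r%:E * k w r%:E)%:E) (pinfty_nbhs R)
  else (dexp rho t * k w t)%:E.

(* The partition is at most countable: its cells are indexed by some [I : set nat]. *)
Definition generated_by_countable_partition (G : set (set Omega)) : Prop :=
  exists (I : set nat) (A : nat -> set Omega),
    [/\ forall i, I i -> measurable (A i),
        trivIset I A,
        \bigcup_(i in I) A i = [set: Omega],
        forall i, I i -> (0 < P (A i))%E &
        G = <<s [set A i | i in I] >>].

(* G-measurable random variables with values in P([0, T]); [pprobability]
   carries the sigma-algebra generated by the evaluations mu |-> mu B, which is
   the Borel sigma-algebra of the weak topology. *)
Record random_law (G : set (set Omega)) := RandomLaw {
  law_fun :> Omega -> pprobability (\bar R) R ;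
  law_measurable : measurable_wrt G law_fun ;
  law_time_set : forall w, law_fun w (time_set T) = 1%E }.

(* Every subsequence has a further subsequence converging weakly, a.s. *)
Definition cvg_weakly_in_probability G (m : nat -> random_law G)
    (minf : random_law G) : Prop :=
  forall phi : nat -> nat, {homo phi : i j / (i < j)%N} ->
    exists2 psi : nat -> nat, {homo psi : i j / (i < j)%N} &
      {ae P, forall w, weak_cvg T (fun n => m (phi (psi n)) w) (minf w)}.

(* Omega * [0, 1] is a subset of [Omega * R], on which P (x) dv is the product
   with Lebesgue measure. *)
Definition tOmega : set (Omega * R) := [set: Omega] `*` `[0, 1].

Definition tilde_sets (t : \bar R) : set (set (Omega * R)) :=
  [set A | A `<=` tOmega /\
           @measurable _ (g_sigma_algebraType (F t) * R)%type A].

Definition randomized_stopping_time (tau : Omega * R -> \bar R) : Prop :=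
  [/\ forall z, tOmega z -> time_set T (tau z),
      forall t, time_set T t -> tilde_sets t (tOmega `&` [set z | (tau z <= t)%E]),
      forall w (u v : R), 0 <= u -> u <= v -> v <= 1 -> (tau (w, u) <= tau (w, v))%E &
      forall w (v : R), 0 < v -> v <= 1 -> tau (w, u) @[u --> v^'-] --> tau (w, v)].

Definition reward (rho : R) (G : set (set Omega))
    (h g : Omega -> \bar R -> random_law G -> R)
    (tau : Omega * R -> \bar R) (m : random_law G) : \bar R :=
  (\int[P \x lebesgue_measure]_(z in tOmega)
     (\int[lebesgue_measure]_(t in fin_time (tau z))
        (dexp rho t%:E * h z.1 t%:E m)%:E
      + discounted rho (fun w t => g w t m) z.1 (tau z)))%E.

(* [m] is the regular conditional law of [tau] under P (x) dv given the
   sigma-algebra of the sets A * [0, 1] with A in G. *)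
Definition conditional_law (G : set (set Omega)) (tau : Omega * R -> \bar R)
    (m : random_law G) : Prop :=
  forall (A : set Omega) (B : set (\bar R)), G A -> measurable B ->
    ((P \x lebesgue_measure) ((A `*` `[0%R, 1%R]) `&` (tau @^-1` B)) =
     \int[P \x lebesgue_measure]_(z in A `*` `[0%R, 1%R]) m z.1 B)%E.

End filtered_space.

(* Main.v *)
(** By (a), the reward of stopping at [t] against the law [m],
    Phi_m(w, t) = int_0^t e^{-rho s} h ds + e^{-rho t} g, is for almost every [w] a continuous
    function of [t] in [0, T] dominated by an integrable variable, and by (b) the value
    J(tau, m) is continuous in [m] uniformly in [tau]. A [G]-measurable random law is one
    law for each of the countably many cells of the partition.

    Given strategies s_0, ..., s_n, a Sperner-type argument on the simplex yields weights [y]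
    such that the mixture of the s_j with weights [y] does at least as well as every s_i against
    the law m_n that it generates; s_(n+1) is then chosen nearly optimal against m_n. Along a
    subsequence the m_n converge weakly in each cell to a limit [m]. By a Mazur argument in L^2,
    forward convex combinations of the conditional distribution functions of the mixtures
    converge almost surely, at all dense times simultaneously; the limit is an adapted increasing
    process, and its left-continuous inverse is a randomized stopping time with conditional
    law [m]. The mixture of a late stage does at least as well as the strategy that was nearly
    optimal at an early stage, and both are evaluated against laws close to [m], so the limit is
    optimal against [m]. *)

Require Import Defs.
From mathcomp Require Import all_boot zify.

Set Implicit Arguments.
Unset Strict Implicit.
Unset Printing Implicit Defensive.

(** * Rooms and doors *)

(** The difficulty is that the mixtures of different stages face different laws, so their optimality
    properties cannot be averaged directly. Stability of the value, uniform over strategies, first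
    replaces each law [m_n] by the limit [m]; the inequality that remains is linear in the
    conditional distribution functions and survives convex combinations and limits. It holds only
    for stages later than the one at which the competing strategy was chosen, which is why the
    combinations must be forward ones. Almost sure convergence lets payoffs pass to the limit path
    by path, by dominated convergence, without a compactness theory for randomized stopping times.
    The limit is known only at dense times, and at a jump it may take any value between the two
    one-sided ones; hence the approximation of continuous functions by step functions that works for
    every weight at the jumps. Countability of the partition makes the pairs of a cell and a dense
    time countable, so a single extraction produces the limit law. *)

Section dominant_sets.
Variables (X I : finType) (r : I -> X -> nat).
Hypothesis r_inj : forall i, injective (r i).

(** Primitive sets in the sense of Scarf, relative to a set of orders. They play the part of the
    simplices of a triangulation in Sperner's lemma, so that no subdivision of the simplex has to be
    built. *)
Definition dominant (J : {set I}) (S : {set X}) : bool :=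
  [forall x, exists i in J, [forall s in S, r i x <= r i s]].

Lemma dominantP (J : {set I}) (S : {set X}) : reflect
  (forall x, exists2 i, i \in J & forall s, s \in S -> r i x <= r i s)
  (dominant J S).
Proof.
apply: (iffP forallP) => H x.
  by have /exists_inP[i iJ /forall_inP] := H x; exists i.
by have [i iJ Hi] := H x; apply/exists_inP; exists i => //; apply/forall_inP.
Qed.

Lemma dominantS (J J' : {set I}) (S S' : {set X}) : J \subset J' -> S' \subset S ->
  dominant J S -> dominant J' S'.
Proof.
move=> /subsetP JJ /subsetP SS /dominantP H; apply/dominantP => x.
by have [i /JJ iJ Hi] := H x; exists i => // s /SS; exact: Hi.
Qed.

Lemma dominant_min (J : {set I}) (S : {set X}) s : dominant J S -> s \in S ->
  exists2 i, i \in J & forall s', s' \in S -> r i s <= r i s'.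
Proof. by move=> /dominantP /(_ s). Qed.

(* [p.1] is a set of points and [p.2] a set of orders. A room has as many points as
   orders, a door one order more than points; rooms and doors are adjacent when they
   differ by one point or one order, and counting incidences gives a room whose label
   set is its set of orders, as in the proof of Sperner's lemma. *)
Definition room (p : {set X} * {set I}) : bool :=
  dominant p.2 p.1 && (#|p.1| == #|p.2|).

Definition incident (d p : {set X} * {set I}) : bool :=
  ((p.2 == d.2) && [exists x in p.1, p.1 :\ x == d.1]) ||
  ((p.1 == d.1) && [exists i in ~: p.2, i |: p.2 == d.2]).

Section door_rooms.
Variables (J : {set I}) (S : {set X}).
Hypotheses (domJ : dominant J S) (cardJ : #|J| = #|S|.+1) (S0 : S != set0).

Let s0 := xchoose (set0Pn _ S0).
Let s0S : s0 \in S. Proof. exact: xchooseP. Qed.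
Let f i := [arg min_(s < s0 in S) r i s].
Let fS i : f i \in S. Proof. by rewrite /f; case: arg_minnP. Qed.
Let fmin i s : s \in S -> r i (f i) <= r i s.
Proof. by rewrite /f; case: arg_minnP => // x _ H /H. Qed.
Let funiq i s : s \in S -> (forall s', s' \in S -> r i s <= r i s') -> f i = s.
Proof.
move=> sS H; apply: (@r_inj i); apply/eqP.
by rewrite eqn_leq fmin //= H.
Qed.

Let onto (K : {set I}) : (forall s, s \in S -> exists2 i, i \in K & f i = s) ->
  f @: K = S.
Proof.
move=> H; apply/setP => s; apply/imsetP/idP => [[i _ ->]//|].
by move=> /H[i iK <-]; exists i.
Qed.

Let dom_onto (K : {set I}) : dominant K S -> f @: K = S.
Proof.
move=> dK; apply: onto => s sS.
by have [i iK H] := dominant_min dK sS; exists i => //; exact: funiq.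
Qed.

(** Dominance makes [f] map [J] onto [S]; since [J] has one element more, exactly one fibre of [f]
    is a pair. Each order of this pair will account for one adjacent room. *)
Let twins : exists j1 j2, [/\ j1 \in J, j2 \in J, j1 != j2 &
  forall i, i \in J -> f @: (J :\ i) = S <-> i = j1 \/ i = j2].
Proof.
have fJ := dom_onto domJ.
have ninj : ~ {in J &, injective f}.
  by move=> /card_in_imset; rewrite fJ cardJ => /n_Sn.
have /exists_inP[j1 j1J /exists_inP[j2 j2J /andP[j12 /eqP fj]]] :
    [exists j1 in J, exists j2 in J, (j1 != j2) && (f j1 == f j2)].
  apply: contra_notT ninj => /exists_inPn H i k iJ kJ fik; apply/eqP.
  have := H i iJ => /exists_inPn /(_ k kJ); rewrite fik eqxx andbT.
  by move=> /negPn.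
exists j1, j2; split => // i iJ; split; last first.
  have aux a b : a \in J -> b \in J -> a != b -> f a = f b -> f @: (J :\ a) = S.
    move=> aJ bJ ab fab; apply: onto => s; rewrite -fJ => /imsetP[k kJ ->].
    have [->|ka] := eqVneq k a; first by exists b => //; rewrite !inE eq_sym ab.
    by exists k => //; rewrite !inE ka.
  by move=> [->|->]; [exact: (aux _ j2)|apply: (aux _ j1) => //; rewrite eq_sym].
move=> fi.
have inji : {in J :\ i &, injective f}.
  apply/imset_injP; rewrite fi; have := cardsD1 i J; by rewrite iJ cardJ => -[->].
suff /orP[/eqP|/eqP] : (i == j1) || (i == j2) by auto.
apply: contraT; rewrite negb_or => /andP[i1 i2].
by move/inji: fj; rewrite !inE (eq_sym j1) (eq_sym j2) i1 i2 j1J j2J => /(_ isT isT)/eqP; rewrite (negbTE j12).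
Qed.

(** The points that refute dominance of [S] by [J :\ j]. As [J] does dominate, each of them lies
    below all of [S] in the order [j]. *)
Let M j := [set x | [forall i in J :\ j, exists s in S, r i s < r i x]].

Let MP j x : reflect (forall i, i \in J -> i != j -> exists2 s, s \in S & r i s < r i x)
  (x \in M j).
Proof.
rewrite inE; apply: (iffP forall_inP) => H i.
  by move=> iJ ij; apply/exists_inP/H; rewrite !inE ij.
by rewrite !inE => /andP[ij iJ]; apply/exists_inP/H.
Qed.

Let Mlt j x i : x \in M j -> i \in J -> i != j -> exists2 s, s \in S & r i s < r i x.
Proof. by move=> /MP; apply. Qed.

Let M0 j : ~~ dominant (J :\ j) S -> exists x, x \in M j.
Proof.
move=> /forallPn[x /exists_inPn H]; exists x; apply/MP => i iJ ij.
have := H i; rewrite !inE ij iJ => /(_ isT)/forall_inPn[s sS].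
by rewrite -ltnNge; exists s.
Qed.

Let Mle j x : j \in J -> x \in M j -> forall s, s \in S -> r j x <= r j s.
Proof.
move=> jJ /MP xM; have [i iJ H] := (dominantP _ _ domJ) x.
have [<-//|ij] := eqVneq i j.
by have [s /H] := xM i iJ ij; rewrite leqNgt => /negP.
Qed.

Let inc := incident (S, J).

(** If dropping [j] keeps dominance, it gives the room; otherwise the point to add is the one of
    [M j] that is highest in the order [j]. A point of [M j] is then dominated in the order [j], by
    maximality. Any other point lies below all of [S] in some order [i] different from [j], and
    there [x] is above a point of [S]. *)
Let nb_exists j : j \in J -> f @: (J :\ j) = S -> exists p, [/\ room p, inc p &
  ((p = (S, J :\ j) /\ dominant (J :\ j) S) \/ exists2 x, p = (x |: S, J) & [/\ x \notin S, x \in M j & forall y, y \in M j -> r j y <= r j x])].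
Proof.
move=> jJ fj; have [dj|dj] := boolP (dominant (J :\ j) S).
  exists (S, J :\ j); split; last by left; split.
    by rewrite /room /= dj /=; have := cardsD1 j J; rewrite jJ cardJ => -[->].
  apply/orP; right; rewrite /= eqxx /=; apply/exists_inP.
  by exists j; rewrite ?setD1K// !inE eqxx.
have [x0 x0M] := M0 dj.
have [x xM xmax] : exists2 x, x \in M j & forall y, y \in M j -> r j y <= r j x.
  by case: (@arg_maxnP _ x0 (mem (M j)) (r j) x0M) => x xM H; exists x.
have xS : x \notin S.
  apply/negP => xS; have := xS; rewrite -{1}fj => /imsetP[i].
  rewrite !inE => /andP[ij iJ] xf.
  by have /MP /(_ i iJ ij)[s /(fmin i)] := xM; rewrite xf leqNgt => /negP.
exists (x |: S, J); split; last by right; exists x.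
  rewrite /room /= cardsU1 xS cardJ eqxx andbT; apply/dominantP => y.
  have [yM|] := boolP (y \in M j).
    exists j => // s; rewrite !inE => /predU1P[->|sS]; first exact: xmax.
    exact: Mle.
  rewrite inE => /forall_inPn[i]; rewrite !inE => /andP[ij iJ] /exists_inPn H.
  exists i => // s; rewrite !inE => /predU1P[->|/H]; last by rewrite -leqNgt.
  have /MP /(_ i iJ ij)[t tS] := xM; move=> /ltnW; apply: leq_trans.
  by rewrite leqNgt; exact: H.
apply/orP; left; rewrite /= eqxx /=; apply/exists_inP; exists x; rewrite ?setU11//.
by rewrite setU1K.
Qed.

(** Conversely, every adjacent room arises in this way. When a point [x] has been added, [j] is an
    order in which [x] is the minimum of the enlarged set; the points of [S] must then be minima in
    orders other than [j]. *)
Let inc_nb p : room p -> inc p -> exists2 j, j \in J & f @: (J :\ j) = S /\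
  ((p = (S, J :\ j) /\ dominant (J :\ j) S) \/ exists2 x, p = (x |: S, J) & [/\ x \notin S, x \in M j & forall y, y \in M j -> r j y <= r j x]).
Proof.
case: p => S' J' /andP[/= dom' /eqP c'] /orP[] /andP[/eqP /= E].
- move=> /exists_inP[x xS' /eqP SS].
  have S'E : S' = x |: S by rewrite -SS setD1K.
  have xS : x \notin S by rewrite -SS !inE eqxx.
  move: E S'E => -> -> in dom' c' *; move=> {xS' SS S' J'}.
  have [j jJ Hj] := dominant_min dom' (setU11 x S).
  have fx i s : i \in J -> s \in x |: S ->
      (forall s', s' \in x |: S -> r i s <= r i s') -> s != x -> f i = s.
    move=> iJ; rewrite !inE => /predU1P[->|sS H sx]; first by rewrite eqxx.
    by apply: funiq => // s' s'S; apply: H; rewrite !inE s'S orbT.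
  have fj : f @: (J :\ j) = S.
    apply: onto => s sS; have sxS : s \in x |: S by rewrite !inE sS orbT.
    have sx : s != x by apply: contraNneq xS => <-.
    have [i iJ Hi] := dominant_min dom' sxS.
    exists i; last exact: (fx i s).
    rewrite !inE iJ andbT; apply: contraNneq sx => ij; apply/eqP.
    move: iJ Hi; rewrite ij => iJ Hi; apply: (@r_inj j); apply/eqP.
    by rewrite eqn_leq Hi ?setU11// Hj.
  have inj : {in J :\ j &, injective f}.
    by apply/imset_injP; rewrite fj; have := cardsD1 j J; rewrite jJ cardJ => -[->].
  exists j => //; split => //; right; exists x => //.
  (* The point [f i] must be the minimum of [x |: S] in some order [k]; injectivity of [f] off [j]
     forces [k = i], so [x] lies strictly above [f i] in the order [i]. *)
  have xM : x \in M j.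
    apply/MP => i iJ ij.
    have fixS : f i \in x |: S by rewrite !inE fS orbT.
    have [k kJ Hk] := dominant_min dom' fixS.
    have fk : f k = f i.
      by apply: fx => //; apply: contraNneq xS => <-.
    have kj : k != j.
      apply/eqP => kj; have := Hk x; rewrite setU11 => /(_ isT).
      rewrite kj => H1; have H2 := Hj _ fixS.
      have : f i = x by apply: (@r_inj j); apply/eqP; rewrite eqn_leq H1 H2.
      by move=> fx'; move: xS; rewrite -fx' fS.
    have ki : k = i by apply: inj; rewrite ?inE ?ij ?kj.
    exists (f i) => //; rewrite -ki ltn_neqAle fk Hk ?setU11// andbT.
    apply/eqP => /r_inj Fx; move: xS; rewrite -Fx fS //.
  split => // y /MP yM.
  have /dominantP /(_ y)[i iJ Hi] := dom'.
  have [ij|ij] := eqVneq i j; first by rewrite -ij Hi// setU11.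
  have [s sS] := yM i iJ ij.
  by have := Hi s; rewrite !inE sS orbT leqNgt => /(_ isT)/negP.
- rewrite E => /exists_inP[j]; rewrite inE => jJ' /eqP JE.
  have J'E : J' = J :\ j by rewrite -JE setU1K.
  have jJ : j \in J by rewrite -JE setU11.
  move: dom'; rewrite J'E E => dom'.
  by exists j => //; split; [apply: dom_onto|left].
Qed.

(** Each of the two orders with a common minimum yields exactly one room. The two rooms differ: a
    point in both [M j1] and [M j2] would lie, in the order [j1], below all of [S] and strictly
    above one of its points. *)
Lemma card_door_rooms : #|[set p | room p && incident (S, J) p]| = 2.
Proof.
have [j1 [j2 [j1J j2J j12 tw]]] := twins.
have f1 : f @: (J :\ j1) = S by apply/tw; auto.
have f2 : f @: (J :\ j2) = S by apply/tw; auto.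
have [p1 [r1 i1 e1]] := nb_exists j1J f1.
have [p2 [r2 i2 e2]] := nb_exists j2J f2.
have uniq j p q : j \in J ->
  ((p = (S, J :\ j) /\ dominant (J :\ j) S) \/ exists2 x, p = (x |: S, J) & [/\ x \notin S, x \in M j & forall y, y \in M j -> r j y <= r j x]) ->
  ((q = (S, J :\ j) /\ dominant (J :\ j) S) \/ exists2 x, q = (x |: S, J) & [/\ x \notin S, x \in M j & forall y, y \in M j -> r j y <= r j x]) -> p = q.
  have nodom x : dominant (J :\ j) S -> x \in M j -> False.
    move=> D xM; have [i + H] := (dominantP _ _ D) x; rewrite !inE => /andP[ij iJ].
    by have [s /H] := Mlt xM iJ ij; rewrite leqNgt => /negP.
  move=> jJ [[-> d]|[x -> [xS xM mx]]] [[-> d']|[y -> [yS yM my]]] //.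
  - by case: (nodom _ d yM).
  - by case: (nodom _ d' xM).
  - by have -> : x = y by apply: (@r_inj j); apply/eqP; rewrite eqn_leq mx ?my.
have p12 : p1 != p2.
  apply/eqP => p12; move: e1 e2; rewrite p12.
  move=> [[-> d]|[x -> [xS xM mx]]] [[E _]|[y E [yS yM my]]].
  - by case: E => E; have := j1J; rewrite -(setD1K j2J) -E !inE (negbTE j12) eqxx.
  - by case: E yS => -> _; rewrite setU11.
  - by case: E xS => <- _; rewrite setU11.
  - have xy : x = y.
      by case: E => /setP /(_ x); rewrite !inE eqxx (negbTE xS) !orbF => /esym/eqP.
    have [s sS] := Mlt yM j1J j12; rewrite -xy => ?.
    by have := Mle j1J xM sS; rewrite leqNgt => /negP.
rewrite (_ : [set p | _] = [set p1; p2]) ?cards2 ?p12//.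
apply/setP => p; rewrite !inE; apply/andP/orP => [[rp ip]|[/eqP->|/eqP->]] //.
have [j jJ [fj H]] := inc_nb rp ip.
have [jj|jj] := (tw j jJ).1 fj; subst j.
- by left; apply/eqP/(uniq j1).
- by right; apply/eqP/(uniq j2).
Qed.
End door_rooms.

Variables (l : X -> I) (i0 : I).

(** The almost completely labelled faces of Sperner's argument, with [i0] as the missing label. *)
Definition door (d : {set X} * {set I}) : bool :=
  [&& dominant d.2 d.1, #|d.1|.+1 == #|d.2|, i0 \in d.2 & l @: d.1 == d.2 :\ i0].

(** A room with a door has a point [x] such that the other points carry exactly the labels
    [J :\ i0]. If the room is not full, [l x] is not [i0]. If [l x] is in [J], it repeats the label
    of some [y], and the two doors omit [x] and [y]. If it is not, the second door adds the order
    [l x] instead of removing a point. *)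
Lemma card_room_doors p : room p -> l @: p.1 != p.2 ->
  ~~ odd #|[set d | door d && incident d p]|.
Proof.
case: p => S J /andP[/= domJ /eqP cardJ] nfull.
have [->|/set0Pn[d]] := eqVneq [set d | door d && incident d (S, J)] set0.
  by rewrite cards0.
rewrite inE => /andP[dd id].
have [x [xS i0J lx]] : exists x, [/\ x \in S, i0 \in J & l @: (S :\ x) = J :\ i0].
  case: d dd id => S' J' /and4P[/= _ /eqP c' iJ' /eqP lS'].
  move=> /orP[] /andP[/eqP /= E].
    by move=> /exists_inP[x xS /eqP SS]; exists x; rewrite SS E.
  move=> /exists_inP[i]; rewrite inE => iJ /eqP JJ'.
  have i0i : i != i0.
    apply: contra_neq nfull => ii; rewrite E lS' -JJ' ii setU1K//.
    by rewrite -ii.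
  have i0J : i0 \in J by move: iJ'; rewrite -JJ' !inE eq_sym (negbTE i0i).
  have : i \in l @: S by rewrite E lS' -JJ' !inE i0i eqxx.
  move=> /imsetP[x xS ix]; exists x; split=> //.
  have linj : {in S &, injective l}.
    apply/imset_injP; rewrite {1}E lS' -JJ' cardJ.
    by have := cardsD1 i0 J'; rewrite iJ' -JJ' cardsU1 iJ !add1n => -[->].
  have -> : J :\ i0 = (l @: S) :\ i.
    rewrite E lS' -JJ'; apply/setP => k; rewrite !inE.
    by have [->|] := eqVneq k i; rewrite ?(negbTE iJ)// andbF.
  apply/setP => k; apply/imsetP/setD1P.
    move=> [y]; rewrite !inE => /andP[yx yS] ->; split; last exact: imset_f.
    by rewrite ix; apply: contra_neq yx => /linj; apply.
  by move=> [ki /imsetP[y yS ky]]; exists y => //; rewrite !inE yS andbT; apply: contra_neq ki => yx; rewrite ky yx.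
have cSx : #|S :\ x| = #|J :\ i0|.
  by apply/eqP; move/eqP: cardJ; rewrite (cardsD1 x S) (cardsD1 i0 J) xS i0J eqn_add2l.
have linj : {in S :\ x &, injective l} by apply/imset_injP; rewrite lx cSx.
have lxi0 : l x != i0.
  apply: contra_neq nfull => lx0.
  by rewrite -(setD1K xS) imsetU1 lx lx0 setD1K.
have lS : l @: S = l x |: (J :\ i0) by rewrite -{1}(setD1K xS) imsetU1 lx.
have dI y : y \in S -> l @: (S :\ y) = J :\ i0 ->
    (S :\ y, J) \in [set d | door d && incident d (S, J)].
  move=> yS ly; rewrite inE; apply/andP; split.
    apply/and4P; split => //=; last exact/eqP.
      by apply: dominantS domJ => //; exact: subsetDl.
    by rewrite -cardJ (cardsD1 y S) yS.
  by apply/orP; left; rewrite /= eqxx; apply/exists_inP; exists y.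
have dP e : e \in [set d | door d && incident d (S, J)] ->
  (exists2 y, y \in S & e = (S :\ y, J) /\ l @: (S :\ y) = J :\ i0) \/
  (exists2 i, i \notin J & e = (S, i |: J) /\ l @: S = (i |: J) :\ i0).
  rewrite inE => /andP[]; case: e => S' J' /and4P[/= _ /eqP c' iJ' /eqP lS'].
  move=> /orP[] /andP[/eqP /= E] /exists_inP.
    by move=> [y yS /eqP SS]; left; exists y => //; rewrite E SS.
  by move=> [i]; rewrite inE => iJ /eqP JE; right; exists i => //; rewrite E JE.
have [lxJ|lxJ] := boolP (l x \in J).
  have : l x \in J :\ i0 by rewrite !inE lxi0.
  rewrite -lx => /imsetP[y ySx lxy]; have := ySx; rewrite !inE => /andP[yx yS].
  suff -> : [set d | door d && incident d (S, J)] = [set (S :\ x, J); (S :\ y, J)].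
    rewrite cards2; case: eqVneq => //= -[/setP /(_ x)].
    by rewrite !inE eqxx xS eq_sym yx.
  have ly : l @: (S :\ y) = J :\ i0.
    apply/setP => k; rewrite -lx; apply/imsetP/imsetP => -[z].
      rewrite !inE => /andP[zy zS] ->.
      by have [->|zx] := eqVneq z x; [exists y|exists z => //; rewrite !inE zx].
    rewrite !inE => /andP[zx zS] ->.
    have [->|zy] := eqVneq z y; last by exists z => //; rewrite !inE zy.
    by exists x => //; rewrite !inE eq_sym yx.
  apply/eqP; rewrite eqEsubset; apply/andP; split; apply/subsetP => e; last first.
    by rewrite !inE => /orP[]/eqP->; have := dI _ xS lx; have := dI _ yS ly; rewrite !inE.
  move=> /dP[[z zS [-> lz]]|[i iJ [_]]].
    rewrite !inE; have [->|zx] := eqVneq z x; first by rewrite eqxx.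
    have [->|zy] := eqVneq z y; first by rewrite eqxx orbT.
    have : l z \in l @: (S :\ z) by rewrite lz -lx imset_f// !inE zx.
    move=> /imsetP[t]; rewrite !inE => /andP[tz tS] lzt.
    have [tx|tx] := eqVneq t x.
      by move: lzt; rewrite tx lxy => /linj; rewrite !inE zx zS yx yS => /(_ isT isT)/eqP; rewrite (negbTE zy).
    by move/linj: lzt; rewrite !inE zx zS tx tS => /(_ isT isT)/esym/eqP; rewrite (negbTE tz).
  rewrite lS => /setP /(_ i); rewrite !inE eqxx (negbTE iJ) /= andbF andbT orbF.
  have -> : i != i0 by apply: contraNneq iJ => ->.
  by move=> /eqP il; move: iJ; rewrite il lxJ.
suff -> : [set d | door d && incident d (S, J)] = [set (S :\ x, J); (S, l x |: J)].
  rewrite cards2; case: eqVneq => //= -[_ /setP /(_ (l x))].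
  by rewrite !inE eqxx (negbTE lxJ).
apply/eqP; rewrite eqEsubset; apply/andP; split; apply/subsetP => e.
  move=> /dP[[z zS [-> lz]]|[i iJ [-> li]]].
    rewrite !inE; have [->|zx] := eqVneq z x; first by rewrite eqxx.
    have : l x \in l @: (S :\ z) by rewrite imset_f// !inE xS eq_sym zx.
    by rewrite lz !inE (negbTE lxJ) andbF.
  have -> : i = l x; last by rewrite !inE eqxx orbT.
  move: li; rewrite lS => /setP /(_ i); rewrite !inE eqxx (negbTE iJ) /= andbF andbT orbF.
  have -> : i != i0 by apply: contraNneq iJ => ->.
  by move=> /eqP.
rewrite in_set2 => /orP[]/eqP->; first exact: dI.
rewrite inE; apply/andP; split.
  apply/and4P; split => //=.
  - by apply: dominantS domJ => //; exact: subsetUr.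
  - by rewrite cardsU1 lxJ cardJ.
  - by rewrite !inE i0J orbT.
  - rewrite lS; apply/eqP/setP => k; rewrite !inE.
    by have [->|] := eqVneq k (l x); rewrite ?lxi0.
by apply/orP; right; rewrite /= eqxx; apply/exists_inP; exists (l x); rewrite ?inE.
Qed.

(** Parity of the number of incidences. The door [d0] without points meets a single room, formed by
    the highest point in the order [i0]; every other door meets two. If no room were full, every
    room would meet an even number of doors. *)
Lemma exists_full_dominant (x0 : X) :
  exists (J : {set I}) (S : {set X}), dominant J S /\ l @: S = J.
Proof.
have [/existsP[p /andP[/andP[dp _] /eqP lp]]|nofull] :=
    boolP [exists p, room p && (l @: p.1 == p.2)].
  by exists p.2, p.1.
pose d0 : {set X} * {set I} := (set0, [set i0]).
have dom0 : dominant [set i0] set0.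
  by apply/dominantP => x; exists i0 => [|s]; rewrite inE.
have dd0 : door d0.
  apply/and4P; split => //=; rewrite ?cards0 ?cards1 ?inE//.
  by rewrite imset0 setDv.
have c0 : #|[set p | room p && incident d0 p]| = 1.
  have [xm xmax] : exists xm, forall x, r i0 x <= r i0 xm.
    by case: (@arg_maxnP _ x0 predT (r i0) isT) => x _ H; exists x => y; exact: H.
  suff -> : [set p | room p && incident d0 p] = [set ([set xm], [set i0])].
    by rewrite cards1.
  apply/setP => -[S J]; rewrite !inE; apply/andP/eqP => [[/andP[/= dS /eqP c]]|[-> ->]].
    move=> /orP[] /andP[/eqP /= E].
      subst J; rewrite cards1 in c; move/eqP: c => /cards1P[x Sx] _.
      subst S; have [i] := dominantP _ _ dS xm.
      rewrite inE => /eqP -> /(_ x (set11 x)) H; congr (_, _).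
      by congr [set _]; apply: (@r_inj i0); apply/eqP; rewrite eqn_leq xmax.
    subst S; move: c; rewrite cards0 => /esym/eqP; rewrite cards_eq0 => /eqP J0.
    by have [i] := dominantP _ _ dS x0; rewrite J0 inE.
  split.
    rewrite /room /= !cards1 eqxx andbT; apply/dominantP => x.
    by exists i0 => [|s]; rewrite inE// => /eqP ->.
  by apply/orP; left; rewrite /= eqxx; apply/exists_inP; exists xm; rewrite ?inE ?setDv.
have : odd (\sum_(d | door d) #|[set p | room p && incident d p]|).
  rewrite (bigD1 d0)//= c0 oddD /= ; set s := (\sum_(_ | _) _).
  suff : ~~ odd s by move=> /negbTE ->.
  rewrite /s; elim/big_ind: _ => // [a b|[S J] /andP[/and4P[/= dS /eqP c iJ _] n0]].
    by rewrite oddD => /negbTE -> /negbTE ->.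
  rewrite card_door_rooms//; apply: contraNneq n0 => S0; subst S.
  rewrite /d0; apply/eqP; congr (_, _).
  by move/eqP: c; rewrite cards0 eq_sym => /cards1P[j Jj]; move: iJ; rewrite Jj inE => /eqP ->.
have -> : \sum_(d | door d) #|[set p | room p && incident d p]| =
   \sum_(p | room p) #|[set d | door d && incident d p]|.
  under eq_bigr do rewrite cardsE -sum1_card.
  under [RHS]eq_bigr do rewrite cardsE -sum1_card.
  rewrite (exchange_big_dep room) /=.
    by apply: eq_bigr => p rp; apply: eq_bigl => d; rewrite ?inE ?unfold_in /= rp.
  by move=> d p _; rewrite ?unfold_in => /andP[].
have : ~~ odd (\sum_(p | room p) #|[set d | door d && incident d p]|).
  elim/big_ind: _ => // [a b|p rp].
    by rewrite oddD => /negbTE -> /negbTE ->.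
  apply: card_room_doors => //; move/existsPn: nofull => /(_ p).
  by rewrite rp.
by move=> /negbTE ->.
Qed.
End dominant_sets.
(** The orders are those of the coordinates on the grid points of sum [N]. If the minima of a
    dominant set over [J] left room for a grid point exceeding all of them, dominance would fail.
    Hence these minima almost exhaust the sum [N], which forces the points to be close together and
    their coordinates outside [J] to be small. *)
Lemma grid_labelling (I : finType) (N : nat) (l : (I -> nat) -> I) :
  exists (J : {set I}) (s : I -> I -> nat), [/\ (exists j, j \in J),
    forall j, j \in J -> (\sum_i s j i = N)%N /\ l (s j) = j,
    forall j k i, j \in J -> k \in J -> (s j i <= s k i + #|I|)%N &
    forall j i, j \in J -> i \notin J -> (s j i <= #|I|)%N].
Proof.
pose i0 := l (fun=> 0%N).
pose X := {x : {ffun I -> 'I_N.+1} | (\sum_i x i == N)%N}.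
pose pt (x : X) : I -> nat := fun i => val x i.
(* Comparison of the coordinate [i], with ties broken by the enumeration of [X] so that the order is
   strict. *)
pose r i (x : X) := (pt x i * #|{: X}| + enum_rank x)%N.
have ltK (x : X) : (enum_rank x < #|{: X}|)%N by exact: ltn_ord.
have r_inj i : injective (r i).
  move=> x y; rewrite /r => H; apply: enum_rank_inj; apply: val_inj => /=.
  have := congr1 (modn^~ #|{: X}|) H; rewrite /= !modnMDl !modn_small ?ltK//.
have r_pt i x y : (r i x <= r i y)%N -> (pt x i <= pt y i)%N.
  rewrite /r => H; rewrite leqNgt; apply/negP => yx.
  have := ltK x; have := ltK y; nia.
have sum_pt x : (\sum_i pt x i = N)%N by apply/eqP; exact: (valP x).
have mkX (f : I -> nat) : (\sum_i f i = N)%N -> exists x : X, forall i, pt x i = f i.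
  move=> fN; have fle i : (f i < N.+1)%N.
    by rewrite ltnS -fN (bigD1 i)//= leq_addr.
  have P : (\sum_i [ffun i => Ordinal (fle i)] i == N)%N.
    by apply/eqP; rewrite -[RHS]fN; apply: eq_bigr => i _; rewrite ffunE.
  by exists (exist (fun x : {ffun I -> 'I_N.+1} => (\sum_i x i == N)%N) _ P) => i; rewrite /pt /= ffunE.
have [x0 _] : exists x : X, forall i, pt x i = (if i == i0 then N else 0)%N.
  by apply: mkX; rewrite -big_mkcond big_pred1_eq.
have [J [S [domJ lS]]] := exists_full_dominant r_inj (fun x => l (pt x)) i0 x0.
have [j0 j0J _] := dominantP _ _ _ domJ x0.
have s_ex j : exists x : X, j \in J -> x \in S /\ l (pt x) = j.
  have [|] := boolP (j \in J); last by exists x0.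
  by rewrite -lS => /imsetP[x xS jx]; exists x.
have [s sP] := fin_all_exists s_ex.
pose m i := pt [arg min_(y < s j0 in S) pt y i] i.
have mP i : (exists2 y, y \in S & pt y i = m i) /\ forall y, y \in S -> (m i <= pt y i)%N.
  rewrite /m; case: arg_minnP => [|y yS H]; first by case: (sP j0).
  by split => //; exists y.
(* Otherwise the point with coordinates [m i + 1] on [J], the rest of the sum being put on [j0],
   beats the minimum in every order of [J]. *)
have sum_m : (N < \sum_(i in J) (m i).+1)%N.
  rewrite ltnNge; apply/negP => mN.
  have [x xE] : exists x : X, forall i, pt x i =
     ((if i \in J then (m i).+1 else 0) + (if i == j0 then N - \sum_(i in J) (m i).+1 else 0))%N.
    apply: mkX; rewrite big_split /= -[X in (_ + X)%N]big_mkcond /= big_pred1_eq.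
    by rewrite -big_mkcond /= subnKC.
  have [i iJ H] := dominantP _ _ _ domJ x.
  have [[y yS ym] _] := mP i.
  by have := r_pt _ _ _ (H y yS); rewrite xE iJ ym; lia.
have cJ : (#|J| <= #|I|)%N := max_card _.
have sumS : (\sum_(i in J) (m i).+1 = \sum_(i in J) m i + #|J|)%N.
  by under eq_bigr do rewrite -addn1; rewrite big_split /= sum1_card.
have bound x i : x \in S -> (pt x i <= (if i \in J then m i else 0) + #|I|)%N.
  move=> xS; have := sum_pt x; rewrite (bigID (mem J))/=.
  have mle k : (m k <= pt x k)%N by apply (mP k).2.
  case: ifPn => iJ.
    rewrite (bigD1 i)//=; move: sum_m; rewrite sumS (bigD1 i)//=.
    have : (\sum_(k in J | k != i) m k <= \sum_(k in J | k != i) pt x k)%N by exact: leq_sum.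
    move: (pt x i) (m i) (\sum_(k in J | k != i) m k)%N (\sum_(k in J | k != i) pt x k)%N
      (\sum_(k | k \notin J) pt x k)%N #|J| #|I| cJ; clear; lia.
  rewrite [X in (_ + X)%N](bigD1 i)//=; move: sum_m; rewrite sumS.
  have : (\sum_(k in J) m k <= \sum_(k in J) pt x k)%N by exact: leq_sum.
  move: (pt x i) (\sum_(k in J) m k)%N (\sum_(k in J) pt x k)%N
      (\sum_(k | (k \notin J) && (k != i)) pt x k)%N #|J| #|I| cJ; clear; lia.

exists J, (fun j => pt (s j)); split.
- by exists j0.
- by move=> j /sP[_ jE]; split => //; exact: sum_pt.
- move=> j k i /sP[jS _] /sP[kS _]; apply: leq_trans (bound _ i jS) _.
  by rewrite leq_add2r; case: ifP => // _; exact: (mP i).2.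
- by move=> j i /sP[jS _] iJ; have := bound _ i jS; rewrite (negbTE iJ).
Qed.

From HB Require Import structures.
From mathcomp Require Import all_boot all_order all_algebra.
From mathcomp Require Import all_classical all_reals all_analysis.
From mathcomp Require Import measurable_realfun lra ring.

Import Order.TTheory GRing.Theory Num.Theory.
Import numFieldNormedType.Exports.

Local Open Scope classical_set_scope.
Local Open Scope ring_scope.

Lemma homo_ltn_recP (next : nat -> nat -> nat) :
  (forall N m, (m < next N m)%N) ->
  {homo (fix phi n := if n is m.+1 then next n (phi m) else next 0%N 0%N) : i j / (i < j)%N}.
Proof. by move=> H; apply: homo_ltn => [???|n]; [exact: ltn_trans|exact: H]. Qed.

(** Compactness of the cube gives one cluster point for all coordinates. As [K] is countable, the
    [n]-th term can be taken within [1/(n+1)] of it in all coordinates of code less than [n]. *)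
Lemma bounded_subsequence (R : realType) (K : countType) (u : nat -> K -> R) :
  (forall n k, `|u n k| <= 1) ->
  exists phi : nat -> nat, {homo phi : i j / (i < j)%N} /\
  exists l : K -> R, forall k, u (phi n) k @[n --> \oo] --> l k.
Proof.
move=> u1.
have [l [_ cl]] : [set f : forall k : K, R | forall k, `[-1, 1]%classic (f k)] `&`
    cluster ((u : nat -> prod_topology (fun _ : K => R)) n @[n --> \oo]) !=set0.
  apply: (@tychonoff K (fun=> R) (fun=> `[-1, 1]%classic)) => [k|].
    exact: segment_compact.
  by exists 0%N => // n _ k; rewrite /= in_itv /= -ler_norml.
have nF : Filter (nbhs (l : prod_topology (fun _ : K => R))) by exact: nbhs_filter.
have freq (N m : nat) : exists n, (m < n)%N /\
    forall k : K, (pickle k < N)%N -> `|l k - u n k| < N.+1%:R^-1.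
  pose B := [set f : forall k : K, R | forall k : K, (pickle k < N)%N -> `|l k - f k| < N.+1%:R^-1].
  have : nbhs (l : prod_topology (fun _ : K => R)) B.
    rewrite /B; elim: {1}N => [|j IH]; first by apply: filterE => f k; rewrite ltn0.
    have : nbhs (l : prod_topology (fun _ : K => R))
        [set f : forall k : K, R | forall k : K, pickle k = j -> `|l k - f k| < N.+1%:R^-1].
      case: (pselect (exists k : K, pickle k = j)) => [[k kj]|nk]; last first.
        by apply: filterE => f k kj; case: nk; exists k.
      have := @proj_continuous K (fun=> R) k l.
      move=> /cvgrPdist_lt /(_ N.+1%:R^-1); rewrite invr_gt0 ltr0n => /(_ isT).
      apply: filterS => f + k' k'j; suff -> : k' = k by [].
      by apply: (pcan_inj pickleK); rewrite kj.
    move: IH; apply: filterS2 => f H1 H2 k; rewrite ltnS leq_eqVlt.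
    by move=> /predU1P[/H2|/H1].
  move=> nB; have [] := cl [set f | exists2 n, (m < n)%N & f = u n] B _ nB.
    by exists m.+1 => // n /= mn; exists n.
  by move=> f [[n mn ->] Bf]; exists n.
have [next Hn] := choice (fun p : nat * nat => freq p.1 p.2).
pose phi := fix phi n := if n is m.+1 then next (n, phi m) else next (0%N, 0%N).
exists phi; split.
  by apply: (@homo_ltn_recP (fun N m => next (N, m))) => N m; case: (Hn (N, m)).
exists l => k; apply/cvgrPdist_lt => e e0.
have H n : (pickle k < n)%N -> `|l k - u (phi n) k| < n.+1%:R^-1.
  by case: n => // n kn; have [_ /(_ k)] := Hn (n.+1, phi n); exact.
near=> n; apply: lt_trans (H n _) _; first by near: n; exact: nbhs_infty_gt.
by near: n; exact: near_infty_natSinv_lt (PosNum e0).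
Unshelve. all: end_near. Qed.

(** * An equilibrium on the simplex *)

Lemma cvg_sum (R : realType) (I : Type) (r : seq I) (P : pred I) (f : nat -> I -> R) (l : I -> R) :
  (forall i, P i -> f n i @[n --> \oo] --> l i) ->
  \sum_(i <- r | P i) f n i @[n --> \oo] --> \sum_(i <- r | P i) l i.
Proof.
move=> fl; elim: r => [|i r IH].
  by rewrite big_nil; under eq_fun do rewrite big_nil; exact: cvg_cst.
rewrite big_cons; under eq_fun do rewrite big_cons.
by case: ifPn => // Pi; apply: cvgD => //; exact: fl.
Qed.

Definition simplex (R : realType) (I : finType) : set (I -> R) :=
  [set x | (forall i, 0 <= x i) /\ \sum_i x i = 1].

(** Each grid point is labelled by an index of largest payoff there. As the grid is refined, the
    points with the various labels in [J] merge into one point [x]: every such label is a best index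
    at [x], and the other coordinates of [x] vanish, so the mean payoff at [x] is the maximal
    one. *)
Lemma simplex_equilibrium (R : realType) (I : finType) (i0 : I) (a : I -> (I -> R) -> R) :
  (forall (x : nat -> I -> R) (y : I -> R), (forall n, simplex (x n)) -> simplex y ->
    (forall i, x n i @[n --> \oo] --> y i) ->
    forall i, a i (x n) @[n --> \oo] --> a i y) ->
  exists2 x, simplex x & forall i, a i x <= \sum_j x j * a j x.
Proof.
move=> acont.
pose scale N (s : I -> nat) : I -> R := fun i => (s i)%:R / N.+1%:R.
pose lab N s := [arg max_(i > i0) a i (scale N s)]%O.
have labP N s i : a i (scale N s) <= a (lab N s) (scale N s).
  by rewrite /lab; case: arg_maxP => // j _; exact.
have scale_simplex N s : (\sum_i s i = N.+1)%N -> simplex (scale N s).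
  move=> sN; split=> [i|]; first by rewrite divr_ge0.
  by rewrite /scale -mulr_suml -natr_sum sN divff// pnatr_eq0.
have H N := grid_labelling N.+1 (lab N).
have [J HJ] := choice H.
have [s {}HJ] := choice HJ.
have [j0 j0P] := choice (fun N => let: And4 h _ _ _ := HJ N in h).
(* The indicator of [J N] is carried along with the grid point, so that one extraction makes the
   point converge and the set stabilise. *)
pose u N (k : I + I) : R := match k with
  | inl i => scale N (s N (j0 N)) i
  | inr i => (i \in J N)%:R end.
have [|phi [phi_incr [v uv]]] := @bounded_subsequence R _ u.
  move=> N [i|i] /=; last by case: (_ \in _); rewrite ?normr1 ?normr0.
  have [_ /(_ (j0 N) (j0P N))[sN _] _ _] := HJ N.
  have [sc0 sc1] := scale_simplex _ _ sN.
  by rewrite ger0_norm// -sc1 (bigD1 i)//= lerDl sumr_ge0.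
have phi_ge n : (n <= phi n)%N.
  by elim: n => // n IH; apply: leq_ltn_trans IH (phi_incr _ _ _).
pose K := #|I|%:R : R.
have small : K / (phi n).+1%:R @[n --> \oo] --> (0 : R).
  rewrite -(mulr0 K); apply: cvgMr.
  apply: (@squeeze_cvgr _ _ _ _ (fun=> 0) (fun n => n.+1%:R^-1)).
  - apply: nearW => n; rewrite invr_ge0 ler0n /= lef_pV2 ?posrE// ler_nat ltnS.
    exact: phi_ge.
  - exact: cvg_cst.
  - exact: cvg_harmonic.
pose x : I -> R := fun i => v (inl i).
have cvg_sc (y : nat -> I -> nat) i :
    (\forall n \near \oo, (y n i <= s (phi n) (j0 (phi n)) i + #|I|)%N /\
       (s (phi n) (j0 (phi n)) i <= y n i + #|I|)%N) ->
    scale (phi n) (y n) i @[n --> \oo] --> x i.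
  move=> yP; have ux : u (phi n) (inl i) @[n --> \oo] --> x i := uv (inl i).
  apply: (@squeeze_cvgr _ _ _ _ (fun n => u (phi n) (inl i) - K / (phi n).+1%:R)
      (fun n => u (phi n) (inl i) + K / (phi n).+1%:R)).
  - apply: filterS yP => n [y1 y2]; rewrite /= /scale -mulrBl -mulrDl.
    rewrite !ler_pM2r ?invr_gt0 ?ltr0n// lerBlDr /K -!natrD !ler_nat.
    by apply/andP.
  - by rewrite -[x i]subr0; exact: cvgB.
  - by rewrite -[x i]addr0; exact: cvgD.
(* A convergent indicator is eventually constant; the threshold 1/2 reads off its value. *)
pose Js : {set I} := [set i | 2^-1 < v (inr i)]%SET.
have JsE i : \forall n \near \oo, (i \in J (phi n)) = (i \in Js).
  have /cvgrPdist_lt /(_ 2^-1) := uv (inr i).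
  rewrite invr_gt0 ltr0n => /(_ isT); apply: filterS => n /=; rewrite inE.
  by case: (i \in J _) => /=; rewrite ?subr0 ltr_norml => /andP[]; lra.
(* For an index outside [J] the base point is used, so that every [y i] is a full sequence
   converging to [x]. *)
pose y i n := if i \in J (phi n) then s (phi n) i else s (phi n) (j0 (phi n)).
have yJ i n : exists2 j, j \in J (phi n) & y i n = s (phi n) j.
  by rewrite /y; case: ifPn => iJ; [exists i|exists (j0 (phi n))].
have y_simplex i n : simplex (scale (phi n) (y i n)).
  have [j jJ ->] := yJ i n; apply: scale_simplex.
  by have [_ /(_ j jJ)[]] := HJ (phi n).
have y_cvg i k : scale (phi n) (y i n) k @[n --> \oo] --> x k.
  apply: cvg_sc; apply: nearW => n; have [j jJ ->] := yJ i n.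
  by have [_ _ H3 _] := HJ (phi n); split; apply: H3.
have xS : simplex x.
  split=> [i|].
    rewrite -(cvg_lim (@Rhausdorff R) (y_cvg i0 i)); apply: limr_ge.
      exact: cvgP (y_cvg i0 i).
    by apply: nearW => n; exact: (y_simplex i0 n).1.
  have : \sum_i (scale (phi n) (y i0 n) i) @[n --> \oo] --> \sum_i x i.
    by apply: cvg_sum => i _; exact: y_cvg.
  under eq_fun do rewrite (y_simplex i0 _).2.
  by move=> /cvg_lim <- //; rewrite lim_cst.
have x0 i : i \notin Js -> x i = 0.
  move=> iJ; have := cvg_lim (@Rhausdorff R) (uv (inl i)); rewrite -/(x i) => <-.
  apply: cvg_lim => //; apply: (@squeeze_cvgr _ _ _ _ (fun=> 0)
     (fun n => K / (phi n).+1%:R)) => //; last exact: cvg_cst.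
  apply: filterS (JsE i) => n; rewrite (negbTE iJ) => /negbT iJn.
  rewrite /= /scale divr_ge0//= ler_pM2r ?invr_gt0 ?ltr0n// ler_nat.
  by have [_ _ _] := HJ (phi n); apply.
have xmax j i : j \in Js -> a i x <= a j x.
  move=> jJ; have ac := acont _ _ (y_simplex j) xS (y_cvg j).
  apply: (ler_cvg_to (ac i) (ac j)).
  apply: filterS (JsE j) => n; rewrite jJ => jJn.
  rewrite /y jJn; have [_ /(_ j jJn)[_ E] _ _] := HJ (phi n).
  by have := labP (phi n) (s (phi n) j) i; rewrite E.
exists x => // i; rewrite -[a i x]mul1r -xS.2 mulr_suml ler_sum// => j _.
have [jJ|/x0 ->] := boolP (j \in Js); last by rewrite !mul0r.
by rewrite ler_wpM2l ?xmax//; exact: xS.1.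
Qed.

(** * Forward convex combinations *)

Section mazur.
Context d (Omega : measurableType d) (R : realType) (P : probability Omega R).
Implicit Types f g : nat -> Omega -> R.

(** The weights [2^-(k+1)] add up to one: the energy of functions with values in [0, 1] is at most
    one, and it controls all coordinates [k] together. *)
Definition sq_sum f (w : Omega) : \bar R :=
  (\sum_(k <oo) (1 / (2 ^ k.+1)%:R * f k w ^+ 2)%:E)%E.

Definition energy f : \bar R := (\int[P]_w sq_sum f w)%E.

Let term_ge0 f k w : (0 <= (1 / (2 ^ k.+1)%:R * f k w ^+ 2)%:E)%E.
Proof. by rewrite lee_fin; apply: mulr_ge0; [exact: divr_ge0|exact: sqr_ge0]. Qed.

Lemma sq_sum_ge0 f w : (0 <= sq_sum f w)%E.
Proof. by apply: nneseries_ge0 => k _ _; exact: term_ge0. Qed.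

Lemma measurable_sq_sum f : (forall k, measurable_fun setT (f k)) ->
  measurable_fun setT (sq_sum f).
Proof.
move=> mf; rewrite /sq_sum.
apply: (@ge0_emeasurable_sum _ _ _ setT _ xpredT) => [k w _ _|k _].
  exact: term_ge0.
by apply/measurable_EFinP; apply: measurable_funM => //; exact: measurable_funX.
Qed.

Lemma energy_ge0 f : (0 <= energy f)%E.
Proof. by apply: integral_ge0 => w _; exact: sq_sum_ge0. Qed.

Lemma energy_le1 f : (forall k, measurable_fun setT (f k)) ->
  (forall k w, 0 <= f k w <= 1) -> (energy f <= 1)%E.
Proof.
move=> mf f01; rewrite -(@probability_setT _ _ _ P) -[leRHS]mul1e -integral_cst//.
apply: ge0_le_integral => //; first by move=> w _; exact: sq_sum_ge0.
  exact: measurable_sq_sum.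
move=> w _; apply: le_trans (epsilon_trick0 xpredT ler01).
apply: lee_nneseries => k _; first by move=> _; exact: term_ge0.
have /andP[f0 f1] := f01 k w.
by rewrite lee_fin ler_piMr ?divr_ge0// expr_le1.
Qed.

Lemma energy_parallelogram (x y m g : nat -> Omega -> R) :
  (forall k, measurable_fun setT (m k)) -> (forall k, measurable_fun setT (g k)) ->
  (forall k w, x k w = m k w + g k w) -> (forall k w, y k w = m k w - g k w) ->
  (forall k, measurable_fun setT (x k)) -> (forall k, measurable_fun setT (y k)) ->
  (energy x + energy y = (energy m + energy m) + (energy g + energy g))%E.
Proof.
move=> mm mg xE yE mx my; rewrite /energy.
have D a b : (forall k, measurable_fun setT (a k)) -> (forall k, measurable_fun setT (b k)) ->
   (energy a + energy b = \int[P]_w (sq_sum a w + sq_sum b w))%E.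
  move=> ma mb; rewrite ge0_integralD//; do ?[by move=> w _; exact: sq_sum_ge0];
  exact: measurable_sq_sum.
rewrite -/(energy _) -/(energy _) -/(energy _) -/(energy _) !D//.
rewrite -ge0_integralD//; last 4 first.
  by move=> w _; rewrite adde_ge0// sq_sum_ge0.
  by apply: emeasurable_funD; exact: measurable_sq_sum.
  by move=> w _; rewrite adde_ge0// sq_sum_ge0.
  by apply: emeasurable_funD; exact: measurable_sq_sum.
apply: eq_integral => w _; rewrite /sq_sum -!nneseriesD;
  try by move=> *; rewrite ?adde_ge0 ?term_ge0.
apply: eq_eseriesr => k _; rewrite -!EFinD; congr EFin.
rewrite xE yE; lra.
Qed.

Variables (E : Type) (mid : E -> E -> E) (B : E -> nat -> Omega -> R).
Hypothesis mB : forall x k, measurable_fun setT (B x k).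
Hypothesis B01 : forall x k w, 0 <= B x k w <= 1.
Hypothesis Bmid : forall x y k w, B (mid x y) k w = (B x k w + B y k w) / 2.

(** The closure of a tail under [mid], encoded as an intersection of closed predicates, so that
    using a membership is an induction. Midpoints suffice, and the convex weights are dyadic. *)
Definition tail_hull (x : nat -> E) (n : nat) (z : E) : Prop :=
  forall Q : E -> Prop, (forall a b, Q a -> Q b -> Q (mid a b)) ->
    (forall l, (n <= l)%N -> Q (x l)) -> Q z.

Lemma tail_hullS x m n z : (m <= n)%N -> tail_hull x n z -> tail_hull x m z.
Proof. by move=> mn H Q Qm Qx; apply: (H Q Qm) => l nl; apply: Qx; exact: leq_trans nl. Qed.

Lemma tail_hull_mid x n a b : tail_hull x n a -> tail_hull x n b -> tail_hull x n (mid a b).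
Proof. by move=> Ha Hb Q Qm Qx; exact: (Qm _ _ (Ha Q Qm Qx) (Hb Q Qm Qx)). Qed.

Let en z := fine (energy (B z)).

Let energyE z : energy (B z) = (en z)%:E.
Proof.
rewrite /en fineK// ge0_fin_numE ?energy_ge0//.
by rewrite (le_lt_trans (energy_le1 (mB z) (B01 z)))// ltry.
Qed.

Let en_ge0 z : 0 <= en z.
Proof. by rewrite fine_ge0// energy_ge0. Qed.

Let en_le1 z : en z <= 1.
Proof. by rewrite -lee_fin -energyE; apply: energy_le1 => *; [exact: mB|exact: B01]. Qed.

Let dif a b : nat -> Omega -> R := fun k w => (B a k w - B b k w) / 2.

Let mdif a b k : measurable_fun setT (dif a b k).
Proof. by apply: measurable_funM => //; exact: measurable_funB. Qed.

Let energy_dif a b :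
  energy (dif a b) = ((en a + en b) / 2 - en (mid a b))%:E.
Proof.
have := @energy_parallelogram (B a) (B b) (B (mid a b)) (dif a b) (mB _) (mdif a b).
rewrite !energyE => /(_ _ _ (mB _) (mB _)) H.
have {}H : ((en a)%:E + (en b)%:E = ((en (mid a b))%:E + (en (mid a b))%:E)
    + (energy (dif a b) + energy (dif a b)))%E.
  by apply: H => k w; rewrite Bmid /dif; lra.
have : (0 <= energy (dif a b))%E by exact: energy_ge0.
move: H; case: (energy _) => [r| |]//; rewrite -!EFinD => -[H] _; congr EFin.
by move: H; lra.
Qed.

Variable x : nat -> E.

Let lev n := inf [set en z | z in tail_hull x n].
Let alpha := sup (range lev).

Let lev_le n z : tail_hull x n z -> lev n <= en z.
Proof.
move=> zn; apply: ge_inf; last by exists z.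
by exists 0 => _ [t _ <-].
Qed.

Let lev_has_inf n : has_inf [set en z | z in tail_hull x n].
Proof.
split; last by exists 0 => _ [t _ <-].
by exists (en (x n)), (x n) => // Q Qm; apply.
Qed.

Let lev_has_sup : has_sup (range lev).
Proof.
split; first by exists (lev 0%N), 0%N.
exists 1 => _ [n _ <-]; apply: le_trans (en_le1 (x n)); apply: lev_le.
by move=> Q Qm; apply.
Qed.

Let nearly_min (e : R) (j : nat) : 0 < e -> exists n, exists z,
  [/\ (j <= n)%N, tail_hull x n z, en z <= alpha + e &
      forall t, tail_hull x n t -> alpha - e <= en t].
Proof.
move=> e0; have [_ [n0 _ <-] n0P] := sup_adherent e0 lev_has_sup.
pose n := maxn j n0.
have [_ [z zn <-] zP] := inf_adherent e0 (lev_has_inf n).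
exists n, z; split => //; first exact: leq_maxl.
  apply/ltW/(lt_le_trans zP); rewrite lerD2r; apply: ub_le_sup; last by exists n.
  exact: lev_has_sup.2.
move=> t tn; apply/ltW/(lt_le_trans n0P)/lev_le; apply: tail_hullS tn.
exact: leq_maxr.
Qed.

(** The least energies [lev n] of the tail hulls increase to [alpha]. Near-minimisers, taken in
    hulls whose energies are all almost at least [alpha], have midpoints whose energy is not much
    below [alpha] either; the parallelogram identity then makes their differences small. No weak
    compactness is involved. *)
Lemma mazur : exists y : nat -> E, (forall n, tail_hull x n (y n)) /\
  {ae P, forall w, forall k, cvgn (fun n => B (y n) k w)}.
Proof.
(* The tolerance [8^-j / 2] makes the energy of the [j]-th difference at most [8^-j]; after the
   factor [4^j] in [S] below, a summable [2^-j] remains. *)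
pose del j : R := (8%:R ^+ j)^-1 / 2.
have del0 j : 0 < del j by rewrite divr_gt0// invr_gt0 exprn_gt0.
have [n] := choice (fun j => nearly_min j (del0 j)).
move=> /choice[y yP]; exists y; split.
  by move=> j; have [jn yn _ _] := yP j; exact: tail_hullS yn.
pose g j := dif (y j) (y j.+1).
have gE j : (energy (g j) <= (8^-1 ^+ j)%:E)%E.
  rewrite energy_dif lee_fin; have [_ h1 u1 l1] := yP j.
  have [_ h2 u2 l2] := yP j.+1.
  have dd : del j.+1 <= del j.
    rewrite ler_pM2r ?invr_gt0// lef_pV2 ?posrE ?exprn_gt0//.
    by rewrite exprS ler_peMl ?exprn_ge0// ler1n.
  have : alpha - del j <= en (mid (y j) (y j.+1)).
    (* The ranks [n j] need not increase; the midpoint is placed in the larger of the two hulls,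
       that of the smaller rank. *)
    have [nn|nn] := leqP (n j) (n j.+1).
      by apply: l1; apply: tail_hull_mid => //; exact: tail_hullS h2.
    apply: (@le_trans _ _ (alpha - del j.+1)); first by rewrite lerD2l lerN2.
    by apply: l2; apply: tail_hull_mid => //; apply: tail_hullS h1; exact: ltnW.
  have : (8^-1 ^+ j) = del j + del j by rewrite /del exprVn; lra.
  by lra.
pose S w := (\sum_(j <oo) ((4%:R ^+ j)%:E * sq_sum (g j) w))%E.
have mS0 j : measurable_fun setT (fun w => ((4%:R ^+ j)%:E * sq_sum (g j) w)%E).
  apply: measurable_funeM; apply: measurable_sq_sum => k; exact: mdif.
have S0 j w : (0 <= (4%:R ^+ j)%:E * sq_sum (g j) w)%E.
  by rewrite mule_ge0 ?sq_sum_ge0// lee_fin exprn_ge0.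
have mS : measurable_fun setT S.
  by apply: (@ge0_emeasurable_sum _ _ _ setT _ xpredT).
have intS : (\int[P]_w S w < +oo)%E.
  rewrite integral_nneseries//.
  apply: (@le_lt_trans _ _ (\sum_(i <oo) (2 / (2 ^ i.+1)%:R)%:E)%E); last first.
    by apply: le_lt_trans (epsilon_trick0 xpredT (ler0n _ _)) _; exact: ltry.
  apply: lee_nneseries => j _; first by move=> _; exact: integral_ge0.
  have msq : measurable_fun setT (sq_sum (g j)).
    by apply: measurable_sq_sum => k; exact: mdif.
  rewrite ge0_integralZl//; last by move=> w _; exact: sq_sum_ge0.
  apply: le_trans (lee_wpmul2l _ (gE j)) _; first by rewrite lee_fin exprn_ge0.
  rewrite -EFinM lee_fin -exprMn expnS natrM invfM mulrA divff// mul1r natrX -exprVn.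
  by rewrite (_ : 4 * 8^-1 = 2^-1 :> R)//; lra.
have iS : P.-integrable setT S.
  apply/integrableP; split => //.
  under eq_integral do rewrite gee0_abs ?nneseries_ge0//.
  exact: intS.
have := integrable_ae measurableT iS; apply: filterS => w /(_ I) Sfin k.
(* Finiteness of [S w] bounds [4^j] times the weighted square of a single coordinate, hence the
   coordinate itself by a constant times [2^-j]. *)
have gb j : `|g j k w| <= Num.sqrt (fine (S w) * (2 ^ k.+1)%:R) * 2^-1 ^+ j.
  have : ((4%:R ^+ j)%:E * (1 / (2 ^ k.+1)%:R * g j k w ^+ 2)%:E <= S w)%E.
    apply: le_trans (nneseries_lim_ge j.+1 _); last by move=> *; exact: S0.
    rewrite big_nat_recr//= -[leLHS]add0e; apply: leeD; first exact: sume_ge0.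
    apply: lee_wpmul2l; first by rewrite lee_fin exprn_ge0.
    apply: le_trans (nneseries_lim_ge k.+1 _); last by move=> *; exact: term_ge0.
    rewrite big_nat_recr//= -[leLHS]add0e; apply: leeD => //.
    by apply: sume_ge0 => *; exact: term_ge0.
  rewrite -(fineK Sfin) -EFinM lee_fin => H.
  have S_ge0 : 0 <= fine (S w) by rewrite fine_ge0// nneseries_ge0.
  have K0 : 0 < (2 ^ k.+1)%:R :> R by rewrite ltr0n expn_gt0.
  have P4 : (2^-1 ^+ j) ^+ 2 * 4%:R ^+ j = 1 :> R.
    rewrite -exprM mulnC exprM -exprMn (_ : _ * _ = 1) ?expr1n//.
    by rewrite expr2; lra.
  have C0 : 0 <= Num.sqrt (fine (S w) * (2 ^ k.+1)%:R) * 2^-1 ^+ j.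
    by apply: mulr_ge0; rewrite ?sqrtr_ge0 ?exprn_ge0.
  rewrite -(@ler_pXn2r _ 2) ?nnegrE//.
  rewrite exprMn sqr_sqrtr ?mulr_ge0//.
  rewrite real_normK ?num_real//.
  have -> : g j k w ^+ 2 = (4 ^+ j * (1 / (2 ^ k.+1)%:R * g j k w ^+ 2)) * (2 ^ k.+1)%:R * (2^-1 ^+ j) ^+ 2.
    rewrite -[LHS]mul1r -{1}P4; move: K0; set K := _%:R; set a := _ ^+ 2; set b := 4 ^+ j.
    by move=> K0; field; rewrite gt_eqF.
  rewrite ler_wpM2r ?exprn_ge0 ?invr_ge0//.
  by rewrite ler_pM2r.
have : cvgn (series (telescope (fun n => B (y n) k w))).
  apply: normed_cvg; apply: (@series_le_cvg _ _ (fun j => 2 * (Num.sqrt (fine (S w) * (2 ^ k.+1)%:R) * 2^-1 ^+ j))) => //.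
  - by move=> i; exact: normr_ge0.
  - move=> i; rewrite /telescope/=.
    have -> : B (y i.+1) k w - B (y i) k w = - 2 * g i k w by rewrite /g /dif; lra.
    by rewrite normrM normrN normr_nat -subr_ge0 -mulrBr mulr_ge0// subr_ge0.
  - under eq_fun do rewrite mulrA.
    apply: (@is_cvg_geometric_series R (2 * Num.sqrt (fine (S w) * (2 ^ k.+1)%:R)) 2^-1).
    by rewrite ger0_norm ?invr_ge0// invf_lt1// ltr1n.
rewrite telescopeK => H.
have -> : (fun n => B (y n) k w) = (fun n => (B (y n) k w - B (y 0%N) k w) + B (y 0%N) k w).
  by apply/funext => n'; rewrite subrK.
by apply: is_cvgD => //; exact: is_cvg_cst.
Qed.
End mazur.

(** * Distribution functions and weak limits on [0, T] *)

Section times.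
Context {R : realType}.
Implicit Types T s t q : \bar R.

Lemma time_setE T : time_set T = [set` `[0%E, T]].
Proof.
by apply/seteqP; split => t /=; rewrite in_itv /= => /andP.
Qed.

Lemma measurable_time_set T : measurable (time_set T).
Proof. by rewrite time_setE; exact: emeasurable_itv. Qed.

Lemma time_set0 T : (0 <= T)%E -> time_set T 0%E.
Proof. by move=> T0; split. Qed.

(** Index 0 is [T] itself, so that the total mass one at [T] passes to limits; codes that do not
    give a rational of [0, T] are sent to time 0. *)
Definition dense_time T (k : nat) : \bar R :=
  if k is j.+1 then
    if unpickle j is Some r then
      if (0 <= ratr r :> R) && ((ratr r)%:E <= T)%E then (ratr r)%:E else 0%E
    else 0%E
  else T.

Lemma dense_timeP T k : (0 <= T)%E -> time_set T (dense_time T k).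
Proof.
move=> T0; case: k => [|k] /=; first by split.
case: (unpickle k) => [r|]; last exact: time_set0.
by case: ifPn => [/andP[]|_]; [split|exact: time_set0].
Qed.

Lemma dense_time_dense T s t : time_set T s -> time_set T t -> (s < t)%E ->
  exists k, (s < dense_time T k < t)%E.
Proof.
case: s => [s| |]; last 2 first.
- by move=> _ _; rewrite ltNge leey.
- by case.
move=> [s0 _] [_ tT] st; have [t' st' t't] : exists2 t', s < t' & (t'%:E <= t)%E.
  case: t st tT => [t| |] // st _; first by exists t => //; rewrite -lte_fin.
  by exists (s + 1); rewrite ?ltrDl ?leey.
have [r] := rat_in_itvoo st'; rewrite in_itv /= => /andP[sr rt'].
exists (pickle r).+1; rewrite /= pickleK.
have rt : ((ratr r)%:E < t)%E by apply: lt_le_trans t't; rewrite lte_fin.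
have -> : 0 <= ratr r :> R by apply: ltW; apply: le_lt_trans sr; rewrite -lee_fin.
by rewrite (ltW (lt_le_trans rt tT)) /= lte_fin sr rt.
Qed.

(* The value at the jump is a parameter because a limit of distribution functions
   is only known to lie between the measures of [t < q] and of [t <= q]. *)
Definition cut_off (kap : \bar R -> R) q t : R :=
  if (t < q)%E then 1 else if t == q then kap q else 0.

Definition step_fun (kap : \bar R -> R) (L : seq (R * \bar R)) t : R :=
  \sum_(p <- L) p.1 * cut_off kap p.2 t.

Definition jump_weight T (kap : \bar R -> R) := (forall q, 0 <= kap q <= 1) /\ kap T = 1.

(** This bound makes products with a cut-off convex weights, which is how they are used in the
    approximation below. *)
Lemma cut_off01 kap q t : (forall q, 0 <= kap q <= 1) -> 0 <= cut_off kap q t <= 1.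
Proof.
by move=> k01; rewrite /cut_off; case: ifP => _; [rewrite lexx ler01|case: ifP => // _; rewrite lexx ler01].
Qed.

(** A step function is cut down at [q] by multiplication. The weight of the first factor at [q] is
    reset to one, since otherwise [kap q] would enter twice when [q' = q]. *)
Lemma cut_off_min kap q q' t :
  cut_off kap (Order.min q' q) t =
  cut_off (fun s => if s == q then 1 else kap s) q' t * cut_off kap q t.
Proof.
rewrite /cut_off; have [qq|qq|qq] := ltgtP q' q.
- have [tq|tq|tq] := ltgtP t q'; rewrite ?mul0r//.
    by rewrite (lt_trans tq qq) mulr1.
  by rewrite tq qq mulr1.
- have [tq|tq|tq] := ltgtP t q; rewrite ?mulr0//.
    by rewrite (lt_trans tq qq) mulr1.
  by rewrite tq qq mul1r.
- rewrite qq; have [tq|tq|tq] := ltgtP t q; rewrite ?mulr0 ?mulr1//.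
  by rewrite mul1r.
Qed.

(** One list [L] serves all jump weights: at a jump, the value is a convex combination of two values
    within [e] of [f]. Existence is the compactness of [0, T], in the form of a supremum argument on
    the part already covered. Weight one at [T] makes [cut_off kap T] constant there, so constants
    are step functions. *)
Lemma step_fun_approx T (f : \bar R -> R) (e : R) : (0 <= T)%E -> 0 < e ->
  {within time_set T, continuous f} ->
  exists L : seq (R * \bar R), (forall p, p \in L -> exists k, p.2 = dense_time T k) /\
    forall kap, jump_weight T kap -> forall t, time_set T t ->
      `|f t - step_fun kap L t| <= e.
Proof.
move=> T0 e0 cf.
pose good x := exists L : seq (R * \bar R),
  (forall p, p \in L -> exists k, p.2 = dense_time T k) /\
  forall kap, jump_weight T kap -> forall t, time_set T t -> (t <= x)%E ->
      `|f t - step_fun kap L t| <= e.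
suff [L [LD Lf]] : good T by exists L; split => // kap kT t Tt; apply: Lf => //; exact: Tt.2.
have cutT kap t : jump_weight T kap -> time_set T t -> cut_off kap T t = 1.
  move=> [_ kT] [_]; rewrite /cut_off le_eqVlt => /predU1P[->|->//].
  by rewrite ltxx eqxx.
have osc x : time_set T x -> exists p p' : \bar R, [/\ (p < x)%E, (x < T)%E -> (x < p')%E,
    x = T -> p' = T, (p' <= T)%E &
    forall t, time_set T t -> (p <= t)%E -> (t <= p')%E -> `|f t - f x| <= e].
  move=> Tx; have : within (time_set T) (nbhs x) [set t | `|f t - f x| <= e].
    have := cf x; rewrite /continuous_at => /cvgrPdist_le /(_ e e0).
    rewrite nbhs_subspace_in//; apply: filterS => t; rewrite /= distrC//.
  rewrite /within /=; case: x Tx => [x| |] Tx; last 2 first.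
  - have TE : T = +oo%E by apply/eqP; rewrite -leye_eq; exact: Tx.2.
    move=> [M [_ MA]]; exists (M + 1)%:E, T; split => //; first exact: ltry.
    move=> t Tt Mt _; apply: MA => //; apply: lt_le_trans Mt.
    by rewrite lte_fin ltrDl.
  - by case: Tx.
  move=> [r /= r0 rA].
  have near t : time_set T t -> ((x - r / 2)%:E <= t)%E -> (t <= (x + r / 2)%:E)%E ->
      `|f t - f x%:E| <= e.
    case: t => [t| |] Tt //; rewrite !lee_fin => t1 t2; apply: rA => //.
    by rewrite /ball /= ltr_norml; apply/andP; split; lra.
  exists (x - r / 2)%:E, (Order.min T (x + r / 2)%:E); split.
  - by rewrite lte_fin; lra.
  - by move=> xT; rewrite lt_min xT lte_fin; lra.
  - by move=> <-; apply/min_idPl; rewrite lee_fin; lra.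
  - by rewrite ge_min lexx.
  - by move=> t Tt t1; rewrite le_min => /andP[_ t2]; exact: near.
pose S := [set x | time_set T x /\ good x].
have goodS x y : (y <= x)%E -> good x -> good y.
  move=> yx [L [LD Lf]]; exists L; split => // kap kT t Tt ty.
  by apply: Lf => //; exact: le_trans yx.
have extend x p p' : time_set T x -> (p < x)%E -> (p' <= T)%E ->
    (forall t, time_set T t -> (p <= t)%E -> (t <= p')%E -> `|f t - f x| <= e) ->
    (p < 0)%E \/ (exists2 y, (p < y)%E & S y) -> good p'.
  move=> Tx px p'T near; have [p0 _|p0 [|[y py [Ty [L [LD Lf]]]]]] := ltP p 0%E.
  - exists [:: (f x, T)]; split; first by move=> q; rewrite inE => /eqP ->; exists 0%N.
    move=> kap kT t Tt tp'; rewrite /step_fun big_seq1 /= cutT// mulr1.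
    by apply: near => //; apply: ltW; apply: lt_le_trans p0 _; exact: Tt.1.
  - by [].
  have Tp : time_set T p by split => //; apply: le_trans (ltW px) Tx.2.
  have [k /andP[pk ky]] := dense_time_dense Tp Ty py.
  set q := dense_time T k in pk ky.
  have Tq : time_set T q by exact: dense_timeP.
  (* The old list is cut at a dense time [q] and continued by the constant [f x], written as [f x]
     times the cut-off at [T] minus [f x] times the cut-off at [q]. *)
  exists ([seq (p.1, Order.min p.2 q) | p <- L] ++ [:: (f x, T); (- f x, q)]); split.
    move=> c; rewrite mem_cat => /orP[/mapP[b /LD[j bj] ->]/=|].
      by rewrite bj minEle; case: ifP => _; [exists j|exists k].
    by rewrite !inE => /orP[/eqP->|/eqP->]; [exists 0%N|exists k].
  move=> kap kT t Tt tp'.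
  pose kap' s := if s == q then 1 else kap s.
  have kT' : jump_weight T kap'.
    by split => [s|]; rewrite /kap'; case: ifP => // _; [rewrite ler01 lexx|exact: kT.1|exact: kT.2].
  have -> : step_fun kap ([seq (p.1, Order.min p.2 q) | p <- L] ++ [:: (f x, T); (- f x, q)]) t
     = step_fun kap' L t * cut_off kap q t + f x * (1 - cut_off kap q t).
    rewrite /step_fun big_cat big_map /= big_cons big_seq1 /= cutT//.
    rewrite mulr_suml mulrBr mulNr mulr1; congr (_ + _).
    by apply: eq_bigr => b _; rewrite cut_off_min mulrA.
  have /andP[th0 th1] := cut_off01 q t kT.1.
  have h1 : 0 < cut_off kap q t -> `|f t - step_fun kap' L t| <= e.
    move=> th; apply: Lf => //; apply: le_trans (ltW ky).
    rewrite leNgt; apply: contraTN th => qt.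
    by rewrite /cut_off (lt_gtF qt) gt_eqF// ltxx.
  have h2 : cut_off kap q t < 1 -> `|f t - f x| <= e.
    move=> th; apply: near => //; apply: le_trans (ltW pk) _.
    by rewrite leNgt; apply: contraTN th => tq; rewrite /cut_off tq ltxx.
  move: h1 h2 th0 th1; set th := cut_off _ _ _; set a := step_fun _ _ _.
  rewrite [0 <= th]le_eqVlt => h1 h2 /predU1P[th0|th0].
    by rewrite -th0 mulr0 add0r subr0 mulr1 => _; apply: h2; rewrite -th0 ltr01.
  rewrite le_eqVlt => /predU1P[th1|th1].
    by rewrite th1 subrr mulr0 mulr1 addr0; exact: h1.
  move: (h1 th0) (h2 th1); rewrite !ler_norml => /andP[? ?] /andP[? ?].
  by apply/andP; split; nra.
pose xs := ereal_sup S.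
have S0 : S 0%E.
  split; first exact: time_set0.
  exists [:: (f 0%E, T)]; split; first by move=> q; rewrite inE => /eqP ->; exists 0%N.
  move=> kap kT t Tt t0; rewrite /step_fun big_seq1 /= cutT// mulr1.
  have -> : t = 0%E by apply/le_anti; rewrite t0 Tt.1.
  by rewrite subrr normr0 ltW.
have xs0 : (0 <= xs)%E by exact: ereal_sup_ubound.
have Txs : time_set T xs.
  by split => //; apply: ge_ereal_sup => y [] [].
have [p [p' [px xp' xT p'T near_xs]]] := osc xs Txs.
have gp' : good p'.
  apply: (extend xs p) => //; right.
  by have [y Sy py] := ereal_sup_gt px; exists y.
have [xsT|xsT] := eqVneq xs T; first by rewrite -(xT xsT).
have {}xsT : (xs < T)%E by rewrite lt_neqAle xsT; exact: Txs.2.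
have := xp' xsT; rewrite ltNge => /negP[]; apply: ereal_sup_ubound; split => //.
by split => //; apply: le_trans (ltW (xp' xsT)); exact: Txs.1.
Qed.

Lemma cut_offE kap q t : cut_off kap q t =
  (1 - kap q) * \1_[set t | (t < q)%E] t + kap q * \1_[set t | (t <= q)%E] t.
Proof.
rewrite /cut_off !indicE /=.
have [tq|tq|->] := ltgtP t q.
- rewrite !mem_set//= ?ltW//; lra.
- rewrite !memNset//= ?mulr0 ?addr0//; apply/negP; rewrite -?ltNge -?leNgt//; exact: ltW.
- by rewrite memNset ?mem_set//= ?ltxx// mulr0 add0r mulr1.
Qed.

Lemma measurable_ltE q : measurable [set t | (t < q)%E].
Proof. by rewrite -set_itvNyo; exact: emeasurable_itv. Qed.

Lemma measurable_leE q : measurable [set t | (t <= q)%E].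
Proof. by rewrite -set_itvNyc; exact: emeasurable_itv. Qed.

Lemma measurable_cut_off kap q D : measurable_fun D (cut_off kap q).
Proof.
rewrite (_ : cut_off kap q = fun t =>
  (1 - kap q) * \1_[set t | (t < q)%E] t + kap q * \1_[set t | (t <= q)%E] t).
  apply: measurable_funD; apply: measurable_funM => //; apply: measurable_indic.
    exact: measurable_ltE.
  exact: measurable_leE.
by apply/funext => t; exact: cut_offE.
Qed.

Lemma measurable_step_fun kap L D : measurable_fun D (step_fun kap L).
Proof.
rewrite /step_fun; apply: (@measurable_sum _ _ _ _ _ L (fun p t => p.1 * cut_off kap p.2 t)) => p.
by apply: measurable_funM => //; exact: measurable_cut_off.
Qed.

Lemma jump_weight1 T : jump_weight T (fun=> 1).
Proof. by split => // q; rewrite ler01 lexx. Qed.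

Lemma within_time_set_measurable T (f : \bar R -> R) : (0 <= T)%E ->
  {within time_set T, continuous f} -> measurable_fun (time_set T) f.
Proof.
move=> T0 cf.
have /choice[L LP] n := @step_fun_approx T f n.+1%:R^-1 T0 ltac:(by rewrite invr_gt0 ltr0n) cf.
apply: (@measurable_fun_cvg _ _ _ (time_set T) (fun n => step_fun (fun=> 1) (L n))).
  by move=> n; exact: measurable_step_fun.
move=> t Tt; apply/cvgrPdist_le => e e0; near=> n.
have [_ /(_ _ (jump_weight1 T) t Tt)] := LP n => /le_trans; apply.
by apply/ltW; near: n; exact: near_infty_natSinv_lt (PosNum e0).
Unshelve. all: end_near. Qed.

Lemma step_fun_bounded kap L t : (forall q, 0 <= kap q <= 1) ->
  `|step_fun kap L t| <= \sum_(p <- L) `|p.1|.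
Proof.
move=> k01; rewrite /step_fun; apply: le_trans (ler_norm_sum _ _ _) _.
apply: ler_sum => p _; rewrite normrM ler_piMr//.
have /andP[c0 c1] := cut_off01 p.2 t k01.
by rewrite ger0_norm.
Qed.

Lemma within_time_set_bounded T (f : \bar R -> R) : (0 <= T)%E ->
  {within time_set T, continuous f} ->
  exists M, forall t, time_set T t -> `|f t| <= M.
Proof.
move=> T0 cf; have [L [_ Lf]] := step_fun_approx T0 ltr01 cf.
exists (1 + \sum_(p <- L) `|p.1|) => t Tt.
have -> : f t = (f t - step_fun (fun=> 1) L t) + step_fun (fun=> 1) L t by rewrite subrK.
apply: le_trans (ler_normD _ _) _; apply: lerD; first exact: Lf (jump_weight1 T) _ Tt.
by apply: step_fun_bounded => q; rewrite ler01 lexx.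
Qed.

Section integrals.
Variables (T : \bar R) (m : {measure set (\bar R) -> \bar R}).
Hypothesis m1 : m (time_set T) = 1%E.

Lemma integrable_bounded_time (f : \bar R -> R) M : measurable_fun (time_set T) f ->
  (forall t, time_set T t -> `|f t| <= M) -> m.-integrable (time_set T) (EFin \o f).
Proof.
move=> mf fM; apply: measurable_bounded_integrable => //.
- exact: measurable_time_set.
- by rewrite m1 ltry.
- exists M; split; first exact: num_real.
  by move=> x Mx t Tt; apply: ltW; apply: le_lt_trans Mx; exact: fM.
Qed.

Lemma integrable_step_fun kap L : (forall q, 0 <= kap q <= 1) ->
  m.-integrable (time_set T) (EFin \o step_fun kap L).
Proof.
move=> k01; apply: (integrable_bounded_time (M := \sum_(p <- L) `|p.1|)).
  exact: measurable_step_fun.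
by move=> t _; exact: step_fun_bounded.
Qed.

Definition cdf q := fine (m (time_set T `&` [set t | (t <= q)%E])).
Definition cdf_left q := fine (m (time_set T `&` [set t | (t < q)%E])).

Lemma time_set_le1 A : measurable A -> (m (time_set T `&` A) <= 1)%E.
Proof.
move=> mA; have mT := measurable_time_set T; rewrite -m1.
by apply: le_measure; rewrite ?inE//; exact: measurableI.
Qed.

Lemma time_set_fin A : measurable A -> m (time_set T `&` A) \is a fin_num.
Proof.
by move=> mA; rewrite ge0_fin_numE// (le_lt_trans (time_set_le1 mA)) ?ltry.
Qed.

Lemma Rintegral_indic_time A : measurable A ->
  \int[m]_(t in time_set T) \1_A t = fine (m (time_set T `&` A)).
Proof.
move=> mA; rewrite /Rintegral integral_indic//; last exact: measurable_time_set.
by rewrite setIC.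
Qed.

Lemma integrable_indic_time A : measurable A -> m.-integrable (time_set T) (EFin \o (\1_A : _ -> R)).
Proof.
move=> mA; apply: (integrable_bounded_time (M := 1)); first exact: measurable_indic.
by move=> t _; rewrite indicE; case: (_ \in _); rewrite ?normr1 ?normr0.
Qed.

Lemma Rintegral_step_fun kap L : (forall q, 0 <= kap q <= 1) ->
  \int[m]_(t in time_set T) step_fun kap L t =
  \sum_(p <- L) p.1 * ((1 - kap p.2) * cdf_left p.2 + kap p.2 * cdf p.2).
Proof.
move=> k01; elim: L => [|p L IH].
  rewrite big_nil /step_fun; under eq_Rintegral do rewrite big_nil.
  by rewrite /Rintegral integral0.
rewrite big_cons -IH.
have mT := measurable_time_set T.
have -> : \int[m]_(t in time_set T) step_fun kap (p :: L) t =
   \int[m]_(t in time_set T) (step_fun kap [:: p] t + step_fun kap L t).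
  by apply: eq_Rintegral => t _; rewrite /step_fun big_cons big_seq1.
rewrite RintegralD//; [|exact: integrable_step_fun|exact: integrable_step_fun].
congr (_ + _).
under eq_Rintegral do rewrite /step_fun big_seq1 cut_offE.
have i1 := integrable_indic_time (measurable_ltE p.2).
have i2 := integrable_indic_time (measurable_leE p.2).
have i1k := integrableZl mT (1 - kap p.2) i1.
have i2k := integrableZl mT (kap p.2) i2.
rewrite RintegralZl//; last first.
  by have := integrableD mT i1k i2k.
rewrite RintegralD//.
rewrite !RintegralZl// !Rintegral_indic_time//; [exact: measurable_leE|exact: measurable_ltE].
Qed.

Lemma Rintegral_step_fun_approx f kap L (e : R) : (0 <= T)%E ->
  {within time_set T, continuous f} -> (forall q, 0 <= kap q <= 1) ->
  (forall t, time_set T t -> `|f t - step_fun kap L t| <= e) ->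
  `|\int[m]_(t in time_set T) f t -
    \sum_(p <- L) p.1 * ((1 - kap p.2) * cdf_left p.2 + kap p.2 * cdf p.2)| <= e.
Proof.
move=> T0 cf k01 fL; have mT := measurable_time_set T.
have [M fM] := within_time_set_bounded T0 cf.
have fi : m.-integrable (time_set T) (EFin \o f).
  by apply: (integrable_bounded_time _ fM); exact: within_time_set_measurable.
have si := integrable_step_fun L k01.
rewrite -Rintegral_step_fun// -RintegralB//.
have di : m.-integrable (time_set T) (EFin \o (fun t => f t - step_fun kap L t)).
  by have := integrableB mT fi si.
apply: le_trans (le_normr_Rintegral mT di) _.
have -> : e = \int[m]_(t in time_set T) e by rewrite Rintegral_cst// m1 mulr1.
apply: le_Rintegral => //; first exact: integrable_norm.
by apply: (integrable_bounded_time (M := `|e|)).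
Qed.
End integrals.

(* The inequality [Rintegral_step_fun_approx], at [kap = 1], as a relation
   between a value [l] for the integral of [f] and a distribution function [c];
   in this form it passes to convex combinations. *)
Definition represents T (f : \bar R -> R) (l : R) (c : \bar R -> R) : Prop :=
  forall L (e : R),
    (forall t, time_set T t -> `|f t - step_fun (fun=> 1) L t| <= e) ->
    `|l - \sum_(p <- L) p.1 * c p.2| <= e.

Lemma represents_measure T (m : {measure set (\bar R) -> \bar R}) f :
  (0 <= T)%E -> m (time_set T) = 1%E -> {within time_set T, continuous f} ->
  represents T f (\int[m]_(t in time_set T) f t) (cdf T m).
Proof.
move=> T0 m1 cf L e fL.
have := Rintegral_step_fun_approx m1 T0 cf (jump_weight1 T).1 fL.
by under eq_bigr do rewrite subrr mul0r add0r mul1r.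
Qed.

Lemma represents_mid T f l l' c c' : represents T f l c -> represents T f l' c' ->
  represents T f ((l + l') / 2) (fun q => (c q + c' q) / 2).
Proof.
move=> H H' L e fL; have := H L e fL; have := H' L e fL.
have -> : \sum_(p <- L) p.1 * ((c p.2 + c' p.2) / 2) =
    (\sum_(p <- L) p.1 * c p.2 + \sum_(p <- L) p.1 * c' p.2) / 2.
  by rewrite -big_split /= mulr_suml; apply: eq_bigr => p _; lra.
by rewrite !ler_norml => /andP[? ?] /andP[? ?]; apply/andP; split; lra.
Qed.

Lemma represents_sum T f (n : nat) (y l : nat -> R) (c : nat -> \bar R -> R) :
  (forall j, 0 <= y j) -> \sum_(j < n) y j = 1 ->
  (forall j, represents T f (l j) (c j)) ->
  represents T f (\sum_(j < n) y j * l j) (fun q => \sum_(j < n) y j * c j q).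
Proof.
move=> y0 y1 H L e fL.
have -> : \sum_(p <- L) p.1 * (\sum_(j < n) y j * c j p.2) =
    \sum_(j < n) y j * (\sum_(p <- L) p.1 * c j p.2).
  under eq_bigr do rewrite mulr_sumr.
  rewrite exchange_big /=; apply: eq_bigr => j _; rewrite mulr_sumr.
  by apply: eq_bigr => p _; rewrite mulrCA.
rewrite -sumrB; apply: le_trans (ler_norm_sum _ _ _) _.
rewrite -[e]mul1r -y1 mulr_suml; apply: ler_sum => j _.
by rewrite -mulrBr normrM ger0_norm// ler_wpM2l//; exact: H.
Qed.

Lemma cdf_total T (m : {measure set (\bar R) -> \bar R}) :
  m (time_set T) = 1%E -> cdf T m T = 1.
Proof.
move=> m1; rewrite /cdf (_ : _ `&` _ = time_set T) ?m1//.
by apply/seteqP; split => [t []//|t Tt]; split => //; exact: Tt.2.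
Qed.

(** Helly's theorem without identifying the limit at the jumps. The same list [L] is used on both
    sides, with jump weight one before the limit and with a weight adapted to [a] in the limit;
    [step_fun_approx] allows both. *)
Lemma helly_represents T (l : nat -> R) (c' : nat -> \bar R -> R)
    (nu : {measure set (\bar R) -> \bar R}) (a : \bar R -> R) f :
  (0 <= T)%E -> nu (time_set T) = 1%E ->
  (forall n, represents T f (l n) (c' n)) -> a T = 1 ->
  (forall k, c' n (dense_time T k) @[n --> \oo] --> a (dense_time T k)) ->
  (forall k, cdf_left T nu (dense_time T k) <= a (dense_time T k) <= cdf T nu (dense_time T k)) ->
  {within time_set T, continuous f} ->
  l n @[n --> \oo] --> \int[nu]_(t in time_set T) f t.
Proof.
move=> T0 nu1 lc aT mua nua cf.
pose b q := cdf_left T nu q; pose c q := cdf T nu q.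
(* The barycentric coordinate of [a q] between the left and right distribution functions of [nu].
   The division yields 0 where these agree, and then any weight represents [a q]. *)
pose kap q := if q == T then 1 else if b q <= a q <= c q then (a q - b q) / (c q - b q) else 0.
have k01 q : 0 <= kap q <= 1.
  rewrite /kap; case: ifP => _; first by rewrite ler01 lexx.
  case: ifPn => [/andP[h1 h2]|_]; last by rewrite lexx ler01.
  have [cb|cb] := eqVneq (c q) (b q); first by rewrite cb subrr invr0 mulr0 lexx ler01.
  have cb0 : 0 < c q - b q by rewrite subr_gt0 lt_neqAle eq_sym cb (le_trans h1).
  by rewrite divr_ge0 ?subr_ge0 ?(ltW cb0)//= ?ler_pdivrMr// ?mul1r ?lerD2r// (le_trans h1).
have kT : jump_weight T kap by split => //; rewrite /kap eqxx.
have kapE k : let q := dense_time T k in (1 - kap q) * b q + kap q * c q = a q.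
  move=> q; rewrite /kap; case: eqVneq => [->|_].
    by rewrite subrr mul0r add0r mul1r /c cdf_total// aT.
  have /andP[h1 h2] := nua k; rewrite -/q -/(b q) -/(c q) in h1 h2.
  rewrite h1 h2 /=; have [cb|cb] := eqVneq (c q) (b q).
    have -> : a q = b q by apply/le_anti; rewrite h1 -cb h2.
    by rewrite subrr mul0r subr0 mul1r mul0r addr0.
  by field; rewrite subr_eq0.
apply/cvgrPdist_le => e e0.
have e30 : 0 < e / 3 by rewrite divr_gt0.
have [L [LD Lf]] := step_fun_approx T0 e30 cf.
have sumE : \sum_(p <- L) p.1 * ((1 - kap p.2) * b p.2 + kap p.2 * c p.2) =
    \sum_(p <- L) p.1 * a p.2.
  apply: eq_big_seq => p /LD[k ->]; by rewrite kapE.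
have lim_n : \sum_(p <- L) p.1 * c' n p.2 @[n --> \oo] --> \sum_(p <- L) p.1 * a p.2.
  elim: L LD {Lf sumE} => [|p L IH] LD.
    by rewrite big_nil; under eq_fun do rewrite big_nil; exact: cvg_cst.
  rewrite big_cons; under eq_fun do rewrite big_cons.
  apply: cvgD; last by apply: IH => q qL; apply: LD; rewrite inE qL orbT.
  by apply: cvgMr; have [k ->] := LD p (mem_head _ _); exact: mua.
have h1 n := lc n L (e / 3) (Lf _ (jump_weight1 T)).
have := @Rintegral_step_fun_approx T nu nu1 f kap L (e / 3) T0 cf k01 (Lf _ kT).
rewrite sumE => h2.
move/cvgrPdist_le: lim_n => /(_ _ e30); apply: filterS => n h3.
have := h1 n; move: h2 h3; rewrite !ler_norml => /andP[? ?] /andP[? ?] /andP[? ?].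
by apply/andP; split; lra.
Qed.

Lemma helly_measure T (mu : nat -> {measure set (\bar R) -> \bar R})
    (nu : {measure set (\bar R) -> \bar R}) (a : \bar R -> R) f :
  (0 <= T)%E -> (forall n, mu n (time_set T) = 1%E) -> nu (time_set T) = 1%E ->
  (forall k, cdf T (mu n) (dense_time T k) @[n --> \oo] --> a (dense_time T k)) ->
  (forall k, cdf_left T nu (dense_time T k) <= a (dense_time T k) <= cdf T nu (dense_time T k)) ->
  {within time_set T, continuous f} ->
  \int[mu n]_(t in time_set T) f t @[n --> \oo] --> \int[nu]_(t in time_set T) f t.
Proof.
move=> T0 mu1 nu1 mua nua cf.
have aT : a T = 1.
  have := mua 0%N => /= /cvg_lim <- //.
  by under eq_fun do rewrite cdf_total//; rewrite lim_cst.
apply: (@helly_represents T _ (fun n => cdf T (mu n)) nu a f) => // n.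
exact: represents_measure.
Qed.

Lemma cdf_left_le T (m : {measure set (\bar R) -> \bar R}) q : m (time_set T) = 1%E ->
  cdf_left T m q <= cdf T m q.
Proof.
move=> m1; have mT := measurable_time_set T.
have ml := measurable_ltE q; have mle := measurable_leE q.
have fl := time_set_fin m1 ml; have fr := time_set_fin m1 mle.
rewrite /cdf_left /cdf fine_le//; apply: le_measure; rewrite ?inE.
- exact: measurableI.
- exact: measurableI.
- by move=> t [Tt /= tq]; split => //; exact: ltW.
Qed.

Lemma EFin_Rintegral_time T (m : {measure set (\bar R) -> \bar R}) f : (0 <= T)%E ->
  m (time_set T) = 1%E -> {within time_set T, continuous f} ->
  (\int[m]_(t in time_set T) (f t)%:E)%E = (\int[m]_(t in time_set T) f t)%:E.
Proof.
move=> T0 m1 cf; have [M fM] := within_time_set_bounded T0 cf.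
rewrite /Rintegral fineK//; apply: integrable_fin_num; first exact: measurable_time_set.
by apply: (integrable_bounded_time m1 _ fM); exact: within_time_set_measurable.
Qed.

Lemma weak_cvg_cdf T (mu : nat -> pprobability (\bar R) R) (nu : pprobability (\bar R) R)
    (a : \bar R -> R) :
  (0 <= T)%E -> (forall n, mu n (time_set T) = 1%E) -> nu (time_set T) = 1%E ->
  (forall k, cdf T (mu n) (dense_time T k) @[n --> \oo] --> a (dense_time T k)) ->
  (forall k, cdf_left T nu (dense_time T k) <= a (dense_time T k) <= cdf T nu (dense_time T k)) ->
  weak_cvg T mu nu.
Proof.
move=> T0 mu1 nu1 mua nua f cf _; rewrite EFin_Rintegral_time//.
have H := helly_measure T0 mu1 nu1 mua nua cf.
rewrite (_ : (fun n => _) = (fun n => (\int[mu n]_(t in time_set T) f t)%:E)).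
  by apply: cvg_EFin; [exact: nearW|exact: H].
by apply/funext => n; exact: (EFin_Rintegral_time T0 (mu1 n) cf).
Qed.
End times.

(** * Randomized stopping times *)

Lemma measurable_set_ler d (X : measurableType d) (R : realType) (f g : X -> R) :
  measurable_fun setT f -> measurable_fun setT g -> measurable [set x | f x <= g x].
Proof.
move=> mf mg; rewrite -preimage_true -[X in measurable X]setTI.
by apply: measurable_fun_ler.
Qed.

Section randomized.
Context d (Omega : measurableType d) (R : realType).
Variables (P : probability Omega R) (T : \bar R) (F : \bar R -> set (set Omega)).
Hypotheses (T0 : (0 <= T)%E) (filtF : is_filtration T F) (usualF : usual_conditions P T F).
Implicit Types (sigma : Omega * R -> \bar R) (t q : \bar R).

Lemma filtration_sigma_algebra t : time_set T t -> sigma_algebra [set: Omega] (F t).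
Proof. by move=> /filtF.1[]. Qed.

Lemma filtration_measurable t A : time_set T t -> F t A -> measurable A.
Proof. by move=> /filtF.1[_]; exact. Qed.

Lemma g_sigma_filtration t : time_set T t ->
  @measurable _ (g_sigma_algebraType (F t)) = F t.
Proof. by move=> /filtration_sigma_algebra /sigma_algebra_id. Qed.

Lemma measurable_to_filtration t : time_set T t ->
  measurable_fun [set: Omega] (id : Omega -> g_sigma_algebraType (F t)).
Proof.
move=> Tt _ A; rewrite g_sigma_filtration// setTI => FA.
exact: filtration_measurable FA.
Qed.

Lemma measurable_wrt_filtration t (f : Omega -> R) : time_set T t ->
  measurable_wrt (F t) f -> measurable_fun setT f.
Proof.
by move=> Tt mf; exact: (measurableT_comp mf (measurable_to_filtration Tt)).
Qed.

Lemma measurable_product_filtration t (A : set (Omega * R)) : time_set T t ->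
  @measurable _ (g_sigma_algebraType (F t) * R)%type A -> measurable A.
Proof.
move=> Tt mA.
have mf : measurable_fun [set: Omega * R]
    (fun z => (z.1 : g_sigma_algebraType (F t), z.2)).
  apply/measurable_fun_pairP; split; last exact: measurable_snd.
  exact: (measurableT_comp (measurable_to_filtration Tt) measurable_fst).
have := mf measurableT A mA; rewrite setTI.
by congr measurable; apply/seteqP; split=> -[].
Qed.

Definition clamp (v : R) : R := Num.max 0 (Num.min v 1).

Lemma clamp01 v : 0 <= clamp v <= 1.
Proof. by rewrite /clamp le_max lexx ge_max ler01 ge_min lexx orbT. Qed.

Lemma clamp_id v : 0 <= v <= 1 -> clamp v = v.
Proof. by move=> /andP[v0 v1]; rewrite /clamp min_l// max_r. Qed.

Lemma measurable_clamp : measurable_fun setT clamp.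
Proof. by apply: measurable_maxr => //; apply: measurable_minr. Qed.

(* [sigma] is only constrained on [Omega * [0, 1]]; this extends it to [Omega * R]. *)
Definition clamp_ext sigma : Omega * R -> \bar R := fun z => sigma (z.1, clamp z.2).

Lemma clamp_tOmega (z : Omega * R) : tOmega (z.1, clamp z.2).
Proof. by split => //=; rewrite in_itv /= clamp01. Qed.

Lemma clamp_ext_id sigma z : tOmega z -> clamp_ext sigma z = sigma z.
Proof.
by case: z => w v [_ /=]; rewrite in_itv /= /clamp_ext /= => v01; rewrite clamp_id.
Qed.

Lemma clamp_ext_time sigma z : randomized_stopping_time T F sigma ->
  time_set T (clamp_ext sigma z).
Proof. by case=> H _ _ _; apply: H; exact: clamp_tOmega. Qed.

Lemma clamp_ext_adapted sigma t : randomized_stopping_time T F sigma -> time_set T t ->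
  @measurable _ (g_sigma_algebraType (F t) * R)%type [set z | (clamp_ext sigma z <= t)%E].
Proof.
move=> [_ H _ _] Tt; have [_ mA] := H t Tt.
have mf : measurable_fun [set: g_sigma_algebraType (F t) * R]
    (fun z => (z.1, clamp z.2)).
  apply/measurable_fun_pairP; split; first exact: measurable_fst.
  exact: (measurableT_comp measurable_clamp measurable_snd).
have := mf measurableT _ mA; rewrite setTI.
congr measurable; apply/seteqP; split=> z /=; first by case.
by move=> zt; split => //; exact: clamp_tOmega.
Qed.

Lemma measurable_clamp_ext sigma : randomized_stopping_time T F sigma ->
  measurable_fun setT (clamp_ext sigma).
Proof.
move=> rs; apply: (measurability _ (ErealGenOInfty.measurableE R)) => _ /= -[_ [r ->] <-].
rewrite setTI preimage_itvoy.
have [r0|r0] := ltP r 0.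
  rewrite (_ : [set _ | _] = setT)//; apply/seteqP; split => // z _ /=.
  by apply: lt_le_trans (clamp_ext_time z rs).1; rewrite lte_fin.
have [rT|rT] := leP r%:E T.
  have Tr : time_set T r%:E by split.
  rewrite (_ : [set _ | _] = ~` [set z | (clamp_ext sigma z <= r%:E)%E]).
    by apply: measurableC; apply: measurable_product_filtration Tr _; exact: clamp_ext_adapted.
  by apply/seteqP; split => z /=; rewrite ltNge => /negP.
rewrite (_ : [set _ | _] = set0)//; apply/seteqP; split => // z /= rz.
have := lt_trans rT rz; rewrite ltNge; apply/negP/negPn; exact: (clamp_ext_time z rs).2.
Qed.

End randomized.

(** * Conditional law and distribution function of a randomized time, given the path *)

Section time_law.
Context d (Omega : measurableType d) (R : realType).
Local Notation RR := (measurableTypeR R).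
Implicit Types (sg : {mfun (Omega * RR)%type >-> \bar R}) (w : Omega) (q : \bar R).

Definition unif : probability RR R := uniform_prob (@ltr01 R).

Definition section_at sg w : RR -> \bar R := fun v => sg (w, v).

Lemma measurable_section_at sg w : measurable_fun setT (section_at sg w).
Proof. by apply: measurable_fun_pair2; exact: measurable_funPT. Qed.

HB.instance Definition _ sg w :=
  isMeasurableFun.Build _ _ _ _ (section_at sg w) (measurable_section_at sg w).

Definition time_law sg w : probability (\bar R) R := distribution unif (section_at sg w).

Variable T : \bar R.
Definition timed sg := forall z, time_set T (sg z).

Lemma time_law_total sg w : timed sg -> time_law sg w (time_set T) = 1%E.
Proof.
move=> tsg; rewrite /time_law /= /distribution /pushforward.
rewrite (_ : _ @^-1` _ = setT) ?probability_setT//.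
by apply/seteqP; split => // v _; exact: tsg.
Qed.

(** As a process in [q], this is the nondecreasing process that represents a randomized stopping
    time; mixing strategies averages these processes. *)
Definition level sg w q : R := cdf T (time_law sg w) q.

Lemma levelE sg w q : timed sg -> level sg w q = fine (unif (xsection [set z | (sg z <= q)%E] w)).
Proof.
move=> tsg; rewrite /level /cdf /time_law /= /distribution /pushforward; congr (fine (_ _)).
apply/seteqP; split => v.
  by move=> [_ H]; rewrite /xsection /= inE.
by rewrite /xsection /= inE => H; split => //; exact: tsg.
Qed.

Lemma cdf01 (m : {measure set (\bar R) -> \bar R}) q : m (time_set T) = 1%E ->
  0 <= cdf T m q <= 1.
Proof.
move=> m1; rewrite /cdf fine_ge0//= -lee_fin fineK ?time_set_fin//; last exact: measurable_leE.
by rewrite time_set_le1//; exact: measurable_leE.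
Qed.

Lemma level01 sg w q : timed sg -> 0 <= level sg w q <= 1.
Proof. by move=> tsg; apply: cdf01; exact: time_law_total. Qed.

Lemma levelT sg w : timed sg -> level sg w T = 1.
Proof. by move=> tsg; apply: cdf_total; exact: time_law_total. Qed.

Lemma le_level sg w q q' : timed sg -> (q <= q')%E -> level sg w q <= level sg w q'.
Proof.
move=> tsg qq; have m1 := time_law_total w tsg.
have mT := measurable_time_set T.
have fq (r : \bar R) : time_law sg w (time_set T `&` [set t | (t <= r)%E]) \is a fin_num.
  by apply: time_set_fin => //; exact: measurable_leE.
rewrite /level /cdf fine_le ?fq//.
apply: le_measure; rewrite ?inE; do ?[by apply: measurableI => //; exact: measurable_leE].
by move=> t [Tt tq]; split => //; exact: le_trans qq.
Qed.
End time_law.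

Section levels.
Context d (Omega : measurableType d) (R : realType).
Local Notation RR := (measurableTypeR R).
Variables (P : probability Omega R) (T : \bar R) (F : \bar R -> set (set Omega)).
Hypotheses (T0 : (0 <= T)%E) (filtF : is_filtration T F) (usualF : usual_conditions P T F).

(** Measurability of section measures is invoked with [F q] on the first factor, which turns the
    defining property of a randomized stopping time into adaptedness. *)
Lemma level_adapted (sg : {mfun (Omega * RR)%type >-> \bar R}) sigma q :
  randomized_stopping_time T F sigma -> (forall z, sg z = clamp_ext sigma z) ->
  time_set T q -> measurable_wrt (F q) (fun w => level T sg w q).
Proof.
move=> rs sgE Tq; have tsg : timed T sg by move=> z; rewrite sgE; exact: clamp_ext_time rs.
have mA := clamp_ext_adapted rs Tq.
have mS : @measurable _ (g_sigma_algebraType (F q) * RR)%type [set z | (clamp_ext sigma z <= q)%E] by exact: mA.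
have := measurable_fun_xsection (unif R) mS => mf.
rewrite /measurable_wrt (_ : (fun w => _) =
   (fun w : g_sigma_algebraType (F q) => fine (unif R (xsection [set z | (clamp_ext sigma z <= q)%E] w)))).
  by apply: measurableT_comp.
apply/funext => w; rewrite levelE//; congr (fine (unif R (xsection _ w))).
by apply/seteqP; split=> z /=; rewrite sgE.
Qed.

(** * Inversion of an adapted nondecreasing process *)

Variable a : Omega -> \bar R -> R.
Hypothesis a_adapted : forall q, time_set T q -> measurable_wrt (F q) (fun w => a w q).
Hypothesis a_mono : forall w q q', time_set T q -> time_set T q' -> (q <= q')%E -> a w q <= a w q'.
Hypothesis a01 : forall w q, 0 <= a w q <= 1.
Hypothesis aT : forall w, a w T = 1.

(* Quantile transform: with [v] uniform, the law of [inverse_level (w, v)] has its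
   distribution functions (for [<] and for [<=]) on either side of [a w]. *)
Definition inverse_level (z : Omega * R) : \bar R :=
  ereal_inf [set q | exists2 k, q = dense_time T k & z.2 <= a z.1 q].

Let tau := inverse_level.

Lemma inverse_level_le w v k : v <= a w (dense_time T k) -> (tau (w, v) <= dense_time T k)%E.
Proof. by move=> H; apply: ereal_inf_lbound; exists k. Qed.

Lemma inverse_level_lt w v k : (tau (w, v) < dense_time T k)%E -> v <= a w (dense_time T k).
Proof.
move=> /ereal_inf_lt[_ [j -> /= H] jk]; apply: le_trans H _.
by apply: a_mono; [exact: dense_timeP|exact: dense_timeP|exact: ltW].
Qed.

Lemma inverse_level_time w v : v <= 1 -> time_set T (tau (w, v)).
Proof.
move=> v1; split; first by apply: le_ereal_inf_tmp => _ [k -> _]; exact: (dense_timeP k T0).1.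
by apply: (@inverse_level_le w v 0%N); rewrite /= aT.
Qed.

Lemma le_inverse_level w u v : u <= v -> (tau (w, u) <= tau (w, v))%E.
Proof.
move=> uv; apply: ereal_inf_le_tmp => _ [k -> /= H]; exists k => //=; exact: le_trans H.
Qed.

(** The right limit of [a w] at [t] along dense times; it stands in for [a w t] because [a] is not
    assumed right-continuous. *)
Let right_level t w : R := inf [set x | exists2 k, (t < dense_time T k)%E & x = a w (dense_time T k)].

Let right_levelP t w y : (t < T)%E ->
  (y <= right_level t w) <-> (forall k, (t < dense_time T k)%E -> y <= a w (dense_time T k)).
Proof.
move=> tT; split=> [H k tk|H].
  apply: le_trans H _; apply: ge_inf; last by exists k.
  by exists 0 => _ [j _ ->]; have /andP[] := a01 w (dense_time T j).
apply: lb_le_inf; first by exists (a w T), 0%N.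
by move=> _ [k tk ->]; exact: H.
Qed.

Lemma inverse_level_leP t w v : time_set T t -> (t < T)%E -> v <= 1 ->
  (tau (w, v) <= t)%E <-> v <= right_level t w.
Proof.
move=> Tt tT v1; split=> [H|/(right_levelP _ _ tT) H].
  by apply/right_levelP => // k tk; apply: inverse_level_lt; exact: le_lt_trans H tk.
rewrite leNgt; apply/negP => lt.
have [k /andP[tk kt]] := dense_time_dense Tt (inverse_level_time w v1) lt.
by have := lt_le_trans kt (inverse_level_le (H k tk)); rewrite ltxx.
Qed.

(** For each [s > t] the infimum may be restricted to dense times in [(t, s]], so the right limit is
    measurable for [F s]. Right-continuity of the filtration brings this down to [F t]. *)
Lemma right_level_adapted t : time_set T t -> (t < T)%E ->
  measurable_wrt (F t) (right_level t).
Proof.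
move=> Tt tT; rewrite /measurable_wrt.
apply: (measurability _ (RGenCInfty.measurableE R)) => _ /= -[_ [y ->] <-].
rewrite setTI preimage_itvcy (g_sigma_filtration filtF Tt) (usualF.2 _ Tt tT) => s [ts Ts].
have -> : [set w | y <= right_level t w] =
    \bigcap_(k in [set k | (t < dense_time T k)%E /\ (dense_time T k <= s)%E])
      [set w | y <= a w (dense_time T k)].
  apply/seteqP; split => w /=.
    by move=> /(right_levelP _ _ tT) H k [tk _]; exact: H.
  move=> H; apply/right_levelP => // k tk.
  have Tk := dense_timeP k T0.
  have [ks|sk] := leP (dense_time T k) s; first exact: H.
  have [j /andP[tj js]] := dense_time_dense Tt Ts ts.
  apply: le_trans (H j _) _; first by split => //; exact: ltW.
  by apply: a_mono => //; [exact: dense_timeP|exact: (ltW (lt_trans js sk))].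
rewrite -(g_sigma_filtration filtF Ts); apply: bigcap_measurable => [|k [tk ks]].
  by have [j /andP[tj js]] := dense_time_dense Tt Ts ts; exists j; split => //; exact: ltW.
rewrite (g_sigma_filtration filtF Ts).
have Tk := dense_timeP k T0.
apply: (filtF.2 _ _ Tk Ts ks); rewrite -(g_sigma_filtration filtF Tk).
rewrite -preimage_itvcy -[X in measurable X]setTI.
by apply: (a_adapted Tk) => //; exact: measurable_itv.
Qed.

Lemma ereal_left_nbhs (t : \bar R) (A : set (\bar R)) : t != -oo%E -> nbhs t A ->
  exists2 p, (p < t)%E & forall s, (p < s)%E -> (s <= t)%E -> A s.
Proof.
case: t => [t| |] // _.
  move=> [e /= e0 eA]; exists (t - e)%:E; first by rewrite lte_fin ltrBlDr ltrDl.
  move=> [s| |] //; rewrite lte_fin lee_fin => s1 s2; apply: eA.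
  by rewrite /ball /= ger0_norm ?subr_ge0// ltrBlDl -ltrBlDr.
by move=> [M [_ MA]]; exists M%:E; rewrite ?ltry// => s Ms _; exact: MA.
Qed.

Lemma inverse_level_rst : randomized_stopping_time T F tau.
Proof.
split.
- by move=> [w v] [_ /=]; rewrite in_itv /= => /andP[_ v1]; exact: inverse_level_time.
- move=> t Tt; split; first by move=> z [].
  have mO : @measurable _ (g_sigma_algebraType (F t) * R)%type (@tOmega _ Omega R).
    by apply: measurableX => //; exact: measurable_itv.
  (* At [t = T] there is no later dense time and [right_level] says nothing; the event is then all
     of [tOmega]. *)
  have [tT|Tlt] := ltP t T; last first.
    rewrite (_ : _ `&` _ = @tOmega _ Omega R)//; apply/seteqP; split => [z []//|[w v] wv].
    split => //=; apply: le_trans Tlt; case: wv => _ /=; rewrite in_itv /= => /andP[_ v1].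
    exact: (inverse_level_time w v1).2.
  rewrite (_ : _ `&` _ = @tOmega _ Omega R `&` [set z | z.2 <= right_level t z.1]).
    apply: measurableI => //.
    apply: (@measurable_set_ler _ (g_sigma_algebraType (F t) * R)%type); first exact: measurable_snd.
    exact: (measurableT_comp (right_level_adapted Tt tT) measurable_fst).
  apply/seteqP; split => -[w v] [wv /= H]; split => //=;
    case: (wv) => _ /=; rewrite in_itv /= => /andP[_ v1].
    exact/inverse_level_leP.
  exact/(inverse_level_leP w Tt tT v1).
- by move=> w u v _ uv _; exact: le_inverse_level.
- move=> w v v0 v1 A nA; have [tv0 tvT] := inverse_level_time w v1.
  have [|p pt pA] := ereal_left_nbhs _ nA.
    by apply/eqP => H; move: tv0; rewrite H.
  have up u : u < v -> (tau (w, u) <= tau (w, v))%E by move=> /ltW; exact: le_inverse_level.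
  change (\forall u \near v^'-, A (tau (w, u))).
  have [p0|p0] := ltP p 0%E.
    near=> u; apply: (pA (tau (w, u))); last by apply: up; near: u; exact: nbhs_left_lt.
    apply: lt_le_trans p0 _; apply: (inverse_level_time w _).1.
    by apply: le_trans v1; near: u; exact: nbhs_left_le.
  have Tp : time_set T p by split => //; apply: le_trans (ltW pt) tvT.
  (* Left-continuity: a dense time between [p] and the value at [v] has level less than [v], and for
     [u] above that level the inverse stays beyond this dense time. *)
  have [k /andP[pk kv]] := dense_time_dense Tp (inverse_level_time w v1) pt.
  have av : a w (dense_time T k) < v.
    by rewrite ltNge; apply/negP => /inverse_level_le; rewrite leNgt kv.
  near=> u; apply: (pA (tau (w, u))); last by apply: up; near: u; exact: nbhs_left_lt.
  apply: lt_le_trans pk _; rewrite leNgt; apply/negP => /inverse_level_lt.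
  by apply/negP; rewrite -ltNge; near: u; exact: nbhs_left_gt.
Unshelve. all: end_near. Qed.

(** The event that the inverse is less than [q] lies in the event [v <= a w q], which lies in the
    event that the inverse is at most [q]; the middle one has uniform probability [a w q]. *)
Lemma inverse_level_cdf (sg : {mfun (Omega * RR)%type >-> \bar R}) w k :
  (forall z, sg z = clamp_ext tau z) ->
  cdf_left T (time_law sg w) (dense_time T k) <= a w (dense_time T k) <=
    cdf T (time_law sg w) (dense_time T k).
Proof.
move=> sgE; pose q := dense_time T k; rewrite -/q.
have tsg : timed T sg by move=> z; rewrite sgE; apply: clamp_ext_time inverse_level_rst.
have m1 := time_law_total w tsg.
have mc (D : set (\bar R)) : measurable D -> measurable [set v : RR | D (clamp_ext tau (w, v))].
  move=> mD; rewrite -[X in measurable X]setTI.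
  have := measurable_section_at sg w measurableT mD; congr measurable.
  by congr setI; apply/seteqP; split => v; rewrite /section_at /= sgE.
have lawE (D : set (\bar R)) : measurable D -> time_law sg w (time_set T `&` D) =
    unif R [set v : RR | D (clamp_ext tau (w, v))].
  move=> mD; rewrite /time_law /= /distribution /pushforward; congr (unif R _).
  apply/seteqP; split => v /=; rewrite /section_at sgE; first by case.
  by move=> Dv; split => //; rewrite -sgE; exact: tsg.
have unif_seg (x : R) : 0 <= x <= 1 -> unif R [set v | clamp v <= x] = x%:E.
  move=> /andP[x0 x1]; rewrite /unif /= /uniform_prob integral_uniform_pdf.
  rewrite (_ : _ `&` _ = `[0, x]%classic); last first.
    apply/seteqP; split => v /=; rewrite !in_itv /=.
      by move=> [+ /andP[v0 v1]]; rewrite clamp_id ?v0.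
    by move=> /andP[v0 vx]; rewrite clamp_id ?v0 ?(le_trans vx).
  rewrite (eq_integral (cst 1%E)); last first.
    move=> v; rewrite inE /= ?in_itv /= => /andP[v0 vx].
    by rewrite /uniform_pdf v0 (le_trans vx x1) subr0 invr1.
  rewrite integral_cst// mul1e /= lebesgue_measure_itv /= lte_fin.
  by have [_|x0'] := ltP 0 x; [rewrite -EFinB subr0|congr EFin; apply/le_anti; rewrite x0 x0'].
have mseg (x : R) : measurable [set v : RR | clamp v <= x].
  by apply: measurable_set_ler => //; exact: measurable_clamp.
have mlt := mc _ (measurable_ltE q); have mle := mc _ (measurable_leE q).
have -> : cdf_left T (time_law sg w) q = fine (unif R [set v : RR | (clamp_ext tau (w, v) < q)%E]).
  by rewrite /cdf_left; congr fine; exact: (lawE _ (measurable_ltE q)).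
have -> : cdf T (time_law sg w) q = fine (unif R [set v : RR | (clamp_ext tau (w, v) <= q)%E]).
  by rewrite /cdf; congr fine; exact: (lawE _ (measurable_leE q)).
have ufin D : measurable D -> unif R D \is a fin_num by move=> mD; exact: fin_num_measure.
rewrite -2!lee_fin !fineK; [|exact: ufin|exact: ufin].
rewrite -unif_seg//; apply/andP; split.
- apply: le_measure; rewrite ?inE// => v /= H; exact: inverse_level_lt.
- apply: le_measure; rewrite ?inE// => v /= H; exact: inverse_level_le.
Qed.
End levels.

(** * Laws that are constant on the cells of a partition *)

Lemma mnormalizeE d (X : measurableType d) (R : realType)
    (mu : {measure set X -> \bar R}) (Q : probability X R) B (r : \bar R) :
  mu setT = r -> r != 0%E -> r \is a fin_num ->
  mnormalize mu Q B = (mu B * (fine r)^-1%:E)%E.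
Proof.
move=> mur r0 rfin; rewrite /mnormalize mur (negbTE r0) /=.
by case: eqP => // roo; move: rfin; rewrite roo.
Qed.

Lemma measurable_time_law d (Omega : measurableType d) (R : realType)
    (sg : {mfun (Omega * measurableTypeR R)%type >-> \bar R}) B : measurable B ->
  measurable_fun setT (fun w => time_law sg w B).
Proof.
move=> mB; have mS : measurable (sg @^-1` B).
  by rewrite -[X in measurable X]setTI; exact: measurable_funPT.
have := measurable_fun_xsection (unif R) mS; congr (measurable_fun _ _).
apply/funext => w; rewrite /time_law /= /distribution /pushforward; congr (unif R _).
by apply/seteqP; split => v; rewrite /xsection /= inE.
Qed.

Section cells.
Context d (Omega : measurableType d) (R : realType).
Local Notation RR := (measurableTypeR R).
Variables (P : probability Omega R) (T : \bar R) (G : set (set Omega)).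
Hypothesis T0 : (0 <= T)%E.
Variable idx : Omega -> nat.
Hypothesis G_idx : forall S : set nat, G (idx @^-1` S).
Hypothesis G_measurable : forall A, G A -> measurable A.
Hypothesis G_char : forall A, G A -> exists S : set nat, A = idx @^-1` S.
Hypothesis cell_pos : forall w, (0 < P (idx @^-1` [set idx w]))%E.
Implicit Types (sg : {mfun (Omega * RR)%type >-> \bar R}).

Definition cell i : set Omega := idx @^-1` [set i].

Lemma measurable_cell i : measurable (cell i).
Proof. exact/G_measurable/G_idx. Qed.

Definition prodm : probability (Omega * RR)%type R := (P \x unif R)%E.

Lemma measurable_cellX i : measurable (cell i `*` [set: RR]).
Proof. by apply: measurableX => //; exact: measurable_cell. Qed.

(** Conditioning on a cell; [mnormalize] falls back on [prodm] when the cell is null, so that a law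
    exists for every index. *)
Definition cell_prob i : probability (Omega * RR)%type R :=
  mnormalize (mrestr prodm (measurable_cellX i)) prodm.

Definition cell_law sg i : probability (\bar R) R := distribution (cell_prob i) sg.

Lemma prodm_section sg (A : set Omega) (B : set (\bar R)) : measurable A -> measurable B ->
  prodm ((A `*` setT) `&` sg @^-1` B) = (\int[P]_(w in A) time_law sg w B)%E.
Proof.
move=> mA mB; rewrite [RHS]integral_mkcond /prodm /= /product_measure1.
apply: eq_integral => w _; rewrite /= patchE; case: ifPn => [|]; rewrite ?inE ?notin_setE => wA.
  rewrite /time_law /= /distribution /pushforward; congr (unif R _).
  by apply/seteqP; split => v; rewrite /xsection /= inE => //; case.
rewrite (_ : xsection _ _ = set0) ?measure0//.
by apply/seteqP; split => // v; rewrite /xsection /= inE => -[[/wA]].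
Qed.

Lemma cell_lawE sg i B : (0 < P (cell i))%E -> measurable B ->
  (cell_law sg i B * P (cell i) = \int[P]_(w in cell i) time_law sg w B)%E.
Proof.
move=> Pi mB; rewrite -prodm_section//; last exact: measurable_cell.
have mT : mrestr prodm (measurable_cellX i) setT = P (cell i).
  rewrite /mrestr setTI; transitivity (P (cell i) * unif R setT)%E.
    by apply: product_measure1E => //; exact: measurable_cell.
  by rewrite probability_setT mule1.
have Pfin : P (cell i) \is a fin_num by apply: fin_num_measure; exact: measurable_cell.
have P0 : P (cell i) != 0%E by rewrite gt_eqF.
have -> : cell_law sg i B = (mrestr prodm (measurable_cellX i) (sg @^-1` B) * (fine (P (cell i)))^-1%:E)%E.
  exact: (mnormalizeE _ _ mT P0 Pfin).
rewrite /mrestr setIC -muleA -{2}(fineK Pfin) -EFinM mulVf ?mule1//.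
by rewrite fine_eq0.
Qed.

Lemma cell_law_total sg i : timed T sg -> cell_law sg i (time_set T) = 1%E.
Proof.
move=> tsg; rewrite /cell_law /= /distribution /pushforward.
rewrite (_ : _ @^-1` _ = setT) ?probability_setT//.
by apply/seteqP; split => // v _; exact: tsg.
Qed.

Lemma cdf_cell_law sg i q : (0 < P (cell i))%E -> timed T sg ->
  cdf T (cell_law sg i) q * fine (P (cell i)) = \int[P]_(w in cell i) level T sg w q.
Proof.
move=> Pi tsg; have mS : measurable (time_set T `&` [set t | (t <= q)%E]).
  by apply: measurableI; [exact: measurable_time_set|exact: measurable_leE].
rewrite /cdf -fineM ?fin_num_measure//; last exact: measurable_cell.
rewrite cell_lawE// /Rintegral; congr fine; apply: eq_integral => w _.
by rewrite /level /cdf fineK// fin_num_measure.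
Qed.

Lemma cdf_left_cell_law sg i q : (0 < P (cell i))%E -> timed T sg ->
  cdf_left T (cell_law sg i) q * fine (P (cell i)) =
  \int[P]_(w in cell i) cdf_left T (time_law sg w) q.
Proof.
move=> Pi tsg; have mS : measurable (time_set T `&` [set t | (t < q)%E]).
  by apply: measurableI; [exact: measurable_time_set|exact: measurable_ltE].
rewrite /cdf_left -fineM ?fin_num_measure//; last exact: measurable_cell.
rewrite cell_lawE// /Rintegral; congr fine; apply: eq_integral => w _.
by rewrite fineK// fin_num_measure.
Qed.

(** Absolute values and normalization make this a probability for any real weights; for convex
    weights it is the plain mixture. *)
Definition mix_law (c : nat -> probability (\bar R) R) (y : nat -> R) N : probability (\bar R) R :=
  mnormalize (msum (fun j => mscale (`|y j|)%:nng (c j)) N) (c 0%N).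

Lemma mix_lawE (c : nat -> probability (\bar R) R) (y : nat -> R) N B : (forall j, 0 <= y j) -> \sum_(j < N) y j = 1 ->
  mix_law c y N B = (\sum_(j < N) (y j)%:E * c j B)%E.
Proof.
move=> y0 y1; have E (S : set (\bar R)) : msum (fun j => mscale (`|y j|)%:nng (c j)) N S = (\sum_(j < N) (y j)%:E * c j S)%E.
  by rewrite /msum; apply: eq_bigr => j _; rewrite /mscale /=;
    congr (_%:E * _)%E; exact: ger0_norm.
have E1 : msum (fun j => mscale (`|y j|)%:nng (c j)) N setT = 1%E.
  rewrite E; under eq_bigr do rewrite probability_setT mule1.
  by rewrite sumEFin y1.
have := mnormalizeE (c 0%N) B E1 onee_neq0 isT.
by rewrite /= invr1 mule1 E.
Qed.

(** Proved on the complement of the time set, which is null whether or not the normalization falls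
    back on [c 0]. *)
Lemma mix_law_total (c : nat -> probability (\bar R) R) (y : nat -> R) N :
  (forall j, c j (time_set T) = 1%E) -> mix_law c y N (time_set T) = 1%E.
Proof.
move=> c1; have D1 (Q : probability (\bar R) R) : Q (time_set T) = 1%E -> Q (~` time_set T) = 0%E.
  by move=> Q1; rewrite probability_setC ?Q1 ?subee//; exact: measurable_time_set.
have : mix_law c y N (~` time_set T) = 0%E.
  rewrite -[LHS]/(mnormalize (msum (fun j => mscale (`|y j|)%:nng (c j)) N) (c 0%N) (~` time_set T)).
  rewrite /mnormalize; case: ifP => _; first by exact: (D1 _ (c1 0%N)).
  apply/eqP; rewrite mule_eq0; apply/orP; left; apply/eqP.
  apply: big1 => j _; apply/eqP; rewrite mule_eq0; apply/orP; right; apply/eqP.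
  exact: (D1 _ (c1 j)).
rewrite probability_setC; last exact: measurable_time_set.
have : mix_law c y N (time_set T) \is a fin_num by apply: fin_num_measure; exact: measurable_time_set.
by case: (mix_law _ _ _ _) => // r _ [] /eqP; rewrite subr_eq0 => /eqP ->.
Qed.

Lemma cdf_mix_law (c : nat -> probability (\bar R) R) (y : nat -> R) N q : (forall j, 0 <= y j) -> \sum_(j < N) y j = 1 ->
  cdf T (mix_law c y N) q = \sum_(j < N) y j * cdf T (c j) q.
Proof.
move=> y0 y1; have E := mix_lawE c (time_set T `&` [set t | (t <= q)%E]) y0 y1.
rewrite /cdf (_ : fine _ = fine (\sum_(j < N) (y j)%:E * c j (time_set T `&` [set t | (t <= q)%E]))%E); last first.
  by congr fine; exact: E.
have mS : measurable (time_set T `&` [set t | (t <= q)%E]).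
  by apply: measurableI; [exact: measurable_time_set|exact: measurable_leE].
rewrite -[RHS]/(fine (_%:E)) -sumEFin; congr fine; apply: eq_bigr => j _.
by rewrite EFinM fineK// fin_num_measure.
Qed.

Lemma law_of_cells_measurable (c : nat -> pprobability (\bar R) R) :
  measurable_wrt G (fun w => c (idx w)).
Proof.
move=> _ B mB; rewrite setTI; apply: sub_sigma_algebra.
exact: (G_idx [set i | B (c i)]).
Qed.

Definition law_of_cells (c : nat -> pprobability (\bar R) R)
    (c1 : forall i, c i (time_set T) = 1%E) : random_law T G :=
  RandomLaw (law_of_cells_measurable c) (fun w => c1 (idx w)).

Lemma prod_lebesgue_section sg tau (A : set Omega) (B : set (\bar R)) :
  (forall z, sg z = clamp_ext tau z) -> measurable A -> measurable B ->
  (P \x lebesgue_measure)%E ((A `*` `[0%R, 1%R]) `&` tau @^-1` B) =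
  (\int[P]_(w in A) time_law sg w B)%E.
Proof.
move=> sgE mA mB; rewrite [RHS]integral_mkcond /= /product_measure1.
apply: eq_integral => w _; rewrite /= patchE; case: ifPn => [|]; rewrite ?inE ?notin_setE => wA.
  rewrite /time_law /= /distribution /pushforward /unif /= /uniform_prob integral_uniform_pdf.
  have mS : measurable ((section_at sg w @^-1` B) `&` `[0, 1]).
    apply: measurableI => //; rewrite -[X in measurable X]setTI.
    exact: (measurable_section_at sg w).
  rewrite (eq_integral (cst 1%E)); last first.
    move=> v; rewrite inE => -[_] /=; rewrite in_itv /= => v01.
    by rewrite /uniform_pdf v01 subr0 invr1.
  rewrite integral_cst// mul1e /=; congr (lebesgue_measure _).
  apply/seteqP; split => v; rewrite /xsection /= inE /= /section_at sgE /clamp_ext /=.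
    by move=> [[_] + Bv]; rewrite in_itv /= => v01; rewrite clamp_id.
  by rewrite in_itv /= => -[+ v01]; rewrite clamp_id.
rewrite (_ : xsection _ _ = set0) ?measure0//.
by apply/seteqP; split => // v; rewrite /xsection /= inE => -[[/wA]].
Qed.

(** A set of [G] is a countable union of cells. On each cell the law is constant, and its mass times
    the probability of the cell is the integral of the sectional laws. *)
Lemma law_of_cells_conditional sg tau (c1 : forall i, cell_law sg i (time_set T) = 1%E) :
  (forall z, sg z = clamp_ext tau z) ->
  conditional_law P tau (law_of_cells c1).
Proof.
move=> sgE A B GA mB; have mA := G_measurable GA.
rewrite (prod_lebesgue_section sgE mA mB).
pose k w := cell_law sg (idx w) B.
have mk : measurable_fun setT k.
  by move=> _ Y _; rewrite setTI; exact: (G_measurable (G_idx [set i | Y (cell_law sg i B)])).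
have mti := measurable_time_law sg mB.
have -> : (\int[P \x lebesgue_measure]_(z in A `*` `[0%R, 1%R]) law_of_cells c1 z.1 B =
   \int[P]_(w in A) k w)%E.
  have mAI : measurable (A `*` `[0%R, 1%R] : set (Omega * RR)).
    by apply: measurableX => //; exact: measurable_itv.
  have mkz : measurable_fun [set: (Omega * RR)%type] (fun z => k z.1).
    exact: (measurableT_comp mk measurable_fst).
  rewrite -[LHS]/(\int[P \x lebesgue_measure]_(z in A `*` `[0%R, 1%R]) k z.1)%E.
  rewrite integral_mkcond fubini_tonelli1; last 2 first.
  - apply: (iffLR (measurable_restrictT (fun z => k z.1) mAI)).
    exact: (measurable_funS measurableT (@subsetT _ _) mkz).
  - by move=> z; rewrite patchE; case: ifPn.
  rewrite [RHS]integral_mkcond; apply: eq_integral => w _; rewrite /fubini_F patchE.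
  case: ifPn => [/set_mem Aw|/negP wA]; last first.
    rewrite (eq_integral (cst 0%E)) ?integral0// => v _; rewrite patchE ifF//.
    by apply/negbTE/negP; rewrite inE => -[] /= Aw _; apply: wA; rewrite inE.
  rewrite (eq_integral ((cst (k w) : RR -> \bar R) \_ (`[0%R, 1%R]%classic : set RR))); last first.
    move=> v _; rewrite !patchE; congr (if _ then _ else _).
    by apply/idP/idP; [rewrite !inE => -[]|rewrite !inE => v01; split].
  rewrite -integral_mkcond integral_cst//= lebesgue_measure_itv /= lte_fin ltr01.
  by rewrite sube0 mule1.
have [S AS] := G_char GA.
pose C i := if i \in S then cell i else set0.
have AC : A = \bigcup_i C i.
  rewrite AS; apply/seteqP; split => w /=.
    by move=> Sw; exists (idx w) => //; rewrite /C mem_set.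
  by move=> [i _]; rewrite /C; case: ifPn => // /set_mem Si; rewrite /cell /= => ->.
have mC i : measurable (C i) by rewrite /C; case: ifPn => // _; exact: measurable_cell.
have tC : trivIset setT C.
  apply/trivIsetP => i j _ _ ij; rewrite /C.
  case: ifPn => _; last by rewrite set0I.
  case: ifPn => _; last by rewrite setI0.
  apply/seteqP; split => // w [] /= wi wj; move: ij.
  by rewrite -wi -wj eqxx.
rewrite AC !ge0_integral_bigcup//; last 2 first.
  by apply: measurable_funTS.
  by apply: measurable_funTS.
apply: eq_eseriesr => i _; rewrite /C; case: ifPn => _; last by rewrite !integral_set0.
have [[w wi]|] := pselect (cell i !=set0); last first.
  by move=> /set0P/negP/negPn/eqP ->; rewrite !integral_set0.
have Pi : (0 < P (cell i))%E by have := cell_pos w; rewrite wi.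
rewrite -cell_lawE//.
rewrite (eq_integral (cst (cell_law sg i B))); last by move=> u /set_mem ui; rewrite /k ui.
by rewrite integral_cst//; exact: measurable_cell.
Qed.
End cells.

(** * Upper limits in [0, 1], choice along histories, dyadic averages *)

Lemma bounded_fun01 (R : realType) (u : nat -> R) : (forall n, 0 <= u n <= 1) -> bounded_fun u.
Proof.
move=> u01; exists 1; split; first exact: num_real.
move=> x x1 n _ /=; have /andP[u0 u1] := u01 n.
by rewrite ger0_norm// (le_trans u1)// ltW.
Qed.

Lemma le_limn_sup01 (R : realType) (u v : nat -> R) :
  (forall n, 0 <= u n <= 1) -> (forall n, 0 <= v n <= 1) -> (forall n, u n <= v n) ->
  limn_sup u <= limn_sup v.
Proof.
move=> u01 v01 uv; rewrite !limn_supE; [|exact: bounded_fun01|exact: bounded_fun01].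
have hs (t : nat -> R) n : (forall n, 0 <= t n <= 1) -> has_sup (sdrop t n).
  move=> t01; split; first by exists (t n), n => //=.
  by exists 1 => _ [k _ <-]; have /andP[] := t01 k.
apply: lb_le_inf; first by exists (sups v 0%N), 0%N.
move=> _ [n _ <-]; apply: le_trans (_ : sups u n <= _).
  apply: ge_inf; last by exists n.
  exists 0 => _ [k _ <-]; apply: le_trans (_ : u k <= _); first by have /andP[] := u01 k.
  by apply: ub_le_sup; [exact: (hs u k u01).2|exists k => /=].
apply: ge_sup; first exact: (hs u n u01).1.
move=> _ [k /= nk <-]; apply: le_trans (uv k) _.
by apply: ub_le_sup; [exact: (hs v n v01).2|exists k].
Qed.

Lemma limn_sup_cst (R : realType) (c : R) : limn_sup (fun=> c) = c.
Proof. by rewrite cvg_limn_supE; [exact: lim_cst|exact: is_cvg_cst]. Qed.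

Lemma limn_sup01 (R : realType) (u : nat -> R) :
  (forall n, 0 <= u n <= 1) -> 0 <= limn_sup u <= 1.
Proof.
move=> u01; apply/andP; split.
  rewrite -[leLHS](@limn_sup_cst R 0); apply: le_limn_sup01 => // n.
    by rewrite lexx ler01.
  by have /andP[] := u01 n.
rewrite -[leRHS](@limn_sup_cst R 1); apply: le_limn_sup01 => // n.
  by rewrite lexx ler01.
by have /andP[] := u01 n.
Qed.

(** Dependent choice in which a term may depend on the whole list of its predecessors, as a nearly
    optimal strategy does through the mixture of all earlier ones. *)
Lemma history_choice (X : Type) (Q : seq X -> X -> Prop) :
  (forall s, exists x, Q s x) -> exists sg : nat -> X, forall n, Q (mkseq sg n) (sg n).
Proof.
move=> /choice[next HQ].
pose S := fix S n := if n is m.+1 then rcons (S m) (next (S m)) else [::].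
exists (fun n => next (S n)) => n; suff -> : mkseq (fun n => next (S n)) n = S n by [].
elim: n => // n IH; rewrite /mkseq -[in LHS]addn1 iotaD map_cat -/(mkseq _ _) IH.
by rewrite /= cats1.
Qed.

Section dyadic.
Variable R : realType.

(** Formal iterated midpoints. Keeping the tree as syntax lets one and the same combination act on
    distribution functions, on their integrals and on values. *)
Inductive dyadic := Leaf of nat | Mid of dyadic & dyadic.

Fixpoint average (x : nat -> R) (t : dyadic) : R := match t with
  | Leaf l => x l
  | Mid a b => (average x a + average x b) / 2
  end.

Lemma average_ge0 x t : (forall l, 0 <= x l) -> 0 <= average x t.
Proof. by move=> x0; elim: t => //= a IHa b IHb; rewrite divr_ge0// addr_ge0. Qed.

Lemma average_le1 x t : (forall l, x l <= 1) -> average x t <= 1.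
Proof. by move=> x1; elim: t => //= a IHa b IHb; lra. Qed.

Lemma le_average x x' t : (forall l, x l <= x' l) -> average x t <= average x' t.
Proof. by move=> xx; elim: t => //= a IHa b IHb; lra. Qed.

Lemma average_tail_ge (x : nat -> R) (c : R) n t : tail_hull Mid Leaf n t ->
  (forall l, (n <= l)%N -> c <= x l) -> c <= average x t.
Proof.
by move=> tn xc; apply: (tn (fun t => c <= average x t)) => // a b /= ? ?; lra.
Qed.

Lemma average_cvg (x : nat -> R) (c : R) (t : nat -> dyadic) : (forall n, tail_hull Mid Leaf n (t n)) ->
  x l @[l --> \oo] --> c -> average x (t n) @[n --> \oo] --> c.
Proof.
move=> tn /cvgrPdist_le xc; apply/cvgrPdist_le => e e0.
have [N _ NP] := xc e e0; exists N => // n /= Nn.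
apply: (tn n (fun t => `|c - average x t| <= e)) => [a b /=|l nl].
  by rewrite !ler_norml => /andP[? ?] /andP[? ?]; apply/andP; split; lra.
by apply: NP; exact: leq_trans nl.
Qed.

Lemma average_cst (c : R) t : average (fun=> c) t = c.
Proof. by elim: t => //= a -> b ->; lra. Qed.

Lemma measurable_average d (X : measurableType d) (x : nat -> X -> R) t :
  (forall l, measurable_fun setT (x l)) -> measurable_fun setT (fun w => average (x ^~ w) t).
Proof.
move=> mx; elim: t => //= a IHa b IHb.
by apply: measurable_funM => //; exact: measurable_funD.
Qed.

Lemma integrable_average d (X : measurableType d) (mu : {measure set X -> \bar R}) D
    (x : nat -> X -> R) t : measurable D ->
  (forall l, mu.-integrable D (EFin \o x l)) ->
  mu.-integrable D (EFin \o (fun w => average (x ^~ w) t)) /\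
  \int[mu]_(w in D) average (x ^~ w) t = average (fun l => \int[mu]_(w in D) x l w) t.
Proof.
move=> mD ix; elim: t => [l|a [ia Ea] b [ib Eb]] /=; first by split => //; exact: ix.
have iab : mu.-integrable D (EFin \o (fun w => average (x ^~ w) a + average (x ^~ w) b)).
  by have := integrableD mD ia ib.
split; last by rewrite RintegralZr// RintegralD// Ea Eb.
by have := integrableZr mD 2^-1 iab.
Qed.
End dyadic.

Lemma Rintegral_wsum d (X : measurableType d) (R : realType) (mu : {measure set X -> \bar R})
    (D : set X) (y : nat -> R) (f : nat -> X -> R) n : measurable D ->
  (forall j, mu.-integrable D (EFin \o f j)) ->
  mu.-integrable D (EFin \o (fun x => \sum_(j < n) y j * f j x)) /\
  \int[mu]_(x in D) (\sum_(j < n) y j * f j x) = \sum_(j < n) y j * \int[mu]_(x in D) f j x.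
Proof.
move=> mD fi; elim: n => [|n [IHi IH]].
  rewrite big_ord0 (_ : (fun x => _) = cst 0); last by apply/funext => x; rewrite big_ord0.
  by split; [exact: integrable0|rewrite /Rintegral integral0].
have yi := integrableZl mD (y n) (fi n).
have -> : (fun x => \sum_(j < n.+1) y j * f j x) =
    (fun x => \sum_(j < n) y j * f j x + y n * f n x).
  by apply/funext => x; rewrite big_ord_recr.
split; first by have := integrableD mD IHi yi.
by rewrite RintegralD// IH RintegralZl// big_ord_recr.
Qed.

Lemma Rintegral_dominated_cvg d (X : measurableType d) (R : realType)
    (mu : {measure set X -> \bar R}) (D : set X) (f_ : nat -> X -> R) (f g : X -> R) :
  measurable D ->
  (forall n, measurable_fun setT (f_ n)) -> measurable_fun setT f ->
  {ae mu, forall x, f_ n x @[n --> \oo] --> f x} ->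
  mu.-integrable D (EFin \o g) ->
  (forall n x, `|f_ n x| <= g x) ->
  \int[mu]_(x in D) f_ n x @[n --> \oo] --> \int[mu]_(x in D) f x.
Proof.
move=> mD mf_ mf ff ig fg.
have [||||ifin _ H] := @dominated_convergence _ _ _ mu D mD
  (fun n x => (f_ n x)%:E) (EFin \o f) (EFin \o g) _ _ _ ig.
- by move=> n; apply/measurable_EFinP; exact: measurable_funTS.
- by apply/measurable_EFinP; exact: measurable_funTS.
- by apply: filterS ff => x H _; apply: cvg_EFin => //; exact: nearW.
- by apply: aeW => x n _ /=; rewrite lee_fin.
- have := integrable_fin_num mD ifin.
  by move=> Hf; apply: fine_cvg; rewrite fineK.
Qed.

(** * Equilibria for continuous payoffs *)

Lemma integrable01 d (X : measurableType d) (R : realType) (P : probability X R)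
    (D : set X) (f : X -> R) : measurable D -> measurable_fun setT f ->
  (forall x, 0 <= f x <= 1) -> P.-integrable D (EFin \o f).
Proof.
move=> mD mf f01; apply: measurable_bounded_integrable => //.
- by apply: le_lt_trans (probability_le1 P mD) _; exact: ltry.
- exact: measurable_funTS.
- exists 1; split; first exact: num_real.
  move=> x x1 t _ /=; have /andP[f0 f1] := f01 t.
  by rewrite ger0_norm// (le_trans f1)// ltW.
Qed.

Section equilibrium.
Context d (Omega : measurableType d) (R : realType).
Local Notation RR := (measurableTypeR R).
Local Notation mfunT := {mfun (Omega * RR)%type >-> \bar R}.
Variables (P : probability Omega R) (T : \bar R) (F : \bar R -> set (set Omega)) (G : set (set Omega)).
Hypotheses (T0 : (0 <= T)%E) (filtF : is_filtration T F) (usualF : usual_conditions P T F).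
Variable idx : Omega -> nat.
Hypothesis G_idx : forall S : set nat, G (idx @^-1` S).
Hypothesis G_measurable : forall A, G A -> measurable A.
Hypothesis G_char : forall A, G A -> exists S : set nat, A = idx @^-1` S.
Hypothesis cell_pos : forall w, (0 < P (idx @^-1` [set idx w]))%E.

Variable Phi : random_law T G -> Omega -> \bar R -> R.
Implicit Types (m : random_law T G) (sg : mfunT).

Definition inner m sg w : R := \int[unif R]_v Phi m w (sg (w, v)).
Definition value m sg : R := \int[P]_w inner m sg w.

Hypothesis Phi_meas : forall m,
  measurable_fun ([set: Omega] `*` time_set T) (fun z : Omega * \bar R => Phi m z.1 z.2).
Hypothesis Phi_cont : forall m w, {within time_set T, continuous (Phi m w)}.
Hypothesis Phi_bound : forall m, exists2 K : Omega -> R, P.-integrable setT (EFin \o K) &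
  forall w t, time_set T t -> `|Phi m w t| <= K w.
Hypothesis Phi_stable : forall (mn : nat -> random_law T G) m,
  (forall w, weak_cvg T (fun n => mn n w) (m w)) -> forall e, 0 < e ->
  \forall n \near \oo, forall sg, timed T sg -> `|value (mn n) sg - value m sg| <= e.

Lemma integrable_section m sg w : timed T sg ->
  (unif R).-integrable setT (EFin \o (fun v => Phi m w (sg (w, v)))).
Proof.
move=> tsg; have [M PhiM] := within_time_set_bounded T0 (@Phi_cont m w).
apply: measurable_bounded_integrable => //.
- by rewrite [X in (X < _)%E](_ : _ = 1%E) ?ltry//; exact: (probability_setT (unif R)).
- apply: (measurable_comp (measurable_time_set T) _
    (within_time_set_measurable T0 (@Phi_cont m w)) (measurable_section_at sg w)).
  by move=> _ [v _ <-]; exact: tsg.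
- exists M; split; first exact: num_real.
  by move=> x Mx v _ /=; apply: ltW; apply: le_lt_trans Mx; exact: PhiM.
Qed.

(** The payoff sees a strategy only through its conditional law, hence depends linearly on the
    conditional distribution function. *)
Lemma inner_time_law m sg w : timed T sg ->
  inner m sg w = \int[time_law sg w]_(t in time_set T) Phi m w t.
Proof.
move=> tsg; have mT := measurable_time_set T.
have m1 := time_law_total w tsg.
pose f : \bar R -> \bar R := (EFin \o Phi m w) \_ (time_set T).
have mf : measurable_fun setT f.
  apply: (iffLR (measurable_restrictT _ mT)); apply/measurable_EFinP.
  exact: within_time_set_measurable.
have fE v : f (sg (w, v)) = (Phi m w (sg (w, v)))%:E by rewrite /f patchE mem_set.
rewrite /inner /Rintegral; congr fine; rewrite [RHS]integral_mkcond -/f.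
rewrite (integral_pushforward (measurable_section_at sg w) (f := f))//.
  by rewrite preimage_setT; apply: eq_integral => v _ /=; rewrite -fE.
rewrite preimage_setT; apply: (@eq_integrable _ _ _ _ _ _ (EFin \o (fun v => Phi m w (sg (w, v))))) => //.
  by move=> v _ /=; rewrite -fE.
exact: integrable_section.
Qed.

Let prod_fun m sg (z : Omega * RR) : R := Phi m z.1 (sg z).

Lemma measurable_prod_fun m sg : timed T sg -> measurable_fun setT (prod_fun m sg).
Proof.
move=> tsg.
have mh : measurable_fun setT (fun z : Omega * RR => (z.1, sg z)).
  apply/measurable_fun_pairP; split; first exact: measurable_fst.
  exact: measurable_funPT.
apply: (measurable_comp _ _ (Phi_meas m) mh).
  by apply: measurableX => //; exact: measurable_time_set.
by move=> _ [z _ <-]; split => //=; exact: tsg.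
Qed.

Lemma integrable_prod_fun m sg : timed T sg -> (P \x unif R)%E.-integrable setT (EFin \o prod_fun m sg).
Proof.
move=> tsg; have [K iK PhiK] := Phi_bound m.
have mf := measurable_prod_fun m tsg.
have mEf : measurable_fun setT (EFin \o prod_fun m sg) by exact/measurable_EFinP.
apply/integrable12ltyP => //.
apply: (@le_lt_trans _ _ (\int[P]_w `|(K w)%:E|)%E); last first.
  by move/integrableP: iK => [_].
have mK : measurable_fun setT K by apply/measurable_EFinP; case/integrableP: iK.
apply: ge0_le_integral => //.
- by move=> w _; apply: integral_ge0.
- apply: (measurable_fun_fubini_tonelli_F (abse \o (EFin \o prod_fun m sg))) => //.
    exact: measurableT_comp.
  by move=> z; exact: abse_ge0.
- by apply: measurableT_comp => //; exact/measurable_EFinP.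
move=> w _.
have -> : `|(K w)%:E|%E = (\int[unif R]_v cst `|(K w)%:E|%E v)%E.
  by rewrite integral_cst// [X in (_ * X)%E](_ : _ = 1%E) ?mule1//; exact: (probability_setT (unif R)).
apply: ge0_le_integral => //.
- have /integrableP[mS _] := integrable_section m w tsg.
  by apply: (measurableT_comp _ mS); exact: abse_measurable.
- by move=> v _ /=; rewrite lee_fin (le_trans (PhiK _ _ (tsg _)))// ler_norm.
Qed.

Lemma innerE m sg w : timed T sg ->
  (inner m sg w)%:E = fubini_F (unif R) (EFin \o prod_fun m sg) w.
Proof.
move=> tsg; rewrite /inner /Rintegral fineK//.
by apply: integrable_fin_num => //; exact: integrable_section.
Qed.

Lemma integrable_inner m sg : timed T sg -> P.-integrable setT (EFin \o inner m sg).
Proof.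
move=> tsg; have := integrable_fubini_F (integrable_prod_fun m tsg).
by congr (_.-integrable _ _); apply/funext => w; rewrite -innerE.
Qed.

Lemma inner_le m sg K w : timed T sg -> (forall t, time_set T t -> `|Phi m w t| <= K) ->
  `|inner m sg w| <= K.
Proof.
move=> tsg PhiK; have iS := integrable_section m w tsg.
apply: le_trans (le_normr_Rintegral measurableT iS) _.
have -> : K = \int[unif R]_v K.
  rewrite Rintegral_cst// [X in fine X](_ : _ = 1%E) ?mulr1//; exact: (probability_setT (unif R)).
apply: le_Rintegral => //.
- exact: integrable_norm.
- exact: finite_measure_integrable_cst.
- by move=> v _; exact: PhiK.
Qed.

Definition admissible sg := exists2 sigma,
  randomized_stopping_time T F sigma & forall z, sg z = clamp_ext sigma z.

Definition strategy := {sg : mfunT | admissible sg}.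

Lemma strategy_timed (x : strategy) : timed T (sval x).
Proof. by move=> z; case: (svalP x) => sigma rs ->; exact: clamp_ext_time rs. Qed.

Lemma mk_strategy sigma : randomized_stopping_time T F sigma ->
  exists x : strategy, forall z, sval x z = clamp_ext sigma z.
Proof.
move=> rs; have mS : measurable_fun [set: (Omega * RR)%type] (clamp_ext sigma) := measurable_clamp_ext filtF rs.
pose sg : mfunT := @mfun_Sub _ _ (Omega * RR)%type (\bar R) (clamp_ext sigma) (mem_set mS).
have asg : admissible sg by exists sigma.
by exists (exist _ sg asg).
Qed.

Lemma exists_strategy : exists x : strategy, True.
Proof.
suff rs : randomized_stopping_time T F (fun=> 0%E) by have [x _] := mk_strategy rs; exists x.
split.
- by move=> z _; exact: time_set0.
- move=> t Tt; split; first by move=> z [].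
  rewrite (_ : _ `&` _ = tOmega (Omega := Omega) (R := R)).
    by apply: measurableX => //; exact: measurable_itv.
  by apply/seteqP; split => [z []//|z tz]; split => //; exact: Tt.1.
- by [].
- by move=> w v _ _; exact: cvg_cst.
Qed.

Definition mixed_cell_law (s : nat -> strategy) (y : nat -> R) N i : probability (\bar R) R :=
  mix_law (fun j => cell_law P G_idx G_measurable (sval (s j)) i) y N.

Lemma mixed_cell_law_total s y N i : mixed_cell_law s y N i (time_set T) = 1%E.
Proof. by apply: mix_law_total => j; apply: cell_law_total; exact: strategy_timed. Qed.

Definition mixed_law s y N : random_law T G := law_of_cells G_idx (mixed_cell_law_total s y N).

Definition mean_value m (s : nat -> strategy) (y : nat -> R) N :=
  \sum_(j < N) y j * value m (sval (s j)).

Lemma value_bound m : exists B, forall x : strategy, value m (sval x) <= B.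
Proof.
have [K iK PhiK] := Phi_bound m; exists (\int[P]_w K w) => x.
apply: le_Rintegral => //; first exact: integrable_inner (strategy_timed x).
move=> w _; apply: le_trans (ler_norm _) _.
by apply: inner_le => [|t Tt]; [exact: strategy_timed|exact: PhiK].
Qed.

Lemma nearly_optimal m (e : R) : 0 < e ->
  exists x : strategy, forall x' : strategy, value m (sval x') <= value m (sval x) + e.
Proof.
move=> e0; have [B xB] := value_bound m; have [x0 _] := exists_strategy.
have hs : has_sup (range (fun x : strategy => value m (sval x))).
  by split; [exists (value m (sval x0)), x0|exists B => _ [x _ <-]].
have [_ [x _ <-] xP] := sup_adherent e0 hs.
exists x => x'; rewrite -lerBlDr; apply/ltW; apply: le_lt_trans xP.
by rewrite lerD2r; apply: ub_le_sup; [exact: hs.2|exists x'].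
Qed.

(** The payoff of the index [i] at weights [x] is the value of [s i] against the law generated by
    [x]. Distribution functions of that law are linear in [x], so the laws converge weakly with the
    weights, and [Phi_stable] gives the continuity that [simplex_equilibrium] asks for. *)
Lemma mixed_equilibrium (s : nat -> strategy) N : exists y : nat -> R,
  [/\ forall j, 0 <= y j, \sum_(j < N.+1) y j = 1 &
  forall i, (i < N.+1)%N -> value (mixed_law s y N.+1) (sval (s i)) <=
    mean_value (mixed_law s y N.+1) s y N.+1].
Proof.
pose ext (x : 'I_N.+1 -> R) (j : nat) : R := if (j < N.+1)%N then x (inord j) else 0.
have extE x (j : 'I_N.+1) : ext x j = x j by rewrite /ext ltn_ord inord_val.
have ext0 x : simplex x -> forall j, 0 <= ext x j.
  by move=> [x0 _] j; rewrite /ext; case: ifP.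
have ext1 x : simplex x -> \sum_(j < N.+1) ext x j = 1.
  by move=> [_ x1]; under eq_bigr do rewrite extE.
pose a (i : 'I_N.+1) x := value (mixed_law s (ext x) N.+1) (sval (s i)).
have [x xS xP] : exists2 x, simplex x & forall i, a i x <= \sum_j x j * a j x.
  apply: (simplex_equilibrium ord0) => xn y xnS yS xny i.
  have wc w : weak_cvg T (fun n => mixed_law s (ext (xn n)) N.+1 w) (mixed_law s (ext y) N.+1 w).
    apply: (@weak_cvg_cdf _ T _ _ (cdf T (mixed_cell_law s (ext y) N.+1 (idx w)))) => //.
    - by move=> n; exact: mixed_cell_law_total.
    - exact: mixed_cell_law_total.
    - move=> k; have cE z : simplex z -> cdf T (mixed_law s (ext z) N.+1 w) (dense_time T k) =
          \sum_(j < N.+1) ext z j *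
            cdf T (cell_law P G_idx G_measurable (sval (s j)) (idx w)) (dense_time T k).
        move=> zS; transitivity (cdf T (mixed_cell_law s (ext z) N.+1 (idx w)) (dense_time T k)) => //.
        by apply: cdf_mix_law; [exact: ext0|exact: ext1].
      rewrite [X in _ --> X](cE _ yS) (_ : (fun n => _) = fun n => \sum_(j < N.+1) ext (xn n) j *
            cdf T (cell_law P G_idx G_measurable (sval (s j)) (idx w)) (dense_time T k)).
      2: by apply/funext => n; exact: cE.
      apply: cvg_sum => j _; apply: cvgMl.
      by rewrite extE; under eq_fun do rewrite extE; exact: xny.
    - by move=> k; rewrite lexx andbT; apply: cdf_left_le; exact: mixed_cell_law_total.
  apply/cvgrPdist_le => e e0; apply: filterS (Phi_stable wc e0) => n H.
  by rewrite distrC; apply: H; exact: strategy_timed.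
exists (ext x); split; [exact: ext0|exact: ext1|].
move=> i iN; have := xP (Ordinal iN); rewrite /mean_value.
by under [X in _ <= X -> _]eq_bigr do rewrite -extE.
Qed.

(** Requirement on a strategy [x] that extends the history [s]. An empty history, which has no
    mixture, imposes nothing. *)
Definition approx_step (x0 : strategy) (s : seq strategy) (x : strategy) : Prop :=
  s = [::] \/ exists y : nat -> R, [/\ forall j, 0 <= y j, \sum_(j < size s) y j = 1,
    forall i, (i < size s)%N ->
      value (mixed_law (nth x0 s) y (size s)) (sval (nth x0 s i)) <=
      mean_value (mixed_law (nth x0 s) y (size s)) (nth x0 s) y (size s) &
    forall x' : strategy, value (mixed_law (nth x0 s) y (size s)) (sval x') <=
      value (mixed_law (nth x0 s) y (size s)) (sval x) + (size s)%:R^-1].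

Lemma exists_approx_step x0 s : exists x, approx_step x0 s x.
Proof.
case: s => [|x1 s]; first by exists x0; left.
have [y [y0 y1 yP]] := mixed_equilibrium (nth x0 (x1 :: s)) (size s).
have e0 : 0 < (size (x1 :: s))%:R^-1 :> R by rewrite invr_gt0 ltr0n.
have [x xP] := nearly_optimal (mixed_law (nth x0 (x1 :: s)) y (size (x1 :: s))) e0.
by exists x; right; exists y.
Qed.

(** The law of stage [n] comes from [s 0], ..., [s n], and [s n.+1] answers it. Of the mixed laws
    only the distribution functions on each cell are retained. *)
Lemma approximate_equilibria : exists (s : nat -> strategy) (m : nat -> random_law T G)
    (c : nat -> nat -> probability (\bar R) R) (y : nat -> nat -> R),
  [/\ forall n w, m n w = c n (idx w) :> (set (\bar R) -> \bar R),
      (forall n j, 0 <= y n j) /\ (forall n, \sum_(j < n.+1) y n j = 1),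
      (forall n i, c n i (time_set T) = 1%E) /\
      (forall n i q, cdf T (c n i) q =
        \sum_(j < n.+1) y n j * cdf T (cell_law P G_idx G_measurable (sval (s j)) i) q),
      forall n i, (i <= n)%N -> value (m n) (sval (s i)) <=
        \sum_(j < n.+1) y n j * value (m n) (sval (s j)) &
      forall n (x' : strategy), value (m n) (sval x') <= value (m n) (sval (s n.+1)) + n.+1%:R^-1].
Proof.
have [x0 _] := exists_strategy.
have [s sP] := history_choice (exists_approx_step x0).
have yex n : exists y : nat -> R, [/\ forall j, 0 <= y j, \sum_(j < n.+1) y j = 1,
    forall i, (i < n.+1)%N ->
      value (mixed_law (nth x0 (mkseq s n.+1)) y n.+1) (sval (s i)) <=
      \sum_(j < n.+1) y j * value (mixed_law (nth x0 (mkseq s n.+1)) y n.+1) (sval (s j)) &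
    forall x' : strategy, value (mixed_law (nth x0 (mkseq s n.+1)) y n.+1) (sval x') <=
      value (mixed_law (nth x0 (mkseq s n.+1)) y n.+1) (sval (s n.+1)) + n.+1%:R^-1].
  have [//|[y]] := sP n.+1; rewrite size_mkseq => -[y0 y1 yP yO].
  exists y; split => // i iN; have := yP i iN; rewrite nth_mkseq// /mean_value.
  by under eq_bigr do rewrite nth_mkseq//.
have [y yP] := choice yex.
exists s, (fun n => mixed_law (nth x0 (mkseq s n.+1)) (y n) n.+1),
  (fun n i => mixed_cell_law (nth x0 (mkseq s n.+1)) (y n) n.+1 i), y; split => //.
- by split => n; have [] := yP n.
- split => [n i|n i q]; first exact: mixed_cell_law_total.
  have [y0 y1 _ _] := yP n; rewrite cdf_mix_law//.
  by apply: eq_bigr => j _; rewrite nth_mkseq.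
- by move=> n; have [_ _ H _] := yP n; exact: H.
- by move=> n; have [_ _ _ H] := yP n; exact: H.
Qed.

Lemma exists_equilibrium : exists (m : random_law T G) (tau : Omega * R -> \bar R) (x : strategy),
  [/\ randomized_stopping_time T F tau, conditional_law P tau m,
      forall z, sval x z = clamp_ext tau z &
      forall x' : strategy, value m (sval x') <= value m (sval x)].
Proof.
have [s [m [c [y [mc [y0 y1] [c1 cdfc] stepP optP]]]]] := approximate_equilibria.
(* Cells and dense times together are countable, so one extraction makes all cell distribution
   functions converge at all dense times. *)
have [|phi [phi_incr [lim_cdf lim_cdfP]]] := @bounded_subsequence R (nat * nat)%type
    (fun n p => cdf T (c n p.1) (dense_time T p.2)).
  move=> n [i k] /=; have /andP[h0 h1] := cdf01 (dense_time T k) (c1 n i).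
  by rewrite ger0_norm.
pose LS l w q := \sum_(j < (phi l).+1) y (phi l) j * level T (sval (s j)) w q.
have lev01 j w q : 0 <= level T (sval (s j)) w q <= 1 by apply: level01; exact: strategy_timed.
have LS01 l w q : 0 <= LS l w q <= 1.
  apply/andP; split.
    by apply: sumr_ge0 => j _; rewrite mulr_ge0//; have /andP[] := lev01 j w q.
  rewrite -(y1 (phi l)); apply: ler_sum => j _; rewrite ler_piMr//.
  by have /andP[] := lev01 j w q.
have LS_mono l w q q' : (q <= q')%E -> LS l w q <= LS l w q'.
  move=> qq; apply: ler_sum => j _; rewrite ler_wpM2l//.
  by apply: le_level => //; exact: strategy_timed.
have LST l w : LS l w T = 1.
  rewrite /LS -[RHS](y1 (phi l)); apply: eq_bigr => j _.
  by rewrite levelT ?mulr1//; exact: strategy_timed.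
have lev_adapted j q : time_set T q -> measurable_wrt (F q) (fun w => level T (sval (s j)) w q).
  move=> Tq; have [sigma rs sE] := svalP (s j).
  exact: (level_adapted rs sE Tq).
have LS_adapted l q : time_set T q -> measurable_wrt (F q) (fun w => LS l w q).
  move=> Tq; rewrite /measurable_wrt /LS; apply: measurable_sum => j.
  by apply: measurable_funM => //; exact: lev_adapted.
pose Lv t w q := average (fun l => LS l w q) t.
have Lv01 t w q : 0 <= Lv t w q <= 1.
  by rewrite average_ge0 ?average_le1// => l; have /andP[] := LS01 l w q.
have Lv_adapted t q : time_set T q -> measurable_wrt (F q) (fun w => Lv t w q).
  by move=> Tq; apply: measurable_average => l; exact: LS_adapted.
have mLv t q : time_set T q -> measurable_fun setT (fun w => Lv t w q).
  by move=> Tq; apply: (measurable_wrt_filtration filtF Tq); exact: Lv_adapted.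
have [t [tailt cvgt]] : exists t : nat -> dyadic, (forall n, tail_hull Mid Leaf n (t n)) /\
    {ae P, forall w, forall k, cvgn (fun n => Lv (t n) w (dense_time T k))}.
  apply: (@mazur _ Omega R P dyadic Mid (fun t k w => Lv t w (dense_time T k))) => //.
  by move=> x k; apply: mLv; exact: dense_timeP.
(* The upper limit is adapted, monotone and equal to one at [T] for every [w], with no exceptional
   set to remove; almost surely it is the limit at all dense times. *)
pose a w q : R := limn_sup (fun n => Lv (t n) w q).
have a01 w q : 0 <= a w q <= 1 by exact: limn_sup01.
have aT w : a w T = 1.
  rewrite /a (_ : (fun n => _) = fun=> 1) ?limn_sup_cst//; apply/funext => n.
  by rewrite /Lv (_ : (fun l => _) = fun=> 1) ?average_cst//; apply/funext => l; exact: LST.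
have a_mono w q q' : time_set T q -> time_set T q' -> (q <= q')%E -> a w q <= a w q'.
  move=> _ _ qq; apply: le_limn_sup01 => // n; apply: le_average => l; exact: LS_mono.
have a_adapted q : time_set T q -> measurable_wrt (F q) (fun w => a w q).
  move=> Tq; apply: (@measurable_fun_limn_sup _ (g_sigma_algebraType (F q)) _ setT (fun n w => Lv (t n) w q)).
  - by move=> w _; exists 1 => _ [n _ <-]; have /andP[] := Lv01 (t n) w q.
  - by move=> w _; exists 0 => _ [n _ <-]; have /andP[] := Lv01 (t n) w q.
  - by move=> n; exact: Lv_adapted.
have ma q : time_set T q -> measurable_fun setT (fun w => a w q).
  by move=> Tq; apply: (measurable_wrt_filtration filtF Tq); exact: a_adapted.
have cvga : {ae P, forall w, forall k, Lv (t n) w (dense_time T k) @[n --> \oo] --> a w (dense_time T k)}.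
  apply: filterS cvgt => w H k; rewrite /a cvg_limn_supE; first exact: H.
  exact: H.
pose tau := inverse_level T a.
have rst_tau : randomized_stopping_time T F tau by exact: (inverse_level_rst T0 filtF usualF a_adapted a_mono a01 aT).
have [x xE] := mk_strategy rst_tau.
have tx := strategy_timed x.
have sand w k : cdf_left T (time_law (sval x) w) (dense_time T k) <= a w (dense_time T k) <=
    cdf T (time_law (sval x) w) (dense_time T k).
  exact: (inverse_level_cdf T0 filtF usualF a_adapted a_mono a01 aT).
pose cs i := cell_law P G_idx G_measurable (sval x) i.
have cs1 i : cs i (time_set T) = 1%E by exact: cell_law_total.
pose ms := law_of_cells G_idx cs1.
have cond : conditional_law P tau ms by exact: law_of_cells_conditional.
have lev_int j i q : time_set T q -> P.-integrable (cell idx i) (EFin \o (fun w => level T (sval (s j)) w q)).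
  move=> Tq; have [sigma rs sE] := svalP (s j).
  have ml := measurable_wrt_filtration filtF Tq (lev_adapted j q Tq).
  apply: integrable01 => //; exact: (measurable_cell G_idx G_measurable).
have weak w : weak_cvg T (fun l => m (phi l) w) (ms w).
  set i := idx w; have Pi : (0 < P (cell idx i))%E by exact: cell_pos.
  have mC : measurable (cell idx i) by exact: (measurable_cell G_idx G_measurable).
  have p0 : 0 < fine (P (cell idx i)) by rewrite fine_gt0// Pi ltey_eq fin_num_measure.
  pose A q := (\int[P]_(u in cell idx i) a u q) / fine (P (cell idx i)).
  apply: (@weak_cvg_cdf _ T _ _ A) => //.
  - by move=> l; exact: (eq_trans (congr1 (fun mu => mu (time_set T)) (mc (phi l) w)) (c1 _ _)).
  - exact: cs1.
  - move=> k; have Tk := dense_timeP k T0.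
    have cdfE l : cdf T (m (phi l) w) (dense_time T k) = cdf T (c (phi l) i) (dense_time T k).
      by rewrite /cdf; congr fine; exact: (congr1 (fun mu => mu _) (mc (phi l) w)).
    under eq_fun do rewrite cdfE.
    suff <- : lim_cdf (i, k) = A (dense_time T k) by exact: (lim_cdfP (i, k)).
    apply/eqP; rewrite /A eq_sym; apply/eqP; apply: (canLR (mulfK (lt0r_neq0 p0))).
    have c_int l : \int[P]_(u in cell idx i) LS l u (dense_time T k) =
        cdf T (c (phi l) i) (dense_time T k) * fine (P (cell idx i)).
      rewrite cdfc mulr_suml.
      have [_ ->] := Rintegral_wsum (y (phi l)) (phi l).+1 mC (fun j => lev_int j i _ Tk).
      apply: eq_bigr => j _; rewrite -mulrA; congr (_ * _); apply/esym.
      by apply: cdf_cell_law => //; exact: strategy_timed.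
    have LSi l : P.-integrable (cell idx i) (EFin \o (fun u => LS l u (dense_time T k))).
      by have [] := Rintegral_wsum (y (phi l)) (phi l).+1 mC (fun j => lev_int j i _ Tk).
    (* The integral over the cell has two limits: one as an average of a convergent sequence, the
       other by dominated convergence. Their equality identifies [lim_cdf] with the cell average of
       [a]. *)
    have h1 : \int[P]_(u in cell idx i) Lv (t n) u (dense_time T k) @[n --> \oo] -->
        lim_cdf (i, k) * fine (P (cell idx i)).
      have avE n : \int[P]_(u in cell idx i) Lv (t n) u (dense_time T k) =
          average (fun l => cdf T (c (phi l) i) (dense_time T k) * fine (P (cell idx i))) (t n).
        have [_ ->] := integrable_average (t n) mC LSi.
        by congr average; apply/funext => l; exact: c_int.
      under eq_fun do rewrite avE.
      by apply: average_cvg => //; apply: cvgMl; exact: (lim_cdfP (i, k)).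
    have h2 : \int[P]_(u in cell idx i) Lv (t n) u (dense_time T k) @[n --> \oo] -->
        \int[P]_(u in cell idx i) a u (dense_time T k).
      apply: (@Rintegral_dominated_cvg _ _ _ _ _ _ _ (cst 1)) => //.
      - by move=> n; exact: mLv.
      - exact: ma.
      - by apply: filterS cvga => u; exact.
      - exact: finite_measure_integrable_cst.
      - by move=> n u; have /andP[u0 u1] := Lv01 (t n) u (dense_time T k); rewrite ger0_norm.
    by rewrite (cvg_unique (@Rhausdorff R) h2 h1).
  - move=> k; have Tk := dense_timeP k T0.
    have mt B : measurable B -> measurable_fun setT (fun u => fine (time_law (sval x) u B)).
      by move=> mB; apply: measurableT_comp => //; exact: measurable_time_law.
    have mT := measurable_time_set T.
    have ml := mt _ (measurableI _ _ mT (measurable_ltE (dense_time T k))).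
    have mle := mt _ (measurableI _ _ mT (measurable_leE (dense_time T k))).
    have il : P.-integrable (cell idx i) (EFin \o (fun u => cdf_left T (time_law (sval x) u) (dense_time T k))).
      apply: integrable01 => // u.
      have m1 := time_law_total u tx.
      rewrite fine_ge0//=; apply: le_trans (cdf_left_le _ m1) _.
      by have /andP[] := cdf01 (dense_time T k) m1.
    have ile : P.-integrable (cell idx i) (EFin \o (fun u => cdf T (time_law (sval x) u) (dense_time T k))).
      by apply: integrable01 => // u; exact: cdf01 (time_law_total u tx).
    have ia : P.-integrable (cell idx i) (EFin \o (fun u => a u (dense_time T k))).
      by apply: integrable01 => //; exact: ma.
    rewrite -(ler_pM2r p0) -[X in _ && X](ler_pM2r p0) /A divfK ?gt_eqF//.
    have -> : cdf_left T (ms w) (dense_time T k) * fine (P (cell idx i)) =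
      \int[P]_(u in cell idx i) cdf_left T (time_law (sval x) u) (dense_time T k).
      exact: cdf_left_cell_law.
    have -> : cdf T (ms w) (dense_time T k) * fine (P (cell idx i)) =
      \int[P]_(u in cell idx i) level T (sval x) u (dense_time T k).
      exact: cdf_cell_law.
    by apply/andP; split; apply: le_Rintegral => // u _; have /andP[] := sand u k.
have stable e : 0 < e -> \forall l \near \oo, forall x' : strategy,
    `|value (m (phi l)) (sval x') - value ms (sval x')| <= e.
  move=> e0; apply: filterS (Phi_stable weak e0) => l H x'.
  by apply: H; exact: strategy_timed.
exists ms, tau, x; split => // x'.
(* Against the fixed law [ms] the averaged mixtures converge in value to [x]. Path by path, their
   payoff is represented by [Lv (t n) w], which converges at dense times to [a w], and [a w] is
   sandwiched by the law of [x]; domination by [K] finishes. *)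
have lim_value : average (fun l => \sum_(j < (phi l).+1) y (phi l) j * value ms (sval (s j))) (t n)
    @[n --> \oo] --> value ms (sval x).
  pose ell l w := \sum_(j < (phi l).+1) y (phi l) j * inner ms (sval (s j)) w.
  have iin j : P.-integrable setT (EFin \o inner ms (sval (s j))).
    by apply: integrable_inner; exact: strategy_timed.
  have [K iK PhiK] := Phi_bound ms.
  have ell_int l : P.-integrable setT (EFin \o ell l) /\
      \int[P]_w ell l w = \sum_(j < (phi l).+1) y (phi l) j * value ms (sval (s j)).
    exact: (Rintegral_wsum (y (phi l)) (phi l).+1 measurableT iin).
  have avE n : average (fun l => \sum_(j < (phi l).+1) y (phi l) j * value ms (sval (s j))) (t n) =
      \int[P]_w average (ell ^~ w) (t n).
    have [_ ->] := integrable_average (t n) measurableT (fun l => (ell_int l).1).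
    by congr average; apply/funext => l; rewrite (ell_int l).2.
  under eq_fun do rewrite avE.
  have mint (f : Omega -> R) : P.-integrable setT (EFin \o f) -> measurable_fun setT f.
    by move=> /integrableP[mf _]; exact/measurable_EFinP.
  apply: (@Rintegral_dominated_cvg _ _ _ _ _ _ _ K) => //.
  - by move=> n; apply: measurable_average => l; apply: mint; exact: (ell_int l).1.
  - by apply: mint; exact: integrable_inner.
  - apply: filterS cvga => w Hw; rewrite inner_time_law//.
    apply: (@helly_represents _ T _ (fun n q => Lv (t n) w q) _ (a w)) => //.
    + exact: time_law_total.
    + move=> n; elim: (t n) => [l|u IHu v IHv] /=; last exact: represents_mid.
      apply: (@represents_sum _ T _ (phi l).+1 (y (phi l)) (fun j => inner ms (sval (s j)) w)
        (fun j q => level T (sval (s j)) w q)) => // j.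
      rewrite inner_time_law; last exact: strategy_timed.
      by apply: represents_measure => //; apply: time_law_total; exact: strategy_timed.
  - move=> n w; have K0 : 0 <= K w.
      by apply: le_trans (PhiK w 0%E (time_set0 T0)); exact: normr_ge0.
    have ellK l : `|ell l w| <= K w.
      apply: le_trans (ler_norm_sum _ _ _) _; rewrite -[leRHS]mul1r -(y1 (phi l)) mulr_suml.
      apply: ler_sum => j _; rewrite normrM ger0_norm// ler_wpM2l//.
      by apply: inner_le => [|q Tq]; [exact: strategy_timed|exact: PhiK].
    elim: (t n) => [l|u IHu v IHv] //=; move: IHu IHv.
    by rewrite !ler_norml => /andP[? ?] /andP[? ?]; apply/andP; split; lra.
apply/ler_addgt0Pr => e e0; rewrite -lerBlDr.
have e40 : 0 < e / 5 by rewrite divr_gt0.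
(* From [l0 < l] follows [phi l0 < phi l], so the strategy chosen after stage [phi l0] is one of
   those that the mixture of stage [phi l] is guaranteed to match. *)
have [l0 l0P] : exists l0, forall l, (l0 < l)%N -> forall x' : strategy,
    value ms (sval x') - e <= \sum_(j < (phi l).+1) y (phi l) j * value ms (sval (s j)).
  have phi_ge n : (n <= phi n)%N.
    by elim: n => // n IH; apply: leq_ltn_trans IH (phi_incr _ _ _).
  have [N1 _ N1P] := stable _ e40.
  have [N2 _ N2P] : \forall n \near \oo, n.+1%:R^-1 < e / 5.
    exact: near_infty_natSinv_lt (PosNum e40).
  pose l0 := maxn N1 N2; exists l0 => l l0l z.
  have st k (z' : strategy) : (l0 <= k)%N -> `|value (m (phi k)) (sval z') - value ms (sval z')| <= e / 5.
    by move=> l0k; exact: (N1P k (leq_trans (leq_maxl N1 N2) l0k) z').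
  (* In order: the competitor against [ms] and against the early law; the strategy answering the
     early law, against that law, [ms] and the late law; the late mixture against its own law and
     [ms]. Four changes of law and one error of near-optimality cost [e / 5] each. *)
  have chain (r1 r2 r3 r4 r5 r6 r7 q : R) : `|r2 - r1| <= e / 5 -> r2 <= r3 + q -> q < e / 5 ->
      `|r3 - r4| <= e / 5 -> `|r5 - r4| <= e / 5 -> r5 <= r6 -> r6 <= r7 + e / 5 -> r1 - e <= r7.
    by rewrite !ler_norml => /andP[? ?] ? ? /andP[? ?] /andP[? ?] ? ?; lra.
  have inv_lt : (phi l0).+1%:R^-1 < e / 5.
    by apply: N2P => /=; apply: leq_trans (phi_ge l0); exact: leq_maxr.
  apply: (chain _ _ _ _ _ _ _ _ (st l0 z (leqnn _)) (optP (phi l0) z) inv_lt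
    (st l0 (s (phi l0).+1) (leqnn _)) (st l (s (phi l0).+1) (ltnW l0l))
    (stepP (phi l) (phi l0).+1 (phi_incr _ _ l0l))).
  have -> : e / 5 = \sum_(j < (phi l).+1) y (phi l) j * (e / 5) by rewrite -mulr_suml y1 mul1r.
  rewrite -big_split /=; apply: ler_sum => j _.
  rewrite -mulrDr ler_wpM2l//; have := st l (s j) (ltnW l0l).
  by rewrite ler_norml => /andP[? ?]; lra.
rewrite -(cvg_lim (@Rhausdorff R) lim_value); apply: limr_ge; first exact: cvgP lim_value.
exists l0.+1 => // n /= l0n.
by apply: (average_tail_ge (tailt n)) => l nl; apply: l0P; exact: leq_trans l0n nl.
Qed.

End equilibrium.

(** * Running and terminal rewards *)

Section time_sequences.
Context {R : realType}.
Implicit Types (T t : \bar R) (s : nat -> \bar R).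

Lemma within_cvg_seq (X Y : topologicalType) (A : set X) (f : X -> Y) (x : X) (u : nat -> X) :
  {within A, continuous f} -> A x -> (forall n, A (u n)) -> u n @[n --> \oo] --> x ->
  f (u n) @[n --> \oo] --> f x.
Proof.
move=> /subspace_continuousP cf Ax Au ux B nB.
have := cf x Ax B nB; rewrite /= /within /= => H.
have := ux _ H; rewrite /= /nbhs /=; apply: filterS => n /=; exact.
Qed.

(** Sequences suffice because the metric [d_rho], here with rate 1, induces the topology of [0, T],
    including the point at infinity. *)
Lemma cvg_seq_within T (f : \bar R -> R) :
  (forall t s, time_set T t -> (forall n, time_set T (s n)) -> s n @[n --> \oo] --> t ->
    f (s n) @[n --> \oo] --> f t) ->
  {within time_set T, continuous f}.
Proof.
move=> H; apply/subspace_continuousP => t Tt; apply/cvgrPdist_lt => e e0.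
apply: contrapT => ne.
have rho1 : 0 < 1 :> R by exact: ltr01.
have bad (n : nat) : exists r : \bar R, [/\ time_set T r, d_rho 1 r t < n.+1%:R^-1 & e <= `|f t - f r|].
  apply: contrapT => nex; apply: ne.
  apply/(d_rho_nbhs [set r : \bar R | `|f t - f r| < e] rho1 Tt).
  exists n.+1%:R^-1; first by rewrite invr_gt0 ltr0n.
  by move=> r Tr rd /=; rewrite ltNge; apply/negP => er; apply: nex; exists r.
have [s sP] := choice bad.
have st : s n @[n --> \oo] --> t.
  move=> A nA; have : within (time_set T) (nbhs t) A by apply: filterS nA.
  move=> /(d_rho_nbhs A rho1 Tt)[r r0 rA].
  change (\forall n \near \oo, A (s n)).
  near=> n; apply: rA; first by have [] := sP n.
  have [_ sd _] := sP n; apply: lt_trans sd _.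
  by near: n; exact: near_infty_natSinv_lt (PosNum r0).
have Ts n : time_set T (s n) by have [] := sP n.
have := H t s Tt Ts st.
move=> /cvgrPdist_lt /(_ e e0)[N _ /(_ N (leqnn _))] /=.
by have [_ _ es] := sP N; rewrite ltNge es.
Unshelve. all: end_near. Qed.

Lemma dexp_cvg_seq (rho : R) T t s : 0 < rho -> time_set T t -> (forall n, time_set T (s n)) ->
  s n @[n --> \oo] --> t -> dexp rho (s n) @[n --> \oo] --> dexp rho t.
Proof.
move=> rho0 Tt Ts st; apply/cvgrPdist_lt => e e0.
have : within (time_set T) (nbhs t) [set s | d_rho rho s t < e].
  by apply/(d_rho_nbhs _ rho0 Tt); exists e.
rewrite /within /= => H; have := st _ H; rewrite /nbhs /=; apply: filterS => n /=.
by move=> /(_ (Ts n)); rewrite /d_rho.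
Qed.

Lemma cvg_seq_lt t s (p : \bar R) : s n @[n --> \oo] --> t -> (p < t)%E ->
  \forall n \near \oo, (p < s n)%E.
Proof.
by move=> st pt; exact: (st _ (open_ereal_gt' pt)).
Qed.

Lemma cvg_seq_gt t s (p : \bar R) : s n @[n --> \oo] --> t -> (t < p)%E ->
  \forall n \near \oo, (s n < p)%E.
Proof.
by move=> st pt; exact: (st _ (open_ereal_lt' pt)).
Qed.

Lemma measurable_fin_time T : measurable (fin_time T : set (measurableTypeR R)).
Proof.
rewrite (_ : fin_time T = [set r | 0 <= r] `&` (EFin @^-1` [set t | (t <= T)%E])).
  apply: measurableI.
    by rewrite -set_itvcy; exact: measurable_itv.
  rewrite -[X in measurable X]setTI; apply: EFin_measurable => //; exact: measurable_leE.
by [].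
Qed.

Lemma fin_time_time_set T r : fin_time T r -> time_set T r%:E.
Proof. by move=> [r0 rT]; split; rewrite ?lee_fin. Qed.

Lemma fin_time_sub T t : (t <= T)%E -> fin_time t `<=` fin_time T.
Proof. by move=> tT r [r0 rt]; split => //; exact: le_trans tT. Qed.

Definition truncation (k : R -> R) t (r : R) : R := if (0 <= r) && (r%:E <= t)%E then k r else 0.

Lemma truncation_restrict k t : truncation k t = k \_ (fin_time t).
Proof.
apply/funext => r; rewrite /truncation patchE; congr (if _ then _ else _).
by apply/idP/idP => [/andP[r0 rt]|]; rewrite inE => // -[-> ->].
Qed.

Lemma time_integral_continuous T (k : R -> R) :
  lebesgue_measure.-integrable (fin_time T) (EFin \o k) ->
  {within time_set T, continuous (fun t => \int[lebesgue_measure]_(r in fin_time t) k r)}.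
Proof.
move=> ik; apply: cvg_seq_within => t s Tt Ts st.
have mT := measurable_fin_time.
have kE u : time_set T u -> \int[lebesgue_measure]_(r in fin_time u) k r =
    \int[lebesgue_measure]_(r in fin_time T) truncation k u r.
  move=> [_ uT]; rewrite truncation_restrict -Rintegral_mkcondr.
  congr Rintegral; apply/seteqP; split => [r ur|r []//].
  by split => //; exact: fin_time_sub ur.
rewrite kE//; under eq_fun do rewrite kE//.
have mk : measurable_fun (fin_time T) k by move/integrableP: ik => [/measurable_EFinP].
have mtr u : time_set T u -> measurable_fun setT (truncation k u : measurableTypeR R -> R).
  move=> [_ uT]; rewrite truncation_restrict; apply: (iffLR (measurable_restrictT _ (mT u))).
  exact: measurable_funS (mT T) (fin_time_sub uT) mk.
apply: (@Rintegral_dominated_cvg _ (measurableTypeR R) R lebesgue_measure (fin_time T)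
  (fun n => truncation k (s n)) (truncation k t) (fun r => `|k r|)) => //.
- by move=> n; exact: mtr.
- exact: mtr.
(* The truncated integrands converge except possibly at [r = t]. For infinite [t] the excluded point
   is 0, which is just as negligible. *)
- exists [set fine t]; split => //; first exact: lebesgue_measure_set1.
  move=> r /= H; apply: contrapT => rt; apply: H.
  have {}rt : r%:E != t by apply/eqP => E; apply: rt; rewrite -E.
  rewrite /truncation; have [r0|r0] := leP 0 r; last by apply: cvg_cst.
  have [rt'|rt'] := ltP r%:E t.
    rewrite (ltW rt'); apply: cvg_near_cst; apply: filterS (cvg_seq_lt st rt') => n rs.
    by rewrite (ltW rs).
  have {}rt' : (t < r%:E)%E by rewrite lt_neqAle eq_sym rt.
  rewrite leNgt rt' /=; apply: cvg_near_cst; apply: filterS (cvg_seq_gt st rt') => n rs.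
  by rewrite leNgt rs.
- exact: integrable_norm.
- by move=> n r; rewrite /truncation; case: ifP => // _; rewrite normr0 /=.
Qed.

End time_sequences.

(** * The discounted terminal reward along a continuous path *)

Section paths.
Context {R : realType} (T : \bar R).

Definition path_ext (x : path_space T) (r : R) : R :=
  if pselect (fin_time T r) is left rT then x (exist _ r (mem_set rT)) else 0.

Lemma path_ext_val (x : path_space T) (s : fin_time T) : path_ext x (\val s) = x s.
Proof.
rewrite /path_ext; case: pselect => [rT|]; last first.
  by case; apply: set_mem; exact: (svalP s).
by congr (x _); apply: val_inj.
Qed.

Lemma path_ext_continuous (x : path_space T) : {within fin_time T, continuous (path_ext x)}.
Proof.
apply/subspace_sigL_continuousP.
rewrite (_ : sigL _ _ = x); first exact: cts_fun.
by apply/funext => s; rewrite /sigL /= path_ext_val.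
Qed.

Variables (rho : R) (ghat : \bar R -> R -> R) (M : R).
Hypotheses (T0 : (0 <= T)%E) (rho0 : 0 < rho).
Hypothesis ghat_cont : {within time_set T `*` [set: R], continuous (fun z => ghat z.1 z.2)}.
Hypothesis ghatM : forall t x, time_set T t -> `|ghat t x| <= M.

(** The value 0 at infinity is the limit along any path, since [ghat] is bounded and the discount
    factor tends to zero. *)
Definition obstacle (x : path_space T) (t : \bar R) : R :=
  if t is r%:E then dexp rho t * ghat t (path_ext x r) else 0.

Lemma dexp01 t : (0 <= t)%E -> 0 <= dexp rho t <= 1.
Proof.
case: t => [r| |] //=; last by rewrite lexx ler01.
rewrite lee_fin => r0; rewrite expR_ge0 /= -expR0 ler_expR mulNr oppr_le0.
by rewrite mulr_ge0// ltW.
Qed.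

Lemma obstacle_le x t : time_set T t -> `|obstacle x t| <= dexp rho t * M.
Proof.
move=> Tt; have /andP[d0 _] := dexp01 Tt.1; rewrite /obstacle; case: t Tt d0 => [r| |] Tt d0 //=.
- by rewrite normrM ger0_norm// ler_wpM2l//; exact: ghatM.
- by rewrite normr0 mul0r.
- by case: Tt.
Qed.

Lemma obstacle_continuous x : {within time_set T, continuous (obstacle x)}.
Proof.
apply: cvg_seq_within => t s Tt Ts st.
have dst := dexp_cvg_seq rho0 Tt Ts st.
case: t Tt st dst => [r| |] Tt st dst; last by case: Tt.
(* Infinite terms, absent from some rank on, are replaced by [r] so that the path can be evaluated
   along the whole sequence. *)
- pose u n := if s n is q%:E then s n else r%:E.
  have us : \forall n \near \oo, u n = s n.
    have rr : (r%:E < (r + 1)%:E)%E by rewrite lte_fin ltrDl.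
    apply: filterS (cvg_seq_gt st rr) => n.
    by rewrite /u; have := Ts n; case: (s n) => [q| |] // [].
  have Tu n : time_set T (u n) by rewrite /u; case E : (s n) => [q| |] //; rewrite -E.
  have uE n : u n = (fine (u n))%:E by rewrite /u; case: (s n).
  have ut : u n @[n --> \oo] --> r%:E.
    by apply: cvg_trans st; apply: near_eq_cvg; apply: filterS us => n ->.
  have fut : fine (u n) @[n --> \oo] --> r by exact: fine_cvg ut.
  have put : path_ext x (fine (u n)) @[n --> \oo] --> path_ext x r.
    apply: (@within_cvg_seq _ _ (fin_time T) (path_ext x) r (fun n => fine (u n))
      (@path_ext_continuous x)) => //.
    by move=> n; have [] := Tu n; rewrite uE lee_fin.
  have gut : ghat (u n) (path_ext x (fine (u n))) @[n --> \oo] --> ghat r%:E (path_ext x r).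
    apply: (@within_cvg_seq _ _ _ (fun z : \bar R * R => ghat z.1 z.2) (r%:E, path_ext x r)
      (fun n => (u n, path_ext x (fine (u n)))) ghat_cont).
    - by split.
    - by move=> n; split => //=; exact: Tu.
    - exact: (cvg_pair ut put).
  apply: cvg_trans (cvgM (dexp_cvg_seq rho0 Tt Tu ut) gut).
  apply: near_eq_cvg; apply: filterS us => n usn; rewrite /= -usn.
  by move: (uE n); case: (u n).
- have dM : dexp rho (s n) * M @[n --> \oo] --> (0 : R).
    by rewrite -[X in _ --> X](mul0r M); apply: cvgMl.
  change (obstacle x (s n) @[n --> \oo] --> (0 : R)).
  apply: (@squeeze_cvgr _ _ _ _ (fun n => - (dexp rho (s n) * M)) (fun n => dexp rho (s n) * M)) => //.
    by apply: nearW => n; rewrite -ler_norml; exact: obstacle_le.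
  by rewrite -oppr0; exact: cvgN.
Qed.
End paths.

Section caratheodory.
Context d (Omega : measurableType d) (R : realType) (T : \bar R).
Hypothesis T0 : (0 <= T)%E.

(* The largest of [0] and the first [n] dense times that are at most [t]: a finitely
   valued approximation of [t] from below. *)
Fixpoint lower_time (n : nat) (t : \bar R) : \bar R :=
  if n is k.+1 then
    if (lower_time k t < dense_time T k)%E && (dense_time T k <= t)%E then dense_time T k
    else lower_time k t
  else 0%E.

Lemma lower_time_le n t : (0 <= t)%E -> (0 <= lower_time n t <= t)%E.
Proof.
move=> t0; elim: n => [|n IH] /=; first by rewrite lexx t0.
by case: ifPn => [/andP[_ ->]|//]; rewrite andbT; exact: (dense_timeP n T0).1.
Qed.

Lemma lower_time_homo t : {homo (lower_time ^~ t) : m n / (m <= n)%N >-> (m <= n)%E}.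
Proof.
apply: homo_leq => [x|y x z|n /=]; [exact: lexx|exact: le_trans|].
by case: ifPn => [/andP[/ltW]|].
Qed.

Lemma lower_time_dense k t : (dense_time T k <= t)%E -> (dense_time T k <= lower_time k.+1 t)%E.
Proof. by move=> kt /=; rewrite kt andbT; case: ifPn => //; rewrite -leNgt. Qed.

Lemma lower_time_cvg t : time_set T t -> lower_time n t @[n --> \oo] --> t.
Proof.
move=> Tt A nA; have [|p pt pA] := ereal_left_nbhs _ nA.
  by apply/eqP => E; case: Tt; rewrite E.
change (\forall n \near \oo, A (lower_time n t)).
have [p0|p0] := ltP p 0%E.
  apply: nearW => n; have /andP[l0 lt] := lower_time_le n Tt.1.
  by apply: pA => //; exact: lt_le_trans l0.
have Tp : time_set T p by split => //; exact: le_trans (ltW pt) Tt.2.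
have [k /andP[pk kt]] := dense_time_dense Tp Tt pt.
exists k.+1 => // n /= kn; have /andP[_ lt] := lower_time_le n Tt.1.
apply: pA => //; apply: lt_le_trans pk _.
by apply: le_trans (lower_time_dense (ltW kt)) _; exact: lower_time_homo.
Qed.

(** A Carathéodory function is the limit of the functions obtained by replacing [t] with
    [lower_time n t]; these take finitely many times and are jointly measurable by cases. *)
Lemma caratheodory_measurable (f : Omega -> \bar R -> R) :
  (forall t, time_set T t -> measurable_fun setT (f ^~ t)) ->
  (forall w, {within time_set T, continuous (f w)}) ->
  measurable_fun ([set: Omega] `*` time_set T) (fun z : Omega * \bar R => f z.1 z.2).
Proof.
move=> mf cf.
have mlow n : measurable_fun setT (lower_time n).
  elim: n => [|n IH] /=; first exact: measurable_cst.
  apply: measurable_fun_ifT => //; apply: measurable_and.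
    exact: measurable_fun_lte.
  exact: measurable_fun_lee.
apply: (@measurable_fun_cvg _ _ _ _ (fun n (z : Omega * \bar R) => f z.1 (lower_time n z.2))).
  move=> n; apply: measurable_funTS; elim: n => [|n IH] /=.
    exact: (measurableT_comp (mf _ (time_set0 T0)) measurable_fst).
  rewrite (_ : (fun z => _) = fun z : Omega * \bar R =>
    if (lower_time n z.2 < dense_time T n)%E && (dense_time T n <= z.2)%E
    then f z.1 (dense_time T n) else f z.1 (lower_time n z.2)); last first.
    by apply/funext => z; case: ifP.
  apply: measurable_fun_ifT => //.
    apply: measurable_and; last exact: measurable_fun_lee.
    by apply: measurable_fun_lte => //; exact: (measurableT_comp (mlow n) measurable_snd).
  exact: (measurableT_comp (mf _ (dense_timeP n T0)) measurable_fst).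
move=> [w t] [_ /= Tt]; apply: (@within_cvg_seq _ _ (time_set T) (f w) t (lower_time ^~ t) (cf w)) => //.
  move=> n; have /andP[l0 lt] := lower_time_le n Tt.1; split => //.
  exact: le_trans lt Tt.2.
exact: lower_time_cvg.
Qed.
End caratheodory.

Lemma measurable_fubini_signed d1 d2 (X : measurableType d1) (Y : measurableType d2) (R : realType)
    (m2 : {sigma_finite_measure set Y -> \bar R}) (f : X * Y -> \bar R) :
  measurable_fun setT f -> measurable_fun setT (fubini_F m2 f).
Proof.
move=> mf; rewrite (_ : fubini_F m2 f = fubini_F m2 f^\+ \- fubini_F m2 f^\-)%E.
  apply: emeasurable_funB; apply: measurable_fun_fubini_tonelli_F => //.
  - exact: measurable_funepos.
  - exact: measurable_funeneg.
apply/funext => x; rewrite /fubini_F [LHS]integralE; congr (_ - _)%E; apply: eq_integral => y _; rewrite ?(funeposE, funenegE).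
all: done.
Qed.

(** * The payoff as running integral plus obstacle *)

Section running.
Context d (Omega : measurableType d) (R : realType) (P : probability Omega R) (T : \bar R).
Local Notation RR := (measurableTypeR R).
Hypothesis T0 : (0 <= T)%E.
Variable k : Omega -> R -> R.
Hypothesis mk : measurable_fun ([set: Omega] `*` (fin_time T : set RR)) (fun z : Omega * RR => k z.1 z.2).

Definition running (w : Omega) (t : \bar R) : \bar R :=
  (\int[lebesgue_measure]_(r in fin_time t) (k w r)%:E)%E.

Definition running_abs (w : Omega) : \bar R :=
  (\int[lebesgue_measure]_(r in fin_time T) (`|k w r|)%:E)%E.

Hypothesis k_int : (\int[P]_w running_abs w < +oo)%E.

Definition tame : set Omega := [set w | (running_abs w < +oo)%E].

Let kT (z : Omega * RR) : R := ((fun z : Omega * RR => k z.1 z.2) \_ ([set: Omega] `*` fin_time T)) z.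

Let mkT : measurable_fun setT kT.
Proof.
by apply: (iffLR (measurable_restrictT _ _)) => //; apply: measurableX => //; exact: measurable_fin_time.
Qed.

Let kTE w r : kT (w, r) = (k w \_ (fin_time T)) r.
Proof.
rewrite /kT !patchE; congr (if _ then _ else _); apply/idP/idP; rewrite !inE => //.
by move=> [].
Qed.

Let mks w : measurable_fun (fin_time T : set RR) (k w).
Proof.
apply: (iffRL (measurable_restrictT _ (measurable_fin_time T))).
rewrite (_ : _ \_ _ = (fun r => kT (w, r))); first exact: measurable_fun_pair2 mkT.
by apply/funext => r; rewrite kTE.
Qed.

Lemma running_abs_ge0 w : (0 <= running_abs w)%E.
Proof. by apply: integral_ge0 => r _; rewrite lee_fin. Qed.

Lemma measurable_running_abs : measurable_fun setT running_abs.
Proof.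
rewrite (_ : running_abs = fubini_F lebesgue_measure (abse \o (EFin \o kT))).
  apply: measurable_fun_fubini_tonelli_F; last by move=> z; exact: abse_ge0.
  by apply: measurableT_comp => //; exact/measurable_EFinP.
apply/funext => w; rewrite /running_abs /fubini_F [LHS]integral_mkcond.
apply: eq_integral => r _; rewrite /= kTE !patchE; case: ifP => //.
by rewrite normr0.
Qed.

Lemma measurable_running :
  measurable_fun ([set: Omega] `*` time_set T) (fun z : Omega * \bar R => running z.1 z.2).
Proof.
(* Moving the condition [r <= t] into the integrand makes [running] a partial integral of one
   jointly measurable function. *)
pose kk (z : (Omega * \bar R) * RR) : R :=
  if (z.2%:E <= z.1.2)%E then kT (z.1.1, z.2) else 0.
have mkk : measurable_fun setT kk.
  apply: measurable_fun_ifT => //.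
    apply: measurable_fun_lee.
      by apply/measurable_EFinP; exact: measurable_snd.
    exact: (measurableT_comp measurable_snd measurable_fst).
  apply: (measurableT_comp mkT); apply/measurable_fun_pairP; split.
    exact: (measurableT_comp measurable_fst measurable_fst).
  exact: measurable_snd.
have mEk : measurable_fun setT (EFin \o kk) by exact/measurable_EFinP.
have := measurable_fubini_signed (lebesgue_measure : {sigma_finite_measure set RR -> \bar R}) mEk.
move=> /(measurable_funS measurableT (@subsetT _ ([set: Omega] `*` time_set T))).
apply: eq_measurable_fun => -[w t]; rewrite inE => -[_ /= [t0 tT]].
rewrite /running /fubini_F [RHS]integral_mkcond; apply: eq_integral => r _.
rewrite /kk /= kTE !patchE; case: ifPn => [rt|rt].
  case: ifPn => [|] ; rewrite ?inE ?notin_setE => rT.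
    by rewrite mem_set//; split => //; case: rT.
  by rewrite memNset// => -[r0 rt']; apply: rT; split => //; exact: le_trans tT.
by rewrite memNset// => -[r0 rt']; rewrite rt' in rt.
Qed.

Lemma tame_integrable w : tame w -> lebesgue_measure.-integrable (fin_time T : set RR) (EFin \o k w).
Proof. by move=> gw; apply/integrableP; split => //; exact/measurable_EFinP. Qed.

Lemma measurable_tame : measurable tame.
Proof.
rewrite -[tame]setTI; apply: emeasurable_fun_infty_o => //; exact: measurable_running_abs.
Qed.

Lemma tame_ae : P (~` tame) = 0%E.
Proof.
have ir : P.-integrable setT running_abs.
  apply/integrableP; split; first exact: measurable_running_abs.
  by under eq_integral do rewrite gee0_abs ?running_abs_ge0//; exact: k_int.
have [N [mN N0 H]] := integrable_ae measurableT ir.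
apply/eqP; rewrite eq_le measure_ge0 andbT -N0; apply: le_measure; rewrite ?inE//.
  by apply: measurableC; exact: measurable_tame.
move=> w gw; apply: H => /= /(_ I); rewrite ge0_fin_numE ?running_abs_ge0//.
Qed.

Variables (obs : Omega -> \bar R -> R) (M : R).
Hypothesis obs_meas : measurable_fun ([set: Omega] `*` time_set T) (fun z : Omega * \bar R => obs z.1 z.2).
Hypothesis obs_cont : forall w, {within time_set T, continuous (obs w)}.
Hypothesis obsM : forall w t, time_set T t -> `|obs w t| <= M.

(** Outside [tame], a null set of paths, the running term is replaced by zero, so that continuity in
    time and the bound hold for every path. *)
Definition payoff (w : Omega) (t : \bar R) : R := \1_tame w * fine (running w t) + obs w t.

Lemma measurable_payoff :
  measurable_fun ([set: Omega] `*` time_set T) (fun z : Omega * \bar R => payoff z.1 z.2).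
Proof.
apply: measurable_funD => //; apply: measurable_funM.
  apply: measurable_funTS.
  have mi : measurable_fun setT (\1_tame : Omega -> R) by apply: measurable_indic; exact: measurable_tame.
  exact: (measurableT_comp mi measurable_fst).
exact: (measurableT_comp _ measurable_running).
Qed.

Lemma payoff_continuous w : {within time_set T, continuous (payoff w)}.
Proof.
have [gw|gw] := pselect (tame w).
  rewrite (_ : payoff w = (fun t => fine (running w t)) \+ obs w).
    move=> t; apply: cvgD; last exact: obs_cont.
    exact: (time_integral_continuous (tame_integrable gw)).
  by apply/funext => t; rewrite /payoff indicE mem_set// mul1r.
rewrite (_ : payoff w = obs w); first exact: obs_cont.
by apply/funext => t; rewrite /payoff indicE memNset// mul0r add0r.
Qed.

Definition payoff_bound (w : Omega) : R := \1_tame w * fine (running_abs w) + M.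

Lemma payoff_le w t : time_set T t -> `|payoff w t| <= payoff_bound w.
Proof.
move=> Tt; rewrite /payoff /payoff_bound.
apply: le_trans (ler_normD _ _) _; apply: lerD; last exact: obsM.
have [gw|gw] := pselect (tame w); last by rewrite indicE memNset// !mul0r normr0.
rewrite indicE mem_set// !mul1r; have ik := tame_integrable gw.
have ikt : lebesgue_measure.-integrable (fin_time t : set RR) (EFin \o k w).
  by apply: (integrableS _ _ _ ik); [exact: measurable_fin_time|exact: measurable_fin_time|exact: fin_time_sub Tt.2].
have := le_normr_Rintegral (measurable_fin_time t) ikt; move=> /le_trans; apply.
rewrite /running_abs /Rintegral fine_le//.
- by apply: integrable_fin_num; [exact: measurable_fin_time|exact: integrable_norm ikt].
- by apply: integrable_fin_num; [exact: measurable_fin_time|exact: integrable_norm ik].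
apply: ge0_subset_integral; [exact: measurable_fin_time|exact: measurable_fin_time| | |exact: fin_time_sub Tt.2].
- by apply/measurable_EFinP; apply: measurableT_comp => //; exact: mks.
- by move=> r _; rewrite lee_fin.
Qed.

Lemma integrable_payoff_bound : P.-integrable setT (EFin \o payoff_bound).
Proof.
have ir : P.-integrable setT running_abs.
  apply/integrableP; split; first exact: measurable_running_abs.
  by under eq_integral do rewrite gee0_abs ?running_abs_ge0//; exact: k_int.
have i1 : P.-integrable setT (EFin \o (fun w => \1_tame w * fine (running_abs w))).
  apply: le_integrable ir => //.
    apply/measurable_EFinP; apply: measurable_funM; first by apply: measurable_indic; exact: measurable_tame.
    by apply: measurableT_comp => //; exact: measurable_running_abs.
  move=> w _ /=; rewrite (gee0_abs (running_abs_ge0 w)).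
  have [gw|gw] := pselect (tame w); last by rewrite indicE memNset// mul0r normr0 running_abs_ge0.
  rewrite indicE mem_set// mul1r ger0_norm ?fine_ge0 ?running_abs_ge0//.
  by rewrite fineK// ge0_fin_numE// running_abs_ge0.
have i2 : P.-integrable setT (EFin \o cst M) by exact: finite_measure_integrable_cst.
by have := integrableD measurableT i1 i2.
Qed.
End running.

(** * The mean-field game *)

Section partition.
Context d (Omega : measurableType d) (R : realType) (P : probability Omega R).
Variable G : set (set Omega).

(** The preimages under [idx] form a sigma-algebra containing the cells, and conversely each
    preimage is a countable union of cells, numbers outside [I] contributing nothing. *)
Lemma partition_index : generated_by_countable_partition P G -> exists idx : Omega -> nat,
  [/\ forall S : set nat, G (idx @^-1` S), forall A, G A -> measurable A,
      forall A, G A -> exists S : set nat, A = idx @^-1` S &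
      forall w, (0 < P (idx @^-1` [set idx w]))%E].
Proof.
move=> [I [A [mA tA UA pA ->]]].
have idxP w : exists i, I i /\ A i w.
  by have [i Ii Aiw] : (\bigcup_(i in I) A i) w by [rewrite UA]; exists i.
have [idx idxA] := choice idxP.
have idxE i : I i -> idx @^-1` [set i] = A i.
  move=> Ii; apply/seteqP; split => [w /= <-|w Aiw /=]; first by case: (idxA w).
  have [Iw Aw] := idxA w.
  by apply: tA => //; exists w.
exists idx; split.
- move=> S; have -> : idx @^-1` S = \bigcup_i (if pselect (I i /\ S i) is left _ then A i else set0).
    apply/seteqP; split => [w /= Sw|w [i _]].
      exists (idx w) => //; have [Iw Aw] := idxA w.
      by case: pselect => //= ns; exfalso; apply: ns.
    case: pselect => [[Ii Si] Aiw|//]; have : (idx @^-1` [set i]) w by rewrite idxE.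
    by move=> /= ->.
  have [_ _ GU] := smallest_sigma_algebra [set: Omega] [set A i | i in I].
  apply: GU => i; case: pselect => [[Ii Si]|_].
    by apply: sub_sigma_algebra; exists i.
  by have [] := smallest_sigma_algebra [set: Omega] [set A i | i in I].
- apply: smallest_sub; first exact: sigma_algebra_measurable.
  by move=> _ [i Ii <-]; exact: mA.
- pose H := [set B : set Omega | exists S : set nat, B = idx @^-1` S].
  suff : <<s [set A i | i in I] >> `<=` H by [].
  apply: smallest_sub; last by move=> _ [i Ii <-]; exists [set i]; rewrite idxE.
  split.
  + by exists set0; rewrite preimage_set0.
  + by move=> B [S ->]; exists (~` S); rewrite setTD preimage_setC.
  + move=> B HB; have [S SP] := choice HB.
    by exists (\bigcup_n S n); rewrite preimage_bigcup; apply: eq_bigcup.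
- by move=> w; have [Iw _] := idxA w; rewrite idxE//; exact: pA.
Qed.

End partition.

Section integral_tOmega.
Context d (Omega : measurableType d) (R : realType) (P : probability Omega R).
Local Notation RR := (measurableTypeR R).
Local Notation tOmegaR := (tOmega (Omega := Omega) (R := R) : set (Omega * RR)).

Lemma measurable_tOmega : measurable tOmegaR.
Proof. by apply: measurableX => //; exact: measurable_itv. Qed.

Lemma ge0_integral_tOmega (p : Omega * RR -> \bar R) : measurable_fun setT p ->
  (forall z, 0 <= p z)%E ->
  (\int[P \x lebesgue_measure]_(z in tOmegaR) p z = \int[P \x unif R]_z p z)%E.
Proof.
move=> mp p0; rewrite [LHS]integral_mkcond.
have mp1 : measurable_fun setT (p \_ tOmegaR).
  by apply: (iffLR (measurable_restrictT _ measurable_tOmega)); exact: measurable_funTS.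
have p10 z : (0 <= (p \_ tOmegaR) z)%E by rewrite patchE; case: ifP.
rewrite (fubini_tonelli1 _ mp1 p10) (fubini_tonelli1 _ mp p0).
apply: eq_integral => w _; rewrite /fubini_F.
rewrite [RHS](integral_uniform (ltr01 : (0 : R) < 1) (measurable_fun_pair2 w mp)) => [|v]; last exact: p0.
rewrite subr0 invr1 mul1e [RHS]integral_mkcond; apply: eq_integral => v _.
rewrite !patchE; congr (if _ then _ else _); apply/idP/idP; rewrite !inE => //.
by move=> [].
Qed.

Lemma integral_tOmega (p : Omega * RR -> \bar R) : measurable_fun setT p ->
  (\int[P \x lebesgue_measure]_(z in tOmegaR) p z = \int[P \x unif R]_z p z)%E.
Proof.
move=> mp; rewrite [LHS]integralE [RHS]integralE.
rewrite ge0_integral_tOmega; [|exact: measurable_funepos|by move=> z; exact: funepos_ge0].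
by rewrite ge0_integral_tOmega//; exact: measurable_funeneg.
Qed.

End integral_tOmega.

Section payoff_reward.
Context d (Omega : measurableType d) (R : realType) (P : probability Omega R) (T : \bar R).
Local Notation RR := (measurableTypeR R).
Local Notation tOmegaR := (tOmega (Omega := Omega) (R := R) : set (Omega * RR)).
Variables (k : Omega -> R -> R) (obs : Omega -> \bar R -> R).
Hypothesis mk : measurable_fun ([set: Omega] `*` (fin_time T : set RR)) (fun z : Omega * RR => k z.1 z.2).
Hypothesis k_int : (\int[P]_w running_abs T k w < +oo)%E.
Hypothesis obs_meas : measurable_fun ([set: Omega] `*` time_set T) (fun z : Omega * \bar R => obs z.1 z.2).

(** The integrands can differ only outside [tame]; on tame paths the running integral is finite and
    [fine] loses nothing. *)
Lemma integral_running_obstacle (sg : {mfun (Omega * RR)%type >-> \bar R}) : timed T sg ->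
  (\int[P \x lebesgue_measure]_(z in tOmegaR) (running k z.1 (sg z) + (obs z.1 (sg z))%:E) =
   \int[P \x unif R]_z (payoff T k obs z.1 (sg z))%:E)%E.
Proof.
move=> tsg.
have mh : measurable_fun setT (fun z : Omega * RR => (z.1, sg z)).
  apply/measurable_fun_pairP; split; first exact: measurable_fst.
  exact: measurable_funPT.
have sub : range (fun z : Omega * RR => (z.1, sg z)) `<=` [set: Omega] `*` time_set T.
  by move=> _ [z _ <-]; split => //=; exact: tsg.
have mD : measurable ([set: Omega] `*` time_set T).
  by apply: measurableX => //; exact: measurable_time_set.
have mr := measurable_comp mD sub (measurable_running mk) mh.
have mo : measurable_fun setT (fun z => obs z.1 (sg z)) := measurable_comp mD sub obs_meas mh.
have mp : measurable_fun setT (fun z => payoff T k obs z.1 (sg z)) :=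
  measurable_comp mD sub (measurable_payoff mk obs_meas) mh.
have mEp : measurable_fun setT (fun z => (payoff T k obs z.1 (sg z))%:E) by exact/measurable_EFinP.
rewrite -(integral_tOmega P mEp).
apply: ae_eq_integral.
- exact: measurable_tOmega.
- apply: measurable_funTS; apply: emeasurable_funD => //.
  exact/measurable_EFinP.
- exact: measurable_funTS.
exists (~` tame T k `*` `[0%R, 1%R]); split.
- by apply: measurableX; [apply: measurableC; exact: measurable_tame|exact: measurable_itv].
- transitivity (P (~` tame T k) * lebesgue_measure (`[0%R, 1%R] : set RR))%E.
    by apply: product_measure1E; [apply: measurableC; exact: measurable_tame|exact: measurable_itv].
  by rewrite (tame_ae mk k_int) mul0e.
move=> z /= H; split; last first.
  by apply: contrapT => nz; apply: H => -[_].
move=> tz; apply: H => _.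
rewrite /payoff indicE mem_set// mul1r EFinD fineK//.
have tT := tsg z.
apply: integrable_fin_num; first exact: measurable_fin_time.
by apply: (integrableS _ _ _ (tame_integrable mk tz)); [exact: measurable_fin_time|exact: measurable_fin_time|exact: fin_time_sub tT.2].
Qed.

End payoff_reward.

(** Monotonicity without measurability: the integral of a nonnegative function is a supremum over
    simple functions below it. It is applied to bounds that are not known to be measurable. *)
Lemma ge0_le_integralT d (X : measurableType d) (R : realType) (mu : {measure set X -> \bar R})
    (f1 f2 : X -> \bar R) : (forall x, 0 <= f1 x)%E -> (forall x, f1 x <= f2 x)%E ->
  (\int[mu]_x f1 x <= \int[mu]_x f2 x)%E.
Proof.
move=> f10 f12; have f20 x : (0 <= f2 x)%E := le_trans (f10 x) (f12 x).
rewrite !ge0_integralTE//; apply: ge_ereal_sup => _ [s sf1 <-].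
by apply: ereal_sup_ubound; exists s => // x; exact: le_trans (sf1 x) (f12 x).
Qed.

Section value_dist.
Context d (Omega : measurableType d) (R : realType) (P : probability Omega R) (T : \bar R).
Variable G : set (set Omega).
Local Notation RR := (measurableTypeR R).
Hypothesis T0 : (0 <= T)%E.
Variable Phi : random_law T G -> Omega -> \bar R -> R.
Hypothesis Phi_meas : forall m,
  measurable_fun ([set: Omega] `*` time_set T) (fun z : Omega * \bar R => Phi m z.1 z.2).
Hypothesis Phi_cont : forall m w, {within time_set T, continuous (Phi m w)}.
Hypothesis Phi_bound : forall m, exists2 K : Omega -> R, P.-integrable setT (EFin \o K) &
  forall w t, time_set T t -> `|Phi m w t| <= K w.

Lemma valueE m (sg : {mfun (Omega * RR)%type >-> \bar R}) : timed T sg ->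
  (value P Phi m sg)%:E = (\int[P \x unif R]_z (Phi m z.1 (sg z))%:E)%E.
Proof.
move=> tsg; have ip := integrable_prod_fun T0 Phi_meas Phi_cont Phi_bound m tsg.
have -> : (\int[P \x unif R]_z (Phi m z.1 (sg z))%:E)%E =
    (\int[P]_w fubini_F (unif R) (EFin \o (fun z : Omega * RR => Phi m z.1 (sg z))) w)%E.
  exact/esym/integral12_prod_meas1.
rewrite /value /Rintegral fineK.
  by apply: eq_integral => w _; exact: innerE.
apply: integrable_fin_num => //; exact: integrable_inner.
Qed.

(** The bound [b] dominates the payoff difference at all times at once, so it also dominates the
    difference after integration over the randomization, whatever the strategy. *)
Lemma value_dist_le m1 m2 (sg : {mfun (Omega * RR)%type >-> \bar R}) (A : set Omega) (b : Omega -> \bar R) :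
  timed T sg -> measurable A -> P (~` A) = 0%E -> (forall w, 0 <= b w)%E ->
  (forall w t, A w -> time_set T t -> (`|Phi m1 w t - Phi m2 w t|%:E <= b w)%E) ->
  ((`|value P Phi m1 sg - value P Phi m2 sg|)%:E <= \int[P]_w b w)%E.
Proof.
move=> tsg mA A0 b0 Ab.
have i1 := integrable_inner T0 Phi_meas Phi_cont Phi_bound m1 tsg.
have i2 := integrable_inner T0 Phi_meas Phi_cont Phi_bound m2 tsg.
have i12 : P.-integrable setT (EFin \o (fun w => inner Phi m1 sg w - inner Phi m2 sg w)).
  by have := integrableB measurableT i1 i2.
have iabs : P.-integrable setT (EFin \o (fun w => `|inner Phi m1 sg w - inner Phi m2 sg w|)).
  by have := integrable_norm i12.
have -> : value P Phi m1 sg - value P Phi m2 sg = \int[P]_w (inner Phi m1 sg w - inner Phi m2 sg w).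
  by rewrite RintegralB.
apply: (@le_trans _ _ (\int[P]_w (`|inner Phi m1 sg w - inner Phi m2 sg w|)%:E)%E).
  have := le_normr_Rintegral measurableT i12.
  by rewrite -lee_fin /Rintegral fineK//; exact: integrable_fin_num.
have mabs : measurable_fun setT (fun w => `|inner Phi m1 sg w - inner Phi m2 sg w|).
  by apply/measurable_EFinP; case/integrableP: iabs.
rewrite (@ae_eq_integral _ _ _ P _ (fun w => (\1_A w * `|inner Phi m1 sg w - inner Phi m2 sg w|)%:E))//.
- apply: ge0_le_integralT => w; first by rewrite lee_fin mulr_ge0.
  have [Aw|nA] := pselect (A w); last by rewrite indicE memNset// mul0r.
  rewrite indicE mem_set// mul1r.
  case: (b w) (b0 w) (Ab w ^~ Aw) => [r| |] // _ Hr; last by rewrite leey.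
  have j1 := integrable_section T0 Phi_cont m1 w tsg.
  have j2 := integrable_section T0 Phi_cont m2 w tsg.
  have j12 : (unif R).-integrable setT (EFin \o (fun v => Phi m1 w (sg (w, v)) - Phi m2 w (sg (w, v)))).
    by have := integrableB measurableT j1 j2.
  rewrite lee_fin /inner -RintegralB//.
  apply: le_trans (le_normr_Rintegral measurableT j12) _.
  have -> : r = \int[unif R]_v r.
    rewrite Rintegral_cst// [X in fine X](_ : _ = 1%E) ?mulr1//; exact: (probability_setT (unif R)).
  apply: le_Rintegral => //.
  - by have := integrable_norm j12.
  - exact: finite_measure_integrable_cst.
  - by move=> v _; rewrite -lee_fin; exact: (Hr _ (tsg _)).
- exact/measurable_EFinP.
- by apply/measurable_EFinP; apply: measurable_funM => //; exact: measurable_indic.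
exists (~` A); split => //; first exact: measurableC.
move=> w /= H; apply: contrapT => /contrapT Aw; apply: H => _.
by rewrite indicE mem_set// mul1r.
Qed.

End value_dist.

Lemma cvg_limf_esup (R : realType) (Fl : set_system R) (f : R -> R) (l : R) : ProperFilter Fl ->
  f x @[x --> Fl] --> l -> limf_esup (fun x => (f x)%:E) Fl = l%:E.
Proof.
move=> FF fl; rewrite limf_esupE; apply/eqP; rewrite eq_le; apply/andP; split.
- apply/lee_addgt0Pr => e e0.
  have Fe : Fl [set x | `|l - f x| < e] by move/cvgrPdist_lt : fl; exact.
  apply: (@le_trans _ _ (ereal_sup [set (f x)%:E | x in [set x | `|l - f x| < e]])).
    by apply: ereal_inf_lbound; exists [set x | `|l - f x| < e].
  apply: ge_ereal_sup => _ [x /= xe <-]; rewrite -EFinD lee_fin.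
  by move: xe; rewrite ltr_distl => /andP[]; lra.
- apply: le_ereal_inf_tmp => _ [V FV <-]; apply/lee_addgt0Pr => e e0.
  have Fe : Fl [set x | `|l - f x| < e] by move/cvgrPdist_lt : fl; exact.
  have [x [Vx /= xe]] := filter_ex (filterI FV Fe).
  apply: (@le_trans _ _ ((f x)%:E + e%:E)%E).
    by rewrite -EFinD lee_fin; move: xe; rewrite ltr_distl => /andP[]; lra.
  by apply: leeD => //; apply: ereal_sup_ubound; exists x.
Qed.

Lemma d_C_ge0 (R : realType) (T : \bar R) (x y : path_space T) : (0 <= d_C x y)%E.
Proof.
have sup0 (S : set (fin_time T)) : 0 <= sup [set `|x s - y s| | s in S].
  have [hs|/sup_out ->//] := pselect (has_sup [set `|x s - y s| | s in S]).
  have [[_ [s Ss _]] _] := hs.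
  apply: (@le_trans _ _ `|x s - y s|); first exact: normr_ge0.
  by apply: sup_upper_bound => //; exists s.
rewrite /d_C; case: T x y sup0 => [r| |] x y sup0.
- by rewrite lee_fin.
- by apply: nneseries_ge0 => n _ _; rewrite lee_fin mulr_ge0// ?divr_ge0// ?addr_ge0// ?exprn_ge0.
- by rewrite lee_fin.
Qed.

Section model.
Context {R : realType} (T : \bar R) (rho : R).
Local Notation RR := (measurableTypeR R).
Hypotheses (T0 : (0 <= T)%E) (rho0 : 0 < rho).
Variables (ghat : \bar R -> R -> R) (M : R).
Hypothesis ghat_cont : {within time_set T `*` [set: R], continuous (fun z => ghat z.1 z.2)}.
Hypothesis ghatM : forall t x, time_set T t -> `|ghat t x| <= M.

Lemma section_continuous t : time_set T t -> continuous (ghat t).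
Proof.
move=> Tt x; move/subspace_continuousP : ghat_cont => H.
have Ax : (time_set T `*` [set: R]) (t, x) by [].
have c1 : (fun=> t) y @[y --> x] --> t by exact: cvg_cst.
have c2 : id y @[y --> x] --> x by exact: cvg_id.
have c := cvg_pair c1 c2.
move=> B /(H _ Ax B) nB; change (nbhs x (fun y => B (ghat t y))).
have fx : Filter (nbhs x) := nbhs_filter x.
have ft : Filter (nbhs t) := nbhs_filter t.
have cB := c fx ft fx _ nB.
apply: (@filterS _ (nbhs x) fx _ _ _ cB) => y /= Hy.
by apply: Hy.
Qed.

Context d (Omega : measurableType d).
Variables (F : \bar R -> set (set Omega)).
Hypothesis filtF : is_filtration T F.

Lemma measurable_obstacle (X : Omega -> path_space T) :
  (forall s : fin_time T, measurable_wrt (F (\val s)%:E) (fun w => X w s)) ->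
  measurable_fun ([set: Omega] `*` time_set T) (fun z : Omega * \bar R => obstacle rho ghat (X z.1) z.2).
Proof.
move=> mX; apply: (caratheodory_measurable T0 (f := fun w => obstacle rho ghat (X w))); last first.
  by move=> w; exact: (obstacle_continuous rho0 ghat_cont ghatM).
case=> [r| |] [t0 tT]; rewrite /obstacle//=.
apply: measurable_funM => //.
have rT : fin_time T r by split; rewrite -?lee_fin.
have Tr := fin_time_time_set rT.
have -> : (fun w => ghat r%:E (path_ext (X w) r)) =
    ghat r%:E \o (fun w => X w (exist _ r (mem_set rT))).
  apply/funext => w /=; congr ghat.
  by rewrite -(path_ext_val _ (exist _ r (mem_set rT))).
apply: measurableT_comp; first by apply: continuous_measurable_fun; exact: section_continuous.
apply: (measurable_wrt_filtration filtF Tr).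
exact: (mX (exist _ r (mem_set rT))).
Qed.

Lemma measurable_progressive (Z : Omega -> \bar R -> R) : progressive T F Z ->
  measurable_fun ([set: Omega] `*` (fin_time T : set RR))
    (fun z : Omega * RR => dexp rho z.2%:E * Z z.1 z.2%:E).
Proof.
have TT : time_set T T by split.
move=> /(_ T TT) mZ; apply: measurable_funM.
  apply: measurable_funTS => /=; apply: measurableT_comp => //.
  exact: (measurableT_comp (mulrl_measurable _) measurable_snd).
have mD : measurable ([set: g_sigma_algebraType (F T)] `*` time_set T).
  by apply: measurableX => //; exact: measurable_time_set.
have mE : measurable ([set: Omega] `*` (fin_time T : set RR)).
  by apply: measurableX => //; exact: measurable_fin_time.
have mh : measurable_fun ([set: Omega] `*` (fin_time T : set RR))
    (fun z : Omega * RR => (z.1 : g_sigma_algebraType (F T), z.2%:E)).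
  apply: measurable_funTS; apply/measurable_fun_pairP; split.
    exact: (measurableT_comp (measurable_to_filtration filtF TT) measurable_fst).
  by apply/measurable_EFinP; exact: measurable_snd.
apply: (measurable_comp mD _ mZ mh).
by move=> _ [[w r] [_ /= rT] <-]; split => //=; exact: fin_time_time_set.
Qed.

(** At infinity the upper limit in [discounted] is a true limit, equal to 0, by boundedness of
    [ghat]; this matches the value chosen in [obstacle]. *)
Lemma discounted_obstacle (g : Omega -> \bar R -> R) (X : Omega -> path_space T) :
  (forall w (s : fin_time T), g w (\val s)%:E = ghat (\val s)%:E (X w s)) ->
  forall w t, time_set T t -> discounted rho g w t = (obstacle rho ghat (X w) t)%:E.
Proof.
move=> gX w t Tt.
have gE r : fin_time T r -> g w r%:E = ghat r%:E (path_ext (X w) r).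
  move=> rT; rewrite -[r]/(\val (exist (fun x => x \in fin_time T) r (mem_set rT))).
  by rewrite path_ext_val gX.
rewrite /discounted /obstacle; case: t Tt => [r| |] [t0 tT]//.
  by rewrite gE//; split; rewrite -?lee_fin.
apply: cvg_limf_esup.
have Too : T = +oo%E by apply/eqP; rewrite -leye_eq.
have near0 : \forall r \near +oo, (0 <= r :> R) by exact: nbhs_pinfty_ge.
have cvg0 : expR (- rho * x) @[x --> +oo] --> (0 : R).
  have : expR (- (rho * x)) @[x --> +oo] --> (0 : R).
    apply: (@cvg_comp _ _ _ (fun x : R => rho * x) (fun x => expR (- x)) _ (pinfty_nbhs R)).
      exact: gt0_cvgMry.
    exact: cvgr_expR.
  by under eq_fun do rewrite -mulNr.
have cM : expR (- rho * x) * M @[x --> +oo] --> (0 : R).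
  by rewrite -[X in _ --> X](mul0r M); apply: cvgMl.
apply: (@squeeze_cvgr _ _ _ _ (fun x => - (expR (- rho * x) * M)) (fun x => expR (- rho * x) * M)) => //.
  apply: filterS near0 => r r0; rewrite -ler_norml normrM ger0_norm ?expR_ge0//.
  rewrite ler_wpM2l ?expR_ge0// gE; last by split => //; rewrite Too leey.
  by apply: ghatM; split; rewrite ?lee_fin// Too leey.
by rewrite -oppr0; exact: cvgN.
Qed.

End model.

Lemma weak_cvg_weakly_in_probability d (Omega : measurableType d) (R : realType) (P : probability Omega R)
    (T : \bar R) (G : set (set Omega)) (mn : nat -> random_law T G) (m : random_law T G) :
  (forall w, weak_cvg T (fun n => mn n w) (m w)) -> cvg_weakly_in_probability P mn m.
Proof.
move=> wc phi phi_incr; exists id => //; apply: aeW => w f cf bf.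
have phi_ge n : (n <= phi n)%N.
  by elim: n => // n IH; apply: leq_ltn_trans IH (phi_incr _ _ _).
have phioo : phi n @[n --> \oo] --> \oo.
  move=> A [N _ NA]; exists N => // n /= Nn; apply: NA => /=.
  exact: leq_trans Nn (phi_ge n).
exact: (cvg_comp _ _ phioo (wc w f cf bf)).
Qed.

(** * The abstract hypotheses on the payoff, verified for the game *)

Section equilibrium_model.
Context (R : realType) (T : \bar R) (rho : R)
    (d : measure_display) (Omega : measurableType d) (P : probability Omega R)
    (F : \bar R -> set (set Omega)) (G : set (set Omega))
    (h g : Omega -> \bar R -> random_law T G -> R)
    (ghat : \bar R -> R -> R) (hhat : \bar R -> path_space T -> R)
    (X : random_law T G -> Omega -> path_space T) (M : R).
Local Notation RR := (measurableTypeR R).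
Hypotheses (T0 : (0 <= T)%E) (rho0 : 0 < rho).
Hypothesis filtF : is_filtration T F.
Hypothesis h_prog : forall m, progressive T F (fun w t => h w t m).
Hypothesis h_int : forall m,
  (\int[P]_w \int[lebesgue_measure]_(t in fin_time T) (dexp rho t%:E * `|h w t%:E m|)%:E < +oo)%E.
Hypothesis ghat_cont : {within time_set T `*` [set: R], continuous (fun z => ghat z.1 z.2)}.
Hypothesis ghatM : forall t x, time_set T t -> `|ghat t x| <= M.
Hypothesis X_adapted : forall m (s : fin_time T), measurable_wrt (F (\val s)%:E) (fun w => X m w s).
Hypothesis hX : forall m w t, time_set T t -> h w t m = hhat t (X m w).
Hypothesis gX : forall m w (s : fin_time T), g w (\val s)%:E m = ghat (\val s)%:E (X m w s).

Definition running_rate m w r : R := dexp rho r%:E * h w r%:E m.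
Definition terminal_reward m w t : R := obstacle rho ghat (X m w) t.
Definition model_payoff m w t : R := payoff T (running_rate m) (terminal_reward m) w t.

Definition model_dist m1 m2 w : \bar R :=
  (d_C (X m1 w) (X m2 w)
   + ereal_sup [set (dexp rho (\val s)%:E *
       `|ghat (\val s)%:E (X m1 w s) - ghat (\val s)%:E (X m2 w s)|)%:E | s in [set: fin_time T]]
   + \int[lebesgue_measure]_(t in fin_time T)
       (dexp rho t%:E * `|hhat t%:E (X m1 w) - hhat t%:E (X m2 w)|)%:E)%E.

Let mk m : measurable_fun ([set: Omega] `*` (fin_time T : set RR)) (fun z : Omega * RR => running_rate m z.1 z.2).
Proof. exact: (measurable_progressive rho T0 filtF (h_prog m)). Qed.

Let k_int m : (\int[P]_w running_abs T (running_rate m) w < +oo)%E.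
Proof.
rewrite (_ : (fun w => _) = (fun w =>
  (\int[lebesgue_measure]_(t in fin_time T) (dexp rho t%:E * `|h w t%:E m|)%:E)%E)) //.
apply/funext => w; apply: eq_integral => r _.
by rewrite /running_rate normrM ger0_norm// expR_ge0.
Qed.

Let mo m : measurable_fun ([set: Omega] `*` time_set T) (fun z : Omega * \bar R => terminal_reward m z.1 z.2).
Proof. by apply: (measurable_obstacle T0 rho0 ghat_cont ghatM filtF); exact: X_adapted. Qed.

Let obs_cont m w : {within time_set T, continuous (terminal_reward m w)}.
Proof. exact: (obstacle_continuous rho0 ghat_cont ghatM). Qed.

Lemma bound_ge0 : 0 <= M.
Proof. by apply: le_trans (ghatM 0 (time_set0 T0)); exact: normr_ge0. Qed.

Let obsM m w t : time_set T t -> `|terminal_reward m w t| <= M.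
Proof.
move=> Tt; apply: le_trans (obstacle_le rho0 ghatM _ Tt) _.
have /andP[d0 d1] := dexp01 rho0 Tt.1.
by rewrite -[leRHS]mul1r ler_wpM2r// bound_ge0.
Qed.

Lemma measurable_model_payoff m :
  measurable_fun ([set: Omega] `*` time_set T) (fun z : Omega * \bar R => model_payoff m z.1 z.2).
Proof. exact: measurable_payoff. Qed.

Lemma model_payoff_continuous m w : {within time_set T, continuous (model_payoff m w)}.
Proof. by apply: payoff_continuous; [exact: mk|exact: obs_cont]. Qed.

Lemma model_payoff_bound m : exists2 K : Omega -> R, P.-integrable setT (EFin \o K) &
  forall w t, time_set T t -> `|model_payoff m w t| <= K w.
Proof.
exists (payoff_bound T (running_rate m) M); first exact: integrable_payoff_bound.
by move=> w t Tt; exact: (payoff_le (mk m) (@obsM m) w Tt).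
Qed.

Lemma model_dist_ge0 m1 m2 w : (0 <= model_dist m1 m2 w)%E.
Proof.
apply: adde_ge0; last by apply: integral_ge0 => r _; rewrite lee_fin mulr_ge0// expR_ge0.
apply: adde_ge0; first exact: d_C_ge0.
have T00 : fin_time T 0 by split.
apply: le_ereal_sup_tmp; exists (dexp rho 0%:E * `|ghat 0%:E (X m1 w (exist _ 0 (mem_set T00)))
    - ghat 0%:E (X m2 w (exist _ 0 (mem_set T00)))|)%:E.
  by exists (exist _ 0 (mem_set T00)).
by rewrite lee_fin mulr_ge0// expR_ge0.
Qed.

Lemma model_payoff_dist m1 m2 w t : tame T (running_rate m1) w -> tame T (running_rate m2) w -> time_set T t ->
  (`|model_payoff m1 w t - model_payoff m2 w t|%:E <= model_dist m1 m2 w)%E.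
Proof.
move=> t1 t2 Tt.
have i1 := tame_integrable (mk m1) t1; have i2 := tame_integrable (mk m2) t2.
have sub : (fin_time t : set RR) `<=` fin_time T := fin_time_sub Tt.2.
have mt := measurable_fin_time t; have mT := measurable_fin_time T.
have j1 : lebesgue_measure.-integrable (fin_time t : set RR) (EFin \o running_rate m1 w).
  exact: (integrableS mT mt sub i1).
have j2 : lebesgue_measure.-integrable (fin_time t : set RR) (EFin \o running_rate m2 w).
  exact: (integrableS mT mt sub i2).
have j12 : lebesgue_measure.-integrable (fin_time t : set RR) (EFin \o (fun r => running_rate m1 w r - running_rate m2 w r)).
  by have := integrableB mt j1 j2.
have i12 : lebesgue_measure.-integrable (fin_time T : set RR) (EFin \o (fun r => running_rate m1 w r - running_rate m2 w r)).
  by have := integrableB mT i1 i2.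
rewrite /model_payoff /payoff !indicE !mem_set// !mul1r.
rewrite opprD addrACA.
apply: (@le_trans _ _ (`|fine (running (running_rate m1) w t) - fine (running (running_rate m2) w t)|%:E
   + `|terminal_reward m1 w t - terminal_reward m2 w t|%:E)%E).
  by rewrite -EFinD lee_fin ler_normD.
rewrite /model_dist addeC; apply: leeD.
  rewrite -[leLHS]add0e; apply: leeD; first exact: d_C_ge0.
  rewrite /terminal_reward /obstacle; case: t Tt {sub mt j1 j2 j12} => [r| |] Tt.
  - have rT : fin_time T r by case: Tt => r0 rT; split; rewrite -?lee_fin.
    rewrite -[r]/(\val (exist (fun x => x \in fin_time T) r (mem_set rT))) !path_ext_val.
    rewrite -mulrBr normrM ger0_norm ?expR_ge0//.
    by apply: ereal_sup_ubound; exists (exist (fun x => x \in fin_time T) r (mem_set rT)).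
  (* At infinite time the obstacle terms cancel, and the supremum is nonnegative, as its term at
     time 0 shows. *)
  - rewrite subrr normr0.
    have T00 : fin_time T 0 by split.
    apply: le_ereal_sup_tmp; exists (dexp rho 0%:E * `|ghat 0%:E (X m1 w (exist _ 0 (mem_set T00)))
      - ghat 0%:E (X m2 w (exist _ 0 (mem_set T00)))|)%:E.
      by exists (exist _ 0 (mem_set T00)).
    by rewrite lee_fin mulr_ge0// expR_ge0.
  - by case: Tt.
have -> : fine (running (running_rate m1) w t) - fine (running (running_rate m2) w t) =
    \int[lebesgue_measure]_(r in fin_time t) (running_rate m1 w r - running_rate m2 w r).
  by rewrite RintegralB.
have j12n := integrable_norm j12.
apply: (@le_trans _ _ (\int[lebesgue_measure]_(r in fin_time t) `|running_rate m1 w r - running_rate m2 w r|%:E)%E).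
  have := le_normr_Rintegral mt j12; rewrite -lee_fin => /le_trans; apply.
  rewrite /Rintegral fineK//; exact: integrable_fin_num j12n.
apply: (@le_trans _ _ (\int[lebesgue_measure]_(r in fin_time T) `|running_rate m1 w r - running_rate m2 w r|%:E)%E).
  apply: ge0_subset_integral; [exact: mt|exact: mT| | |exact: sub].
  - by case/integrableP: (integrable_norm i12).
  - by move=> r _; rewrite lee_fin.
rewrite le_eqVlt; apply/orP; left; apply/eqP; apply: eq_integral => r /set_mem rT.
have Tr := fin_time_time_set rT.
by rewrite /running_rate !hX// -mulrBr normrM ger0_norm// expR_ge0.
Qed.

Let tame_both m1 m2 : P (~` (tame T (running_rate m1) `&` tame T (running_rate m2))) = 0%E.
Proof.
have mt m := measurable_tame (mk m).
rewrite setCI; apply/eqP; rewrite eq_le measure_ge0 andbT.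
apply: le_trans (measureU2 _ _ _) _; [by apply: measurableC; exact: mt|by apply: measurableC; exact: mt|].
rewrite [X in (X + _ <= _)%E](_ : _ = 0%E); last exact: (tame_ae (mk m1) (k_int m1)).
by rewrite [X in (_ + X <= _)%E](_ : _ = 0%E) ?adde0//; exact: (tame_ae (mk m2) (k_int m2)).
Qed.

Hypothesis stable : forall (mn : nat -> random_law T G) (minf : random_law T G),
  cvg_weakly_in_probability P mn minf ->
  (\int[P]_w model_dist (mn n) minf w)%E @[n --> \oo] --> 0%E.

(** The expectation of [model_dist] bounds the difference of values and involves no stopping time;
    this is where uniformity over [sg] comes from. *)
Lemma model_value_stable (mn : nat -> random_law T G) (m : random_law T G) :
  (forall w, weak_cvg T (fun n => mn n w) (m w)) -> forall e : R, 0 < e ->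
  \forall n \near \oo, forall sg : {mfun (Omega * RR)%type >-> \bar R}, timed T sg ->
    `|value P model_payoff (mn n) sg - value P model_payoff m sg| <= e.
Proof.
move=> wc e e0; have s := stable (weak_cvg_weakly_in_probability P wc).
have e0' : (0 < e%:E)%E by rewrite lte_fin.
apply: filterS (cvg_seq_gt s e0') => n ne sg tsg.
rewrite -lee_fin; apply: le_trans (ltW ne).
apply: (value_dist_le T0 measurable_model_payoff model_payoff_continuous model_payoff_bound
  (A := tame T (running_rate (mn n)) `&` tame T (running_rate m)) tsg).
- by apply: measurableI; apply: measurable_tame; exact: mk.
- exact: tame_both.
- by move=> w; exact: model_dist_ge0.
- by move=> w t [t1 t2] Tt; exact: model_payoff_dist.
Qed.

Lemma reward_value m sigma (sg : {mfun (Omega * RR)%type >-> \bar R}) :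
  randomized_stopping_time T F sigma -> (forall z, sg z = clamp_ext sigma z) ->
  reward P rho h g sigma m = (value P model_payoff m sg)%:E.
Proof.
move=> rs sgE.
have tsg : timed T sg by move=> z; rewrite sgE; exact: clamp_ext_time rs.
rewrite (valueE T0 measurable_model_payoff model_payoff_continuous model_payoff_bound)//.
have := integral_running_obstacle (mk m) (k_int m) (mo m) tsg.
rewrite /model_payoff => <-; rewrite /reward.
apply: eq_integral => z /set_mem tz.
rewrite sgE clamp_ext_id// /running; congr (_ + _)%E.
have [rT _ _ _] := rs.
exact: (discounted_obstacle rho0 ghatM (gX m) z.1 (rT z tz)).
Qed.

End equilibrium_model.

Theorem theorem3p10 (R : realType) (T : \bar R) (rho : R)
    (d : measure_display) (Omega : measurableType d) (P : probability Omega R)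
    (F : \bar R -> set (set Omega)) (G : set (set Omega))
    (h g : Omega -> \bar R -> random_law T G -> R)
    (ghat : \bar R -> R -> R) (hhat : \bar R -> path_space T -> R)
    (X : random_law T G -> Omega -> path_space T) :
  (0 <= T)%E -> 0 < rho ->
  is_filtration T F -> usual_conditions P T F ->
  generated_by_countable_partition P G ->
  (* (i) *)
  (forall m, let Y := discounted rho (fun w t => g w t m) in
     [/\ optional T F Y, class_D P T F Y, usc_in_expectation P T F Y &
         left_usc_paths P T Y]) ->
  (* (ii) *)
  (forall m, progressive T F (fun w t => h w t m) /\
     (\int[P]_w \int[lebesgue_measure]_(t in fin_time T)
        (dexp rho t%:E * `|h w t%:E m|)%:E < +oo)%E) ->
  (* (a) *)
  {within time_set T `*` [set: R], continuous (fun z => ghat z.1 z.2)} ->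
  (exists M, forall t x, time_set T t -> `|ghat t x| <= M) ->
  (forall m (s : fin_time T),
     measurable_wrt (F (\val s)%:E) (fun w => X m w s)) ->
  (forall m w t, time_set T t -> h w t m = hhat t (X m w)) ->
  (forall m w (s : fin_time T),
     g w (\val s)%:E m = ghat (\val s)%:E (X m w s)) ->
  (T = +oo%E -> forall m w, g w +oo%E m = 0) ->
  (* (b) *)
  (forall (mn : nat -> random_law T G) (minf : random_law T G),
     cvg_weakly_in_probability P mn minf ->
     (\int[P]_w
        (d_C (X (mn n) w) (X minf w)
         + ereal_sup [set (dexp rho (\val s)%:E *
             `|ghat (\val s)%:E (X (mn n) w s)
               - ghat (\val s)%:E (X minf w s)|)%:E | s in [set: fin_time T]]
         + \int[lebesgue_measure]_(t in fin_time T)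
             (dexp rho t%:E *
              `|hhat t%:E (X (mn n) w) - hhat t%:E (X minf w)|)%:E))%E
       @[n --> \oo] --> 0%E) ->
  exists (mstar : random_law T G) (taustar : Omega * R -> \bar R),
    [/\ randomized_stopping_time T F taustar,
        (ereal_sup [set reward P rho h g tau mstar |
                     tau in randomized_stopping_time T F]
         <= reward P rho h g taustar mstar)%E &
        conditional_law P taustar mstar].
Proof.
move=> T0 rho0 filtF usualF /partition_index[idx [G_idx G_measurable G_char cell_pos]].
move=> _ hP ghat_cont [M ghatM] X_adapted hX gX _ stable.
have h_prog m := (hP m).1; have h_int m := (hP m).2.
have pay_cont m w : {within time_set T, continuous (model_payoff rho h ghat X m w)}.
  exact: (model_payoff_continuous T0 rho0 filtF h_prog ghat_cont ghatM).
have [m [tau [x [rs cl xE xopt]]]] := exists_equilibrium T0 filtF usualF G_idx G_measurable G_char cell_pos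
  (measurable_model_payoff T0 rho0 filtF h_prog ghat_cont ghatM X_adapted)
  pay_cont
  (model_payoff_bound X T0 rho0 filtF h_prog h_int ghatM)
  (model_value_stable T0 rho0 filtF h_prog h_int ghat_cont ghatM X_adapted hX stable).
exists m, tau; split => //.
have rv := reward_value T0 rho0 filtF h_prog h_int ghat_cont ghatM X_adapted gX.
(* Every reward is the real value of the strategy given by the clamped extension, so optimality
   among strategies is optimality among randomized stopping times. *)
rewrite (rv _ _ _ rs xE); apply: ge_ereal_sup => _ [sigma rsigma <-].
have [y yE] := mk_strategy filtF rsigma.
by rewrite (rv _ _ _ rsigma yE) lee_fin; exact: xopt.
Qed.
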